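(* Assume that the simple Lie algebra $\bar{\mathfrak g}$ is not of type $G_2$, and let $q$ be an arbitrary nonzero complex number. Let $V$ be a highest weight module over $U_q\mathfrak g$, let $v\in V$ and $\xi\in V^*$ be weight vectors, let $n_1,\dots,n_r\ge 0$ be integers, put $I_\alpha=\{1,\dots,n_\alpha\}$, and let $$f(z^{(\alpha)}_i)=\Big\langle \xi,\ \prod_{\alpha=1}^r\prod_{i\in I_\alpha} e_\alpha(z^{(\alpha)}_i)\,v\Big\rangle ,$$ a formal series in $\mathbb C[[z_i^{(\alpha)},z_i^{(\alpha)-1}]]$, the product being ordered with $\alpha$ increasing and, for each $\alpha$, $i$ increasing. Then: 1) $f$ belongs to $\mathbb C((z^{(1)}_1))((z^{(1)}_2))\cdots((z^{(r)}_{n_r}))$. 2) $f$ is the expansion of a rational function on $\prod_\alpha(\mathbb C^\times)^{I_\alpha}$, regular everywhere except for simple poles on the shifted diagonals $q_\alpha^{a_{\alpha\beta}}z^{(\alpha)}_i=z^{(\beta)}_j$ (for $\alpha<\beta$, or $\alpha=\beta$ and $i<j$), or when some $z^{(\alpha)}_i$ meets the origin. It satisfies the twisted symmetry relations $$(q_\alpha^2z^{(\alpha)}_i-z^{(\alpha)}_{j})\,f=(z^{(\alpha)}_i-q_\alpha^2z^{(\alpha)}_{j})\,(\sigma^{(\alpha)}_{ij}f),\qquad j=i+1,\quad i,j\in I_\alpha,$$ where $\sigma^{(\alpha)}_{ij}$ is the interchange of the variables $z^{(\alpha)}_i$ and $z^{(\alpha)}_j$. In other words, $f$ has the form $$f(z^{(\alpha)}_i)=\frac{\prod_\alpha\prod_{i,j\in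 I_\alpha,\ i<j}(z^{(\alpha)}_i-z^{(\alpha)}_j)}{\prod_{\alpha\le\beta}\ \prod_{i\in I_\alpha,\,j\in I_\beta,\ i<j\text{ if }\alpha=\beta}(q_\alpha^{a_{\alpha\beta}}z^{(\alpha)}_i-z^{(\beta)}_j)}\,A(z^{(\alpha)}_i),$$ where $A$ is a Laurent polynomial in $\mathbb C[z^{(\alpha)}_i,z^{(\alpha)-1}_i]$, symmetric in the variables $(z^{(\alpha)}_i)_{i\in I_\alpha}$ for each $\alpha$. 3) Moreover, for any $\alpha\neq\beta$, any $j\in I_\beta$ and any pairwise different elements $i_1,\dots,i_{1-a_{\alpha\beta}}$ of $I_\alpha$, $$A(z^{(\alpha)}_i)=0\quad\text{when}\quad z^{(\alpha)}_{i_1}=q_\alpha^2z^{(\alpha)}_{i_2}=\cdots=q_\alpha^{-2a_{\alpha\beta}}z^{(\alpha)}_{i_{1-a_{\alpha\beta}}}=q_\alpha^{-a_{\alpha\beta}}z^{(\beta)}_j .\qquad( * )$$ In other words, $f$ has the form $$f(z^{(\alpha)}_i)=\frac{\prod_\alpha\prod_{i,j\in I_\alpha,\ i<j}(z^{(\alpha)}_i-z^{(\alpha)}_j)}{\prod_{\alpha\le\beta,\ a_{\alpha\beta}\ne0}\ \prod_{i\in I_\alpha,\,j\in I_\beta,\ i<j\text{ if }\alpha=\beta}(q_\alpha^{a_{\alpha\beta}}z^{(\alpha)}_i-z^{(\beta)}_j)}\,B(z^{(\alpha)}_i),$$ where $B\in\mathbb C[z^{(\alpha)}_i,z^{(\alpha)-1}_i]$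 satisfies the vanishing conditions $( * )$ (with $A$ replaced by $B$) for all $\alpha\neq\beta$ such that $a_{\alpha\beta}\neq0$.
   Context: $\bar{\mathfrak g}$ is a simple finite-dimensional complex Lie algebra of rank $r$, with simple roots indexed by $\{1,\dots,r\}$ and Cartan matrix $(a_{\alpha\beta})_{1\le\alpha,\beta\le r}$; $d_\alpha$ are the symmetrizing factors (the standard positive integers such that $(d_\alpha a_{\alpha\beta})$ is symmetric) and $q_\alpha=q^{d_\alpha}$. $\mathfrak g$ is the (untwisted) affinization of $\bar{\mathfrak g}$, and $U_q\mathfrak g$ the associated quantum affine algebra in Drinfeld's new realization. Its positive nilpotent currents are $e_\alpha(z)=\sum_{n\in\mathbb Z}e_\alpha[n]z^{-n}$, and they satisfy the vertex relations $$(q_\alpha^{a_{\alpha\beta}}z-w)\,e_\alpha(z)e_\beta(w)=(z-q_\alpha^{a_{\alpha\beta}}w)\,e_\beta(w)e_\alpha(z)$$ and, for $\alpha\ne\beta$, the quantum Serre relations $$\sum_{s=0}^{1-a_{\alpha\beta}}(-1)^s\begin{bmatrix}1-a_{\alpha\beta}\\ s\end{bmatrix}_{q_\alpha}\operatorname{Sym}_{z_1\cdots z_{1-a_{\alpha\beta}}}\big(e_\alpha(z_1)\cdots e_\alpha(z_s)e_\beta(w)e_\alpha(z_{s+1})\cdots e_\alpha(z_{1-a_{\alpha\beta}})\big)=0,$$ where $\begin{bmatrix}n\\ p\end{bmatrix}_q=\frac{[n]^!_q}{[p]^!_q[n-p]^!_q}$, $[n]^!_q=[1]_q\cdots[n]_q$,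 $[n]_q=\frac{q^n-q^{-n}}{q-q^{-1}}$, and $\operatorname{Sym}$ is the sum over all permutations of the variables. $U_q\mathfrak g$ carries the homogeneous gradation, in which $e_\alpha[n]$ has degree $n$. A highest weight module $V$ is graded, $V=\bigoplus_{i\le i_0}V_i$, compatibly with this gradation; weight vectors $v\in V$ and $\xi\in V^*$ are in particular homogeneous for it ($v$ lies in some $V_j$, and $\xi$ is nonzero on at most one $V_i$). $\mathbb C[[z_1,z_1^{-1},\dots,z_n,z_n^{-1}]]$ is the space of all formal series $\sum u_{i_1\dots i_n}z_1^{i_1}\cdots z_n^{i_n}$, $i_k\in\mathbb Z$, without restriction. For a ring $R$, $R((z))=R[[z]][z^{-1}]$. The space $\mathbb C((z^{(1)}_1))((z^{(1)}_2))\cdots((z^{(r)}_{n_r}))$ is formed iteratively, with variables ordered as $z^{(1)}_1,\dots,z^{(1)}_{n_1},z^{(2)}_1,\dots,z^{(r)}_{n_r}$; rational functions are expanded in it with each variable much smaller than the preceding ones. *)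

(* Defs.v *)
From HB Require Import structures.
From mathcomp Require Import all_boot all_order all_fingroup all_algebra.
From mathcomp Require Import ring.
From mathcomp Require Import reals complex mpoly.

Set Implicit Arguments.
Unset Strict Implicit.
Unset Printing Implicit Defensive.

Import Order.TTheory GRing.Theory Num.Theory.
Local Open Scope ring_scope.

(* The simple complex Lie algebra enters through its Cartan matrix [A], with an
   arbitrary numbering of the simple roots: [A] runs over the indecomposable
   Cartan matrices of finite type.  [d] is the standard symmetrizer, i.e. the
   one with coprime entries; the form [d_a * A a b] is the invariant form on
   the root lattice, and finite type means that it is positive definite. *)
Record simple_cartan (r : nat) (A : 'M[int]_r) (d : 'I_r -> nat) : Prop :=
  SimpleCartan {
  cartan_rank : (0 < r)%N;
  cartan_diag : forall a, A a a = 2;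
  cartan_offdiag : forall a b, a != b -> A a b <= 0;
  cartan_zero : forall a b, A a b = 0 -> A b a = 0;
  cartan_indecomposable : forall S : {set 'I_r}, S != set0 -> S != [set: 'I_r] ->
    exists a b, [/\ a \in S, b \notin S & A a b != 0];
  symmetrizer_pos : forall a, (0 < d a)%N;
  symmetrizer_sym : forall a b, (d a)%:Z * A a b = (d b)%:Z * A b a;
  symmetrizer_coprime : \big[gcdn/0%N]_a d a = 1%N;
  cartan_finite : forall x : 'rV[int]_r, x != 0 ->
    0 < \sum_a \sum_b (d a)%:Z * A a b * x ord0 a * x ord0 b }.

Definition G2_matrix : 'M[int]_2 :=
  \matrix_(i, j) (if i == j then 2 else if i == ord0 then -1 else -3).

Definition type_G2 (r : nat) (A : 'M[int]_r) : Prop :=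
  exists2 s : 'I_r -> 'I_2, bijective s & forall a b, A a b = G2_matrix (s a) (s b).

(* q-integers and q-binomials are Laurent polynomials in q.  The forms used here
   make sense for every q <> 0, including roots of unity, where the defining
   quotients may be 0/0; [qintE] and [qbinomE] relate them to those quotients. *)
Section QNumbers.
Variable C : fieldType.
Implicit Type q : C.

Definition qint q (n : nat) : C := \sum_(k < n) q ^ (n%:Z - 1 - (2 * k)%N%:Z).

Definition qfact q (n : nat) : C := \prod_(k < n) qint q k.+1.

Fixpoint qbinom q (n p : nat) : C :=
  match n, p with
  | _, 0%N => 1
  | 0%N, _.+1 => 0
  | n'.+1, p'.+1 => q ^ p%:Z * qbinom q n' p + q ^ (p%:Z - n%:Z) * qbinom q n' p'
  end.

Lemma qintE q n : q != 0 -> (q - q^-1) * qint q n = q ^ n%:Z - q ^ (- n%:Z).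
Proof.
move=> q0; have -> : q - q^-1 = q ^ 1 - q ^ (-1) by rewrite expr1z exprN1.
rewrite mulr_sumr.
rewrite (eq_bigr (fun k : 'I_n =>
  - (q ^ (n%:Z - (2 * k.+1)%N%:Z) - q ^ (n%:Z - (2 * k)%N%:Z)))); last first.
  move=> k _; rewrite opprB mulrBl -!expfzDr //.
  by congr (q ^ _ - q ^ _); rewrite ?mulnS ?PoszD; ring.
rewrite sumrN -(big_mkord xpredT (fun k =>
  q ^ (n%:Z - (2 * k.+1)%N%:Z) - q ^ (n%:Z - (2 * k)%N%:Z))).
rewrite telescope_sumr // opprB muln0 subr0 mul2n -addnn PoszD.
by congr (_ - q ^ _); ring.
Qed.

Lemma qintD q m n : q != 0 ->
  qint q (m + n) = q ^ n%:Z * qint q m + q ^ (- m%:Z) * qint q n.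
Proof.
move=> q0; rewrite /qint big_split_ord !mulr_sumr /=.
by congr (_ + _); apply: eq_bigr => k _; rewrite -expfzDr //; congr (q ^ _);
  rewrite ?mulnDr !PoszD ?PoszM; ring.
Qed.

Lemma qbinom_small q n p : (n < p)%N -> qbinom q n p = 0.
Proof.
elim: n p => [|n IHn] [|p] //= lt_np.
by rewrite !IHn ?mulr0 ?addr0 // ltnW.
Qed.

Lemma qbinomE q n p : q != 0 -> (p <= n)%N ->
  qbinom q n p * (qfact q p * qfact q (n - p)) = qfact q n.
Proof.
move=> q0; have qfS k : qfact q k.+1 = qfact q k * qint q k.+1.
  by rewrite /qfact big_ord_recr.
have qf0 : qfact q 0 = 1 by rewrite /qfact big_ord0.
elim: n p => [|n IHn] [|p] // le_pn; rewrite ?subn0 /= ?qf0 ?mul1r ?mulr1 //.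
rewrite subSS; have {}le_pn : (p <= n)%N by [].
have step1 : qbinom q n p.+1 * (qfact q p.+1 * qfact q (n - p)) =
    qint q (n - p) * qfact q n.
  have [lt_pn|le_np] := ltnP p n; last first.
    have -> : (n - p = 0)%N by apply/eqP; rewrite subn_eq0.
    by rewrite qbinom_small // /qint big_ord0 !mul0r.
  by rewrite -(IHn p.+1 lt_pn) -[(n - p)%N]prednK ?subn_gt0 //
    (qfS (n - p).-1) -subnS; ring.
have step2 : qbinom q n p * (qfact q p.+1 * qfact q (n - p)) =
    qint q p.+1 * qfact q n.
  by rewrite -(IHn p le_pn) qfS; ring.
rewrite mulrDl -!mulrA step1 step2 qfS !mulrA -mulrDl mulrC; congr (_ * _).
rewrite -[in RHS](subnK (_ : p.+1 <= n.+1)%N) // subSS qintD //.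
by congr (_ * _ + q ^ _ * _); rewrite -subzn //; ring.
Qed.

End QNumbers.

(* The Drinfeld generators acting on a module on which the central element q^c
   acts by the scalar [level] (as it does on any highest weight module).
   The currents are e_a(z) = sum_n e_a[n] z^-n, and likewise for f_a, K+_a and
   K-_a. *)
Record drinfeld_ops (C : fieldType) (r : nat) (V : lmodType C) := DrinfeldOps {
  e_op : 'I_r -> int -> {linear V -> V};
  f_op : 'I_r -> int -> {linear V -> V};
  Kp_op : 'I_r -> int -> {linear V -> V};
  Km_op : 'I_r -> int -> {linear V -> V};
  level : C }.

Section Modules.
Variables (C : fieldType) (r : nat) (V : lmodType C).

(* Coefficient of z^-m w^-n, for all m and n, of
   (a z - b w) x(z) y(w) = (c z - d w) y(w) x(z). *)
Definition exchange (a b c d : C) (x y : int -> {linear V -> V}) : Prop :=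
  forall (m n : int) (u : V),
    a *: x (m + 1) (y n u) - b *: x m (y (n + 1) u) =
    c *: y n (x (m + 1) u) - d *: y (n + 1) (x m u).

Definition apply_word (w : seq (V -> V)) (u : V) : V := foldr (fun g => g) u w.

(* Coefficient of z_1^-(k_1) ... z_N^-(k_N) w^-l in the quantum Serre relation
   for x = e_a, y = e_b, p = q_a and aab = a_{ab}, with N = 1 - a_{ab}. *)
Definition serre (p : C) (aab : int) (x y : int -> {linear V -> V}) : Prop :=
  let N := `|1 - aab|%N in
  forall (k : 'I_N -> int) (l : int) (u : V),
    \sum_(s < N.+1) (-1) ^+ s * qbinom p N s *:
      \sum_(g : 'S_N)
        apply_word ([seq (x (k (g i)) : V -> V) | i <- take s (enum 'I_N)] ++
                    (y l : V -> V) ::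
                    [seq (x (k (g i)) : V -> V) | i <- drop s (enum 'I_N)]) u
    = 0.

Variables (A : 'M[int]_r) (d : 'I_r -> nat) (q : C).

Definition qroot (a : 'I_r) : C := q ^+ d a.

(* Drinfeld's relations, in the normalization
     (Q z - w) e_a(z) e_b(w) = (z - Q w) e_b(w) e_a(z).
   The half-currents satisfy
     [K+_a(z), K+_b(w)] = [K-_a(z), K-_b(w)] = 0,
     (z - Q^-1 t^-1 w)(z - Q t w) K+_a(z) K-_b(w)
        = (z - Q^-1 t w)(z - Q t^-1 w) K-_b(w) K+_a(z),
     (q_a - q_a^-1) [e_a(z), f_b(w)]
        = delta_{ab} (delta(t z / w) K-_a(z) - delta(t w / z) K+_a(w)),
   where Q = q_a^(a_{ab}) and t = q^c; the Cartan generator usually written K_a is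
   K-_a[0], the inverse of K+_a[0].  All denominators, including q_a - q_a^-1,
   are cleared, so that the relations make sense for every q <> 0. *)
Record is_Uq_module (X : drinfeld_ops r V) : Prop := IsUqModule {
  level_neq0 : level X != 0;
  Kp_neg : forall a n u, n < 0 -> Kp_op X a n u = 0;
  Km_pos : forall a n u, 0 < n -> Km_op X a n u = 0;
  Kp0Km0 : forall a u, Kp_op X a 0 (Km_op X a 0 u) = u;
  Km0Kp0 : forall a u, Km_op X a 0 (Kp_op X a 0 u) = u;
  KpKp : forall a b m n u,
    Kp_op X a m (Kp_op X b n u) = Kp_op X b n (Kp_op X a m u);
  KmKm : forall a b m n u,
    Km_op X a m (Km_op X b n u) = Km_op X b n (Km_op X a m u);
  KpKm : forall a b, let Q := qroot a ^ A a b in let t := level X in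
    forall m n u,
      Kp_op X a (m + 2) (Km_op X b n u)
      - (Q^-1 * t^-1 + Q * t) *: Kp_op X a (m + 1) (Km_op X b (n + 1) u)
      + Kp_op X a m (Km_op X b (n + 2) u)
      = Km_op X b n (Kp_op X a (m + 2) u)
      - (Q^-1 * t + Q * t^-1) *: Km_op X b (n + 1) (Kp_op X a (m + 1) u)
      + Km_op X b (n + 2) (Kp_op X a m u);
  Kp_e : forall a b, let Q := qroot a ^ A a b in let t := level X in
    exchange (Q * t) 1 t Q (Kp_op X a) (e_op X b);
  Kp_f : forall a b, let Q := qroot a ^ A a b in
    exchange 1 Q Q 1 (Kp_op X a) (f_op X b);
  Km_e : forall a b, let Q := qroot a ^ A a b in
    exchange Q 1 1 Q (Km_op X a) (e_op X b);
  Km_f : forall a b, let Q := qroot a ^ A a b in let t := level X in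
    exchange t Q (Q * t) 1 (Km_op X a) (f_op X b);
  e_e : forall a b, let Q := qroot a ^ A a b in
    exchange Q 1 1 Q (e_op X a) (e_op X b);
  f_f : forall a b, let Q := qroot a ^ A a b in
    exchange 1 Q Q 1 (f_op X a) (f_op X b);
  e_f : forall a b (m n : int) u,
    (qroot a - (qroot a)^-1) *: (e_op X a m (f_op X b n u) - f_op X b n (e_op X a m u))
    = if a == b then level X ^ n *: Km_op X a (m + n) u
                     - level X ^ m *: Kp_op X a (m + n) u
      else 0;
  serre_e : forall a b, a != b -> serre (qroot a) (A a b) (e_op X a) (e_op X b);
  serre_f : forall a b, a != b -> serre (qroot a) (A a b) (f_op X a) (f_op X b) }.

(* [pr i] is the projection of V onto its component V_i. *)
Definition homogeneous (pr : int -> {linear V -> V}) (i : int) (u : V) : Prop :=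
  pr i u = u.

Definition degree_op (pr : int -> {linear V -> V}) (n : int) (g : V -> V) : Prop :=
  forall i u, homogeneous pr i u -> homogeneous pr (i + n) (g u).

(* V = direct sum of the V_i, with V_i = 0 for i > i0, compatibly with the
   homogeneous gradation of U_q g. *)
Record graded_module (X : drinfeld_ops r V) (pr : int -> {linear V -> V})
    (i0 : int) : Prop := GradedModule {
  pr_orth : forall i j u, pr i (pr j u) = if i == j then pr i u else 0;
  pr_sum : forall u, exists2 s : seq int, uniq s & u = \sum_(i <- s) pr i u;
  pr_bound : forall i u, i0 < i -> pr i u = 0;
  e_degree : forall a n, degree_op pr n (e_op X a n);
  f_degree : forall a n, degree_op pr n (f_op X a n);
  Kp_degree : forall a n, degree_op pr n (Kp_op X a n);
  Km_degree : forall a n, degree_op pr n (Km_op X a n) }.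

Definition generated_by (X : drinfeld_ops r V) (v0 : V) : Prop :=
  forall P : V -> Prop,
    P v0 ->
    (forall (c : C) u w, P u -> P w -> P (c *: u + w)) ->
    (forall a n u, P u ->
       [/\ P (e_op X a n u), P (f_op X a n u), P (Kp_op X a n u)
         & P (Km_op X a n u)]) ->
    forall u, P u.

(* The positive affine root vectors are the e_a[n] with n >= 0, the f_a[n] and
   the K+_a[n] with n > 0, and their commutators. *)
Record highest_weight_vector (X : drinfeld_ops r V) (v0 : V) : Prop :=
  HighestWeightVector {
  hw_neq0 : v0 != 0;
  hw_e : forall a n, 0 <= n -> e_op X a n v0 = 0;
  hw_f : forall a n, 0 < n -> f_op X a n v0 = 0;
  hw_Kp : forall a n, 0 < n -> Kp_op X a n v0 = 0;
  hw_weight : forall a, exists c : C, Km_op X a 0 v0 = c *: v0 }.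

Definition highest_weight_module (X : drinfeld_ops r V)
    (pr : int -> {linear V -> V}) : Prop :=
  is_Uq_module X /\
  exists (i0 : int) (v0 : V),
    [/\ graded_module X pr i0, homogeneous pr i0 v0,
        highest_weight_vector X v0 & generated_by X v0].

Definition weight_vector (X : drinfeld_ops r V) (pr : int -> {linear V -> V})
    (v : V) : Prop :=
  (exists i, homogeneous pr i v) /\
  (forall a, exists c : C, Km_op X a 0 v = c *: v).

Definition weight_form (X : drinfeld_ops r V) (pr : int -> {linear V -> V})
    (xi : {scalar V}) : Prop :=
  (exists i, forall j u, j != i -> homogeneous pr j u -> xi u = 0) /\
  (forall a, exists c : C, forall u, xi (Km_op X a 0 u) = c * xi u).

End Modules.

Notation "x %:F" := (FracField.tofrac x) : ring_scope.

Section Series.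
Variables (C : fieldType) (N : nat).

Definition exponent := {ffun 'I_N -> int}.

(* C[[z_1, z_1^-1, ..., z_N, z_N^-1]]: [f m] is the coefficient of z^m. *)
Definition series := exponent -> C.

Definition one_series : series := fun m => (m == 0)%:R.

Definition mul_series (P : {mpoly C[N]}) (f : series) : series := fun m =>
  \sum_(k <- msupp P) P@_k * f [ffun i => m i - (k i)%:Z].

Definition perm_series (s : 'S_N) (f : series) : series :=
  fun m => f [ffun i => m (s i)].

(* [Laurent p k] is the Laurent polynomial p / (z_1 ... z_N)^k. *)
Record laurent := Laurent { lnum : {mpoly C[N]}; lexp : nat }.

Definition laurent_frac (L : laurent) : {fraction {mpoly C[N]}} :=
  (lnum L)%:F / ((\prod_(i < N) 'X_i) ^+ lexp L)%:F.

Definition laurent_eval (L : laurent) (z : 'I_N -> C) : C :=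
  (lnum L).@[z] / (\prod_i z i) ^+ lexp L.

(* z_1 ... z_N is symmetric, so permuting the variables of [L] permutes those
   of its numerator. *)
Definition perm_laurent (s : 'S_N) (L : laurent) : laurent :=
  Laurent (msym s (lnum L)) (lexp L).

Definition perm_frac (s : 'S_N) (F : {fraction {mpoly C[N]}}) :
    {fraction {mpoly C[N]}} :=
  (msym s \n_(generic_quotient.repr F))%:F / (msym s \d_(generic_quotient.repr F))%:F.

End Series.

(* [iter_laurent f]: f lies in C((z_1))((z_2))...((z_N)).  A series in z_N with
   coefficients in C((z_1))...((z_(N-1))) has a lower bound on the exponent of
   z_N that is uniform over all its monomials. *)
Definition extend_exponent (N : nat) (m : exponent N) (k : int) : exponent N.+1 :=
  [ffun i => if unlift ord_max i is Some j then m j else k].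

Fixpoint iter_laurent (C : fieldType) (N : nat) : series C N -> Prop :=
  match N with
  | 0 => fun _ => True
  | N'.+1 => fun f =>
      (exists k0 : int, forall m : exponent N', forall k : int,
          k < k0 -> f (extend_exponent m k) = 0) /\
      (forall k : int, @iter_laurent C N' (fun m => f (extend_exponent m k)))
  end.

(* C((z_1))...((z_N)) is a field containing the polynomials, with each variable
   much smaller than the preceding ones, and the expansion in it of the rational
   function P / Q is its only element f such that Q f = P. *)
Definition expansion_of (C : fieldType) (N : nat)
    (F : {fraction {mpoly C[N]}}) (f : series C N) : Prop :=
  iter_laurent f /\
  exists P Q : {mpoly C[N]},
    [/\ Q != 0, F = P%:F / Q%:F
      & mul_series Q f =1 mul_series P (@one_series C N)].

(* The variable z^(a)_i has index [zvar i] in 'I_(\sum_a n a); this numbering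
   is the lexicographic one, z^(1)_1, ..., z^(1)_(n_1), z^(2)_1, ... *)
Section Correlation.
Variables (C : fieldType) (r : nat) (n : 'I_r -> nat).

Definition nvars : nat := (\sum_a n a)%N.

Definition zvar (a : 'I_r) (i : 'I_(n a)) : 'I_nvars := tagnat.Rank a i.

Definition zcolor (x : 'I_nvars) : 'I_r := tagnat.sig1 x.

Definition zpoly (a : 'I_r) (i : 'I_(n a)) : {mpoly C[nvars]} := 'X_(zvar i).

(* The coefficient of z^m in e_a(z) is e_a[-m]. *)
Definition correlation (V : lmodType C) (X : drinfeld_ops r V)
    (xi : {scalar V}) (v : V) : series C nvars := fun m =>
  xi (apply_word [seq (e_op X (zcolor x) (- m x) : V -> V) | x <- enum 'I_nvars] v).

Variables (A : 'M[int]_r) (d : 'I_r -> nat) (q : C).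

(* [cond] selects the pairs a <= b of simple roots that occur. *)
Definition diagonals (cond : 'I_r -> 'I_r -> bool) : {mpoly C[nvars]} :=
  \prod_(a < r) \prod_(b < r | (a <= b)%N && cond a b)
    \prod_(i < n a) \prod_(j < n b | (a == b) ==> (i < j)%N)
      ((qroot d q a ^ A a b) *: zpoly i - zpoly j).

Definition all_diagonals := diagonals (fun _ _ => true).

Definition linked_diagonals := diagonals (fun a b => A a b != 0).

Definition vandermonde : {mpoly C[nvars]} :=
  \prod_(a < r) \prod_(i < n a) \prod_(j < n a | (i < j)%N) (zpoly i - zpoly j).

Definition simple_poles (F : {fraction {mpoly C[nvars]}}) : Prop :=
  exists P : laurent C nvars, F * all_diagonals%:F = laurent_frac P.

Definition color_symmetric (L : laurent C nvars) : Prop :=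
  forall s : 'S_nvars, (forall x, zcolor (s x) = zcolor x) -> perm_laurent s L = L.

(* The condition at (z_1, ..., z_N) in the torus reads
   z_(i_1) = q_a^2 z_(i_2) = ... = q_a^(-2 a_{ab}) z_(i_(1-a_{ab}))
           = q_a^(-a_{ab}) z^(b)_j, with i_(k+1) given by [t k]. *)
Definition vanishing (L : laurent C nvars) (a b : 'I_r) : Prop :=
  forall (j : 'I_(n b)) (t : 'I_`|1 - A a b| -> 'I_(n a)) (z : 'I_nvars -> C),
    injective t -> (forall x, z x != 0) ->
    (forall k : 'I_`|1 - A a b|,
       qroot d q a ^+ (2 * k) * z (zvar (t k)) = qroot d q a ^ (- A a b) * z (zvar j)) ->
    laurent_eval L z = 0.

End Correlation.

Arguments zpoly C {r n a} i.
Arguments correlation {C r} n {V} X xi v _.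
Arguments all_diagonals {C r} n A d q.
Arguments linked_diagonals {C r} n A d q.
Arguments vandermonde C {r} n.

(* Main.v *)
Require Import Defs.
From HB Require Import structures.
From mathcomp Require Import all_boot all_order all_fingroup all_algebra.
From mathcomp Require Import ring zify.
From mathcomp.multinomials Require ssrcomplements.
From mathcomp Require Import boolp reals complex mpoly.

Set Implicit Arguments.
Unset Strict Implicit.
Unset Printing Implicit Defensive.

Import Order.TTheory GRing.Theory Num.Theory.
Local Open Scope ring_scope.

(** Attach to every pair of variables the linear form [q_a^(a_ab) z_x - z_y] of
    the statement.  By the exchange relations, the product of the correlation
    series of a word of currents with all these forms, each with the sign that
    the order of the word prescribes, does not depend on that order
    ([word_corr_invariant]).  Any variable can be put last, where its exponents
    are bounded below because the module has no vector of large degree; and the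
    total degree is fixed, since [v] and [xi] are homogeneous.  So the product is
    a Laurent polynomial ([word_corr_laurent]).  Permuting the variables of one
    color permutes the forms up to sign, so this Laurent polynomial is
    antisymmetric in each color: it is the product of the Vandermonde polynomials
    and of a symmetric Laurent polynomial [A] ([word_corr_structure]).  The poles
    and the twisted symmetry follow.

    For the vanishing conditions, let [N = 1 - a_ab], and fix [N] variables
    [z_k] of color [a] and a variable [w] of color [b].  The series of a word of
    currents vanishes far enough in the direction of each pair of its letters
    ([tame]), so that multiplication by the linear forms can be undone
    ([wprod_cancel]).  Hence, once the forms that involve another variable are
    cleared, the series of a word starting with these [N + 1] currents is
    [B * E], where [B] is [A] times the Vandermonde factors that involve another
    variable, and [E] is a universal series, the expansion in the order of the
    word of the product of [(z_k - z_l) / (q_a^2 z_k - z_l)] and of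
    [1 / (q_a^(a_ab) z_k - w)] ([expansion], [expansion_unique]).  The Serre
    relation becomes [B * K = 0], where [K] is the combination of universal
    series with the coefficients of the Serre relation ([serre_sum]).

    Two properties of [K] are enough to conclude.
    - The elementary symmetric polynomials in the [z_k] act on [K] as the scalars
      which are their values at the wheel [z_k = q_a^(N-1-2k) w]
      ([wheel_annihilator]).  This follows from the exchange relations through
      explicit identities with coefficients polynomial in [q_a], so it holds
      for all [q <> 0], roots of unity included.  As [B] is symmetric in the
      [z_k], it acts on [K] as its restriction to the wheel, a polynomial in the
      other variables and [w].
    - The terms of [K] of exponent [-1] in all the [z_k] reduce to a nonzero
      multiple of the inverse of the product of the [z_k]: only the words where
      [w] comes last contribute, and all of them equally ([serre_slice]).
    So the restriction of [B] to the wheel is [0], and that of [A] as well, since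
    the other factors of [B] do not vanish identically there
    ([wheel_vanishing]).

    The identities are given for [N <= 3].  Positivity of the invariant form
    leaves [a_ab >= -2] outside of type G2 ([cartan_offdiag_ge]), so they are all
    that is needed.  When [a_ab = 0] the vanishing condition says that [A] is
    zero for [z_x = z_y], and the form [z_x - z_y] cancels from the denominator;
    this gives the second presentation ([linked_form]). *)

(** * Polynomials acting on formal series *)

Section SeriesModule.
Variables (C : fieldType) (N : nat).
Implicit Types (f g : series C N) (P Q : {mpoly C[N]}) (m : exponent N).

(** The formal series form a module over the polynomials, for [mul_series]. *)
HB.instance Definition _ := gen_eqMixin (series C N).
HB.instance Definition _ := gen_choiceMixin (series C N).

Lemma seriesP f g : f =1 g -> f = g.
Proof. by move=> e; apply/funext. Qed.

Definition series_add f g : series C N := fun m => f m + g m.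
Definition series_opp f : series C N := fun m => - f m.
Definition series_zero : series C N := fun _ => 0.

Fact series_addA : associative series_add.
Proof. by move=> f g h; apply: seriesP => m; apply: addrA. Qed.
Fact series_addC : commutative series_add.
Proof. by move=> f g; apply: seriesP => m; apply: addrC. Qed.
Fact series_add0 : left_id series_zero series_add.
Proof. by move=> f; apply: seriesP => m; apply: add0r. Qed.
Fact series_addN : left_inverse series_zero series_opp series_add.
Proof. by move=> f; apply: seriesP => m; apply: addNr. Qed.

HB.instance Definition _ := GRing.isZmodule.Build (series C N)
  series_addA series_addC series_add0 series_addN.

(** The exponent of a monomial of a polynomial. *)
Definition mexp (k : 'X_{1..N}) : exponent N := [ffun i => (k i)%:Z].

Lemma mexpD k l : mexp (k + l)%MM = mexp k + mexp l.
Proof. by apply/ffunP => i; rewrite !ffunE mnmDE PoszD. Qed.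

Lemma mexp0 : mexp 0%MM = 0.
Proof. by apply/ffunP => i; rewrite !ffunE mnm0E. Qed.

Lemma mul_seriesE P f m :
  mul_series P f m = \sum_(k <- msupp P) P@_k * f (m - mexp k).
Proof.
by apply: eq_bigr => k _; congr (_ * f _); apply/ffunP => i; rewrite !ffunE.
Qed.

(** The sum over a common range, for the comparison of several polynomials. *)
Lemma mul_serieswE k P f m : (msize P <= k)%N ->
  mul_series P f m = \sum_(l : 'X_{1..N < k}) P@_l * f (m - mexp l).
Proof.
move=> le_pk; rewrite mul_seriesE; pose I : subFinType _ := 'X_{1..N < k}.
rewrite (ssrcomplements.big_mksub I) //=; first last.
  by move=> x /msize_mdeg_lt /leq_trans; apply.
  by rewrite msupp_uniq.
by rewrite big_rmcond //= => i; move/memN_msupp_eq0 ->; rewrite mul0r.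
Qed.

Lemma mul_seriesDl P Q f : mul_series (P + Q) f = mul_series P f + mul_series Q f.
Proof.
apply: seriesP => m; rewrite /GRing.add /= /series_add.
pose k := maxn (msize (P + Q)) (maxn (msize P) (msize Q)).
rewrite !(@mul_serieswE k) ?leq_max ?leqnn ?orbT // -big_split /=.
by apply: eq_bigr => l _; rewrite mcoeffD mulrDl.
Qed.

Lemma mul_seriesDr P f g : mul_series P (f + g) = mul_series P f + mul_series P g.
Proof.
apply: seriesP => m; rewrite {2}/GRing.add /= /series_add !mul_seriesE -big_split /=.
by apply: eq_bigr => l _; rewrite -mulrDr.
Qed.

Lemma mul_seriesX c k f m :
  mul_series (c *: 'X_[k]) f m = c * f (m - mexp k).
Proof.
have [->|c0] := eqVneq c 0; first by rewrite scale0r mul_seriesE msupp0 big_nil mul0r.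
rewrite mul_seriesE (perm_big _ (msuppZ _ c0)) msuppX big_seq1.
by rewrite mcoeffZ mcoeffX eqxx mulr1.
Qed.

Lemma mul_series0 f : mul_series 0 f = 0.
Proof. by apply: seriesP => m; rewrite mul_seriesE msupp0 big_nil. Qed.

Lemma mul_seriesM P Q f : mul_series P (mul_series Q f) = mul_series (P * Q) f.
Proof.
elim/mpolyind: P => [|c k P _ _ IHP]; first by rewrite mul0r !mul_series0.
rewrite mulrDl !mul_seriesDl IHP; congr (_ + _).
elim/mpolyind: Q {IHP} => [|c' k' Q _ _ IHQ].
  rewrite mulr0 !mul_series0; apply: seriesP => m.
  by rewrite mul_seriesX mulr0.
rewrite mulrDr !mul_seriesDl mul_seriesDr IHQ; congr (_ + _).
rewrite -scalerAl -scalerAr scalerA -mpolyXD; apply: seriesP => m.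
by rewrite !mul_seriesX mexpD opprD addrA mulrA.
Qed.

Lemma mul_series1 f : mul_series 1 f = f.
Proof.
apply: seriesP => m; rewrite -mpolyX0 -[X in mul_series X]scale1r mul_seriesX.
by rewrite mul1r mexp0 subr0.
Qed.

HB.instance Definition _ := GRing.Zmodule_isLmodule.Build {mpoly C[N]} (series C N)
  mul_seriesM mul_series1 mul_seriesDr (fun f P Q => mul_seriesDl P Q f).

Lemma scale_seriesE P f : P *: f = mul_series P f. Proof. by []. Qed.

Lemma seriesDE f g m : (f + g) m = f m + g m. Proof. by []. Qed.
Lemma seriesNE f m : (- f) m = - f m. Proof. by []. Qed.
Lemma series0E m : (0 : series C N) m = 0. Proof. by []. Qed.
Lemma series_sumE (I : Type) (s : seq I) (Pr : pred I) (F : I -> series C N) m :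
  (\sum_(i <- s | Pr i) F i) m = \sum_(i <- s | Pr i) F i m.
Proof. by elim/big_rec2: _ => // i y x _ <-. Qed.

(** The exponent of the variable [z_i]. *)
Definition unit_exp (i : 'I_N) : exponent N := [ffun j => (j == i)%:Z].

Lemma unit_expE i j : unit_exp i j = (j == i)%:Z. Proof. by rewrite ffunE. Qed.

Lemma mexpU i : mexp U_(i)%MM = unit_exp i.
Proof. by apply/ffunP => j; rewrite !ffunE mnm1E eq_sym. Qed.

Lemma scaleCE c f m : (c%:MP *: f) m = c * f m.
Proof.
rewrite scale_seriesE -[c%:MP]mulr1 mul_mpolyC -mpolyX0 mul_seriesX.
by rewrite mexp0 subr0.
Qed.

Lemma scaleXE i f m : ('X_i *: f) m = f (m - unit_exp i).
Proof.
by rewrite scale_seriesE -[X in mul_series X]scale1r mul_seriesX mul1r mexpU.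
Qed.

Lemma scaleXXE c k f m : ((c *: 'X_[k]) *: f) m = c * f (m - mexp k).
Proof. exact: mul_seriesX. Qed.

(** Every property of series stable under sums, scalars and multiplication by
    the variables is stable under the action of polynomials. *)
Lemma scale_ind (H : series C N -> Prop) :
  H 0 -> (forall f g, H f -> H g -> H (f + g)) ->
  (forall (c : C) f, H f -> H (c%:MP *: f)) ->
  (forall i f, H f -> H ('X_i *: f)) ->
  forall P f, H f -> H (P *: f).
Proof.
move=> H0 HD HC HX P f Hf.
elim/mpolyind: P => [|c k P _ _ IHP]; first by rewrite scale0r.
rewrite scalerDl; apply: HD => //; rewrite -mul_mpolyC -scalerA; apply: HC.
rewrite mpolyXE_id; elim: (index_enum _) => [|i s IHs]; first by rewrite big_nil scale1r.
rewrite big_cons -scalerA; elim: (k i) => [|j IHj]; first by rewrite expr0 scale1r.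
by rewrite exprS -scalerA; apply: HX.
Qed.

End SeriesModule.
Arguments unit_exp {N} i.

(** * Series bounded in the direction of a pair of variables *)

Section Tame.
Variables (C : fieldType) (N : nat).
Implicit Types (f g : series C N) (P Q : {mpoly C[N]}) (m : exponent N).
Implicit Types (x y : 'I_N) (s u v : seq 'I_N).

(** On each line of exponents of direction [z_x / z_y], the coefficients of [f]
    vanish far enough towards large powers of [z_x].  This holds for series
    expanded with [z_y] much smaller than [z_x]. *)
Definition tame x y f := forall m : exponent N, exists J : nat, forall j : nat,
  (J <= j)%N -> f (m + (unit_exp x - unit_exp y) *+ j) = 0.

Lemma tame_scale x y P f : tame x y f -> tame x y (P *: f).
Proof.
apply: (@scale_ind _ _ (tame x y)) => [m|g h Hg Hh m|c g Hg m|i g Hg m].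
- by exists 0%N.
- have [J HJ] := Hg m; have [K HK] := Hh m; exists (maxn J K) => j.
  by rewrite geq_max => /andP[Jj Kj]; rewrite seriesDE HJ // HK // addr0.
- by have [J HJ] := Hg m; exists J => j Jj; rewrite scaleCE HJ // mulr0.
- have [J HJ] := Hg (m - unit_exp i); exists J => j Jj.
  by rewrite scaleXE addrAC HJ.
Qed.

Lemma tameB x y f g : tame x y f -> tame x y g -> tame x y (f - g).
Proof.
move=> Hf Hg m; have [J HJ] := Hf m; have [K HK] := Hg m; exists (maxn J K) => j.
rewrite geq_max => /andP[Jj Kj].
by rewrite seriesDE seriesNE HJ // HK // subr0.
Qed.

(** The two terms of [a z_x - z_y] relate each coefficient to the next one on a
    line of direction [z_x / z_y]. *)
Lemma tame_cancel x y (a : C) f : a != 0 -> tame x y f ->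
  (a *: 'X_x - 'X_y) *: f = 0 -> f = 0.
Proof.
move=> a0 Hf Hz; apply: seriesP => m; rewrite series0E.
have step m' : f m' = a^-1 * f (m' + (unit_exp x - unit_exp y)).
  have := congr1 (fun g : series C N => g (m' + unit_exp x)) Hz.
  rewrite /= scalerBl seriesDE seriesNE -mul_mpolyC -scalerA scaleCE !scaleXE.
  rewrite addrK series0E -addrA => /eqP; rewrite subr_eq0 => /eqP <-.
  by rewrite mulKf.
have stepn j : f m = a^-1 ^+ j * f (m + (unit_exp x - unit_exp y) *+ j).
  elim: j => [|j ->]; first by rewrite expr0 mul1r mulr0n addr0.
  by rewrite step -addrA -mulrSr mulrA -exprSr.
by have [J HJ] := Hf m; rewrite (stepn J) HJ ?mulr0.
Qed.

(** Tameness for all the pairs of variables, in the order of the word [s]. *)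
Definition tame_word s f := forall x y, subseq [:: x; y] s -> tame x y f.

Lemma tame_word_sub s s' f : subseq s' s -> tame_word s f -> tame_word s' f.
Proof. by move=> ss Hf x y xy; apply: Hf; apply: subseq_trans xy ss. Qed.

Lemma tame_word_scale s P f : tame_word s f -> tame_word s (P *: f).
Proof. by move=> Hf x y xy; apply: tame_scale; apply: Hf. Qed.

Lemma tame_wordB s f g : tame_word s f -> tame_word s g -> tame_word s (f - g).
Proof. by move=> Hf Hg x y xy; apply: tameB; [apply: Hf|apply: Hg]. Qed.

End Tame.

(** * Products over the pairs of letters of a word *)

Section WordProducts.
Variables (T : eqType) (R : comNzRingType).
Implicit Types (phi : T -> T -> R) (s t u v : seq T).

(** The product of the [phi x y] for [x] before [y] in [s]. *)
Fixpoint wprod phi s : R :=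
  if s is x :: s' then (\prod_(y <- s') phi x y) * wprod phi s' else 1.

(** The product over the pairs with one letter in [s] and one in [t]. *)
Definition cross phi s t : R := \prod_(x <- s) \prod_(y <- t) phi x y.

Lemma wprod_cat phi s t : wprod phi (s ++ t) = wprod phi s * cross phi s t * wprod phi t.
Proof.
rewrite /cross; elim: s => [|x s IHs] /=; first by rewrite big_nil !mul1r.
by rewrite IHs big_cat /= big_cons; ring.
Qed.

(** The factors of [wprod phi (u ++ x :: y :: v)] other than [phi x y]. *)
Definition wrest phi u x y v : R :=
  wprod phi u * wprod phi v * (\prod_(b <- v) phi x b) * (\prod_(b <- v) phi y b)
  * cross phi u v * (\prod_(a <- u) phi a x) * (\prod_(a <- u) phi a y).

Lemma wprod_pair phi u x y v :
  wprod phi (u ++ x :: y :: v) = wrest phi u x y v * phi x y.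
Proof.
rewrite wprod_cat /= big_cons /wrest.
have -> : cross phi u (x :: y :: v) =
    (\prod_(a <- u) phi a x) * (\prod_(a <- u) phi a y) * cross phi u v.
  rewrite /cross -!big_split /=; apply: eq_bigr => a _.
  by rewrite !big_cons mulrA.
by ring.
Qed.

Lemma wrestC phi u x y v : wrest phi u x y v = wrest phi u y x v.
Proof. by rewrite /wrest; ring. Qed.

Lemma eq_wprod phi psi s : {in s &, forall x y, phi x y = psi x y} ->
  wprod phi s = wprod psi s.
Proof.
elim: s => //= x s IHs H; rewrite IHs; last first.
  by move=> a b sa sb; apply: H; rewrite inE ?sa ?sb orbT.
congr (_ * _); rewrite [LHS]big_seq [RHS]big_seq; apply: eq_bigr => y sy.
by apply: H; rewrite inE ?eqxx ?sy ?orbT.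
Qed.

Lemma wprodM phi psi s :
  wprod (fun x y => phi x y * psi x y) s = wprod phi s * wprod psi s.
Proof. by elim: s => [|x s /= ->]; rewrite ?mulr1 //= big_split /=; ring. Qed.

Lemma wprod1 s : wprod (fun _ _ => 1) s = 1.
Proof. by elim: s => //= x s ->; rewrite big1 ?mulr1. Qed.

End WordProducts.

Lemma rmorph_wprod (T : eqType) (R R' : comNzRingType) (h : {rmorphism R -> R'})
  (phi : T -> T -> R) s : h (wprod phi s) = wprod (fun x y => h (phi x y)) s.
Proof. by elim: s => [|x s /= IHs]; rewrite ?rmorph1 //= rmorphM IHs rmorph_prod. Qed.

Lemma wprod_map (T T' : eqType) (R : comNzRingType) (h : T' -> T)
  (phi : T -> T -> R) s : wprod phi (map h s) = wprod (fun x y => phi (h x) (h y)) s.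
Proof. by elim: s => //= x s ->; rewrite big_map. Qed.

Lemma perm_swap (T : eqType) (u : seq T) x y v :
  perm_eq (u ++ x :: y :: v) (u ++ y :: x :: v).
Proof. by rewrite perm_cat2l (perm_catCA [:: x] [:: y] v). Qed.

(** A function of words without repetition that is invariant under adjacent
    transpositions is invariant under all permutations. *)
Lemma word_invariant (T : eqType) (Y : Type) (Phi : seq T -> Y) :
  (forall u x y v, uniq (u ++ x :: y :: v) ->
     Phi (u ++ x :: y :: v) = Phi (u ++ y :: x :: v)) ->
  forall s s', perm_eq s s' -> uniq s -> Phi s = Phi s'.
Proof.
move=> Hswap.
have move_front u v x t : uniq (u ++ v ++ x :: t) ->
    Phi (u ++ v ++ x :: t) = Phi (u ++ x :: v ++ t).
  elim: v u => [|y v IHv] u // Hu; rewrite cat_cons.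
  rewrite -cat_rcons IHv ?cat_rcons // Hswap //.
  move: Hu; apply: etrans; apply: perm_uniq; rewrite perm_cat2l perm_cons.
  by rewrite (perm_catCA [:: x] v t).
suff gen s s' u : perm_eq s s' -> uniq (u ++ s) -> Phi (u ++ s) = Phi (u ++ s').
  by move=> s s' Hp; apply: (gen s s' [::]).
elim: s s' u => [|x s IHs] s' u; first by rewrite perm_sym => /perm_nilP ->.
move=> Hp Hu; have xs' : x \in s' by rewrite -(perm_mem Hp) mem_head.
case/splitPr: xs' Hp => v t Hp; rewrite move_front; last first.
  by move: Hu; apply: etrans; apply: perm_uniq; rewrite perm_cat2l perm_sym.
rewrite -!cat_rcons; apply: IHs; last by rewrite cat_rcons.
by rewrite -(perm_cons x) (perm_trans Hp) // (perm_catCA v [:: x] t).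
Qed.

Lemma enum_ord_adjacent N (i j : 'I_N) : j = i.+1 :> nat ->
  exists u w, enum 'I_N = u ++ i :: j :: w /\ size u = i.
Proof.
move=> eij; have iN : (i < size (enum 'I_N))%N by rewrite size_enum_ord.
have jN : (i.+1 < size (enum 'I_N))%N by rewrite size_enum_ord -eij.
exists (take i (enum 'I_N)), (drop i.+2 (enum 'I_N)); split; last first.
  by rewrite size_takel // ltnW.
rewrite -{1}(cat_take_drop i (enum 'I_N)); congr (_ ++ _).
rewrite (drop_nth i iN) nth_ord_enum; congr (_ :: _).
by rewrite (drop_nth i jN) -eij nth_ord_enum eij.
Qed.

Lemma wprod_perm (T : eqType) (R : comNzRingType) (phi : T -> T -> R) s s' :
  (forall x y, phi x y = phi y x) -> perm_eq s s' -> uniq s ->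
  wprod phi s = wprod phi s'.
Proof.
move=> phiC; apply: word_invariant => u x y v _.
by rewrite !wprod_pair wrestC phiC.
Qed.

(** * Cancellation of linear factors *)

Section Cancel.
Variables (C : fieldType) (N : nat) (Q : 'I_N -> 'I_N -> C).
Hypothesis Q_neq0 : forall x y, Q x y != 0.
Hypothesis QC : forall x y, Q x y = Q y x.
Implicit Types (f g : series C N) (x y : 'I_N) (s u v : seq 'I_N).

(** The linear form [Q_xy z_x - z_y] if [x < y], and its opposite otherwise.
    With this sign [dfac y x] is [z_x - Q_xy z_y] for [x < y], as [Q] is
    symmetric, and the exchange relation between two currents reads
    [dfac x y *: e_x e_y = dfac y x *: e_y e_x] for all [x] and [y]. *)
Definition dfac x y : {mpoly C[N]} :=
  if (x < y)%N then Q x y *: 'X_x - 'X_y else 'X_y - Q x y *: 'X_x.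

Lemma dfac_cancel x y f : tame x y f -> dfac x y *: f = 0 -> f = 0.
Proof.
rewrite /dfac; case: ifP => _ Hf; first exact: tame_cancel.
rewrite -opprB scaleNr => /eqP; rewrite oppr_eq0 => /eqP.
exact: tame_cancel.
Qed.

Lemma dfac_cancelr x s f : (forall y, y \in s -> tame x y f) ->
  (\prod_(y <- s) dfac x y) *: f = 0 -> f = 0.
Proof.
elim: s f => [|y s IHs] f H; first by rewrite big_nil scale1r.
rewrite big_cons mulrC -scalerA => Hf.
apply: (@dfac_cancel x y); first by apply: H; rewrite mem_head.
apply: IHs Hf => z sz; apply: tame_scale; apply: H.
by rewrite inE sz orbT.
Qed.

Lemma dfac_cancell x s f : (forall y, y \in s -> tame y x f) ->
  (\prod_(y <- s) dfac y x) *: f = 0 -> f = 0.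
Proof.
elim: s f => [|y s IHs] f H; first by rewrite big_nil scale1r.
rewrite big_cons mulrC -scalerA => Hf.
apply: (@dfac_cancel y x); first by apply: H; rewrite mem_head.
apply: IHs Hf => z sz; apply: tame_scale; apply: H.
by rewrite inE sz orbT.
Qed.

Lemma wprod_cancel s f : tame_word s f -> wprod dfac s *: f = 0 -> f = 0.
Proof.
elim: s f => [|x s IHs] f H /=; first by rewrite scale1r.
rewrite mulrC -scalerA => Hf; apply: (@dfac_cancelr x s).
  by move=> y sy; apply: H; rewrite /= eqxx sub1seq.
apply: IHs Hf; apply: tame_word_scale; apply: tame_word_sub H.
exact: subseq_cons.
Qed.

Lemma cross_cancel s t f : (forall x y, x \in s -> y \in t -> tame x y f) ->
  cross dfac s t *: f = 0 -> f = 0.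
Proof.
rewrite /cross; elim: s f => [|x s IHs] f H; first by rewrite big_nil scale1r.
rewrite big_cons mulrC -scalerA => Hf.
apply: (@dfac_cancelr x t); first by move=> y ty; apply: H => //; rewrite mem_head.
apply: IHs Hf => z y sz ty; apply: tame_scale; apply: H => //.
by rewrite inE sz orbT.
Qed.

(** In the product [wrest u x y v] the letters [x] and [y] are only compared with
    the letters of [u] and [v], so that the order between them does not matter. *)
Lemma wrest_cancel u x y v f :
  tame_word (u ++ x :: v) f -> tame_word (u ++ y :: v) f ->
  wrest dfac u x y v *: f = 0 -> f = 0.
Proof.
move=> Hx Hy; rewrite /wrest -!scalerA.
have Hu : tame_word u f by apply: tame_word_sub Hx; apply: prefix_subseq.
have Hv : tame_word v f.
  by apply: tame_word_sub Hx; rewrite -cat_rcons; apply: suffix_subseq.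
have H1 z b : tame_word (u ++ z :: v) f -> b \in v -> tame z b f.
  move=> H vb; apply: H; rewrite -[X in subseq X]cat0s cat_subseq ?sub0seq //=.
  by rewrite eqxx sub1seq.
have H2 z a : tame_word (u ++ z :: v) f -> a \in u -> tame a z f.
  move=> H ua; apply: H; rewrite -[X in subseq X]/([:: a] ++ [:: z]).
  by rewrite cat_subseq ?sub1seq // mem_head.
have H3 a b : a \in u -> b \in v -> tame a b f.
  move=> ua vb; apply: Hx; rewrite -[X in subseq X]/([:: a] ++ [:: b]).
  by rewrite cat_subseq ?sub1seq // inE vb orbT.
move=> H; have {}H : wprod dfac v *: ((\prod_(b <- v) dfac x b) *:
    ((\prod_(b <- v) dfac y b) *: (cross dfac u v *:
    ((\prod_(a <- u) dfac a x) *: ((\prod_(a <- u) dfac a y) *: f))))) = 0.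
  by apply: (wprod_cancel _ H); do 6?apply: tame_word_scale.
have {}H : (\prod_(b <- v) dfac x b) *: ((\prod_(b <- v) dfac y b) *:
    (cross dfac u v *: ((\prod_(a <- u) dfac a x) *:
    ((\prod_(a <- u) dfac a y) *: f)))) = 0.
  by apply: (wprod_cancel _ H); do 5?apply: tame_word_scale.
have {}H : (\prod_(b <- v) dfac y b) *: (cross dfac u v *:
    ((\prod_(a <- u) dfac a x) *: ((\prod_(a <- u) dfac a y) *: f))) = 0.
  by apply: (dfac_cancelr _ H) => b vb; do 4?apply: tame_scale; apply: H1 vb.
have {}H : cross dfac u v *: ((\prod_(a <- u) dfac a x) *:
    ((\prod_(a <- u) dfac a y) *: f)) = 0.
  by apply: (dfac_cancelr _ H) => b vb; do 3?apply: tame_scale; apply: H1 vb.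
have {}H : (\prod_(a <- u) dfac a x) *: ((\prod_(a <- u) dfac a y) *: f) = 0.
  by apply: (cross_cancel _ H) => a b ua vb; do 2?apply: tame_scale; apply: H3.
have {}H : (\prod_(a <- u) dfac a y) *: f = 0.
  by apply: (dfac_cancell _ H) => a ua; apply: tame_scale; apply: H2 ua.
by apply: (dfac_cancell _ H) => a ua; apply: H2 ua.
Qed.

End Cancel.

(** * Universal expansions *)

Section Expansion.
Variables (C : fieldType) (N : nat) (Q : 'I_N -> 'I_N -> C) (same : rel 'I_N).
Hypothesis Q_neq0 : forall x y, Q x y != 0.
Hypothesis QC : forall x y, Q x y = Q y x.
Hypothesis sameC : forall x y, same x y = same y x.
Implicit Types (f g : series C N) (x y : 'I_N) (s u v : seq 'I_N).
Implicit Types (m : exponent N).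

Local Notation ue := unit_exp.

(** The numerator attached to a pair of variables: their difference, with the
    smaller index first, if they have the same color, and [1] otherwise. *)
Definition numer x y : {mpoly C[N]} :=
  if same x y then (if (x < y)%N then 'X_x - 'X_y else 'X_y - 'X_x) else 1.

Lemma numerC x y : numer x y = numer y x.
Proof.
rewrite /numer sameC; case: ifP => // _.
by case: ltngtP => // /val_inj ->.
Qed.

(** The quotient of [g] by [Q_xy z_x - z_y], expanded for [z_y] much smaller
    than [z_x]; it is meaningful when no positive power of [z_x] occurs in [g]. *)
Definition geom x y g : series C N := fun m =>
  if m x < 0 then
    \sum_(j < `|m x|%N) (Q x y)^-1 ^+ j.+1 * g (m + ue x + (ue x - ue y) *+ j)
  else 0.

(** The quotient by [dfac x y], in the same expansion. *)
Definition dquot x y g : series C N := if (x < y)%N then geom x y g else - geom x y g.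

(** No positive power of [z_x] occurs in [g]. *)
Definition no_pos x g := forall m, 0 < m x -> g m = 0.

Lemma exp_shift x y j m : x != y ->
  [/\ (m + ue x) x = m x + 1, (m + (ue x - ue y) *+ j) x = m x + j%:Z,
      (m - ue y) x = m x & (m - ue x) x = m x - 1].
Proof.
move=> xy; have uej : ((ue x - ue y) *+ j) x = j%:Z.
  elim: j => [|j IHj]; first by rewrite mulr0n ffunE.
  by rewrite mulrSr ffunE IHj !ffunE eqxx (negPf xy); lia.
split; rewrite [LHS]ffunE ?uej // !ffunE ?eqxx ?(negPf xy) /=. all: lia.
Qed.

Lemma exp_shift_other x y z j m : z != x -> z != y ->
  [/\ (m + ue x) z = m z, (m + (ue x - ue y) *+ j) z = m z,
      (m - ue y) z = m z & (m - ue x) z = m z].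
Proof.
move=> zx zy; have uej : ((ue x - ue y) *+ j) z = 0.
  elim: j => [|j IHj]; first by rewrite mulr0n ffunE.
  by rewrite mulrSr ffunE IHj !ffunE (negPf zx) (negPf zy).
split; rewrite [LHS]ffunE ?uej ?addr0 // !ffunE ?(negPf zx) ?(negPf zy) /=. all: lia.
Qed.

Lemma geomK x y g : x != y -> no_pos x g ->
  (Q x y *: 'X_x - 'X_y) *: geom x y g = g.
Proof.
move=> xy Hg; apply: seriesP => m.
rewrite scalerBl seriesDE seriesNE -mul_mpolyC -scalerA scaleCE !scaleXE /geom.
have [_ _ -> ->] := exp_shift 0 m xy.
have [m_gt0|m_le0] := ltrP 0 (m x).
  rewrite !ifF ?mulr0 ?subr0 ?Hg //; lia.
have [k mk] : exists k : nat, m x = - k%:Z by exists `|m x|%N; lia.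
rewrite ifT ?mk; last lia.
rewrite (_ : `|- k%:Z - 1|%N = k.+1); last lia.
rewrite big_ord_recl /= expr1 mulrDr mulrA mulfV // mul1r mulr0n addr0 subrK.
case: k mk => [|k] mk; first by rewrite big_ord0 mulr0 addr0 ltxx subr0.
have -> : (- k.+1%:Z < 0) = true by lia.
rewrite (_ : `|- k.+1%:Z|%N = k.+1); last lia.
rewrite mulr_sumr -addrA -sumrB big1 ?addr0 // => j _.
rewrite [X in _ * (X * _)]exprS !mulrA mulfV // mul1r; apply/eqP.
rewrite subr_eq0; apply/eqP; congr (_ * g _).
by rewrite /bump /= mulrS addrA; congr (_ + _); rewrite addrA addrAC.
Qed.

Lemma dquotK x y g : x != y -> no_pos x g -> dfac Q x y *: dquot x y g = g.
Proof.
move=> xy Hg; rewrite /dfac /dquot; case: ifP => _; first exact: geomK.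
by rewrite -opprB scaleNr scalerN opprK geomK.
Qed.

Lemma dquot_ge0 x y g m : 0 <= m x -> dquot x y g m = 0.
Proof.
move=> m0; rewrite /dquot /geom; case: ifP => _; rewrite ?seriesNE ifF ?oppr0 //; lia.
Qed.

Lemma dquot0 x y g m :
  (forall j, g (m + ue x + (ue x - ue y) *+ j) = 0) -> dquot x y g m = 0.
Proof.
move=> H; have Hg : geom x y g m = 0.
  by rewrite /geom; case: ifP => // _; rewrite big1 // => j _; rewrite H mulr0.
by rewrite /dquot; case: ifP; rewrite ?seriesNE Hg ?oppr0.
Qed.

(** Multiplication of [g] by the expansion of [numer x y / dfac x y]. *)
Definition pair_ratio x y g : series C N := numer x y *: dquot x y g.

(** The expansion, in the order of the word [s], of the product over its pairs of
    letters of [numer x y / dfac x y].  The factors that involve the first letter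
    [x] are applied last: the rest does not depend on [z_x], and each quotient by
    [dfac x y] is then defined ([expansion_no_pos]). *)
Fixpoint expansion s : series C N :=
  if s is x :: s' then foldr (pair_ratio x) (expansion s') s' else @one_series C N.

(** Multiplication by [numer x y] preserves the vanishing on sets of exponents
    stable by division by [z_x] and [z_y]. *)
Lemma numer_closed (H : exponent N -> bool) x y g :
  (forall m, H m -> H (m - ue x) && H (m - ue y)) ->
  (forall m, H m -> g m = 0) -> forall m, H m -> (numer x y *: g) m = 0.
Proof.
move=> HH Hg m Hm; have /andP[Hx Hy] := HH m Hm.
rewrite /numer; case: ifP => _; last by rewrite scale1r Hg.
case: ifP => _; rewrite scalerBl seriesDE seriesNE !scaleXE !Hg ?subr0 //.
Qed.

Lemma pair_ratio_no_pos x y g : x != y -> no_pos x g -> no_pos x (pair_ratio x y g).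
Proof.
move=> xy Hg m m0; rewrite /pair_ratio /numer.
have [_ _ e1 e2] := exp_shift 0 m xy.
case: ifP => _; last by rewrite scale1r dquot_ge0 // ltW.
by case: ifP => _; rewrite scalerBl seriesDE seriesNE !scaleXE !dquot_ge0 ?subr0 //;
  rewrite ?e1 ?e2; lia.
Qed.

Lemma foldr_pair_ratio x s g : x \notin s -> no_pos x g ->
  no_pos x (foldr (pair_ratio x) g s) /\
  (\prod_(y <- s) dfac Q x y) *: foldr (pair_ratio x) g s = (\prod_(y <- s) numer x y) *: g.
Proof.
elim: s => [|y s IHs] //=; first by rewrite !big_nil.
rewrite inE negb_or => /andP[xy xs] Hg; have [IH1 IH2] := IHs xs Hg.
split; first exact: pair_ratio_no_pos.
rewrite !big_cons [pair_ratio x y _]/pair_ratio scalerA mulrAC mulrC [X in _ * X]mulrC mulrA.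
rewrite -[LHS]scalerA.
rewrite dquotK //.
by rewrite mulrC -[LHS]scalerA IH2 scalerA.
Qed.

Lemma pair_ratio_other x y z g : z != x -> z != y ->
  (forall m, m z != 0 -> g m = 0) -> forall m, m z != 0 -> pair_ratio x y g m = 0.
Proof.
move=> zx zy Hg; apply: (numer_closed (H := fun m => m z != 0)) => m mz.
  by have [_ _ -> ->] := exp_shift_other 0 m zx zy; rewrite mz.
apply: dquot0 => j; apply: Hg.
by have [_ -> _ _] := exp_shift_other j (m + ue x) zx zy;
   have [-> _ _ _] := exp_shift_other j m zx zy.
Qed.

Lemma expansion_notin z s m : z \notin s -> m z != 0 -> expansion s m = 0.
Proof.
elim: s m => [|x s IHs] m /=.
  move=> _ mz; rewrite /one_series; case: eqP => [m0|//].
  by rewrite m0 ffunE eqxx in mz.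
rewrite inE negb_or => /andP[zx zs].
suff H : forall t, {subset t <= s} ->
    forall m, m z != 0 -> foldr (pair_ratio x) (expansion s) t m = 0.
  by apply: H.
elim=> [|y t IHt] ts m' /=; first exact: IHs.
apply: pair_ratio_other => //; last first.
  by apply: IHt => a ta; apply: ts; rewrite inE ta orbT.
by apply: contraNneq zs => ->; apply: ts; rewrite mem_head.
Qed.

Lemma expansion_no_pos x s : x \notin s -> no_pos x (expansion s).
Proof. by move=> xs m mx; rewrite (expansion_notin xs) // gt_eqF. Qed.

Theorem expansionK s : uniq s ->
  wprod (dfac Q) s *: expansion s = wprod numer s *: @one_series C N.
Proof.
elim: s => //= x s IHs /andP[xs us].
have [_ H] := foldr_pair_ratio xs (expansion_no_pos xs).
by rewrite mulrC -[LHS]scalerA H scalerA mulrC -[LHS]scalerA IHs // scalerA.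
Qed.

Lemma tame_pair_ratio a b x y g : a != x -> b != x -> tame a b g -> tame a b (pair_ratio x y g).
Proof.
move=> ax bx Hg; apply: tame_scale => m.
have xa : x != a by rewrite eq_sym. have xb : x != b by rewrite eq_sym.
have [J HJ] : exists J, forall j i, (J <= j)%N -> (i < `|m x|)%N ->
    g (m + ue x + (ue x - ue y) *+ i + (ue a - ue b) *+ j) = 0.
  elim: `|m x|%N => [|k [J HJ]]; first by exists 0%N.
  have [J' HJ'] := Hg (m + ue x + (ue x - ue y) *+ k).
  exists (maxn J J') => j i; rewrite geq_max => /andP[Jj J'j].
  by rewrite ltnS leq_eqVlt => /predU1P[->|]; [apply: HJ'|apply: HJ].
exists J => j Jj; set m' := m + _.
have em : m' x = m x by have [_ -> _ _] := exp_shift_other j m xa xb.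
have Hq : geom x y g m' = 0.
  rewrite /geom em; case: ifP => // _; rewrite big1 // => i _.
  rewrite /m' -addrA -addrA [X in m + X]addrC !addrA HJ ?mulr0 //.
by rewrite /dquot; case: ifP; rewrite ?seriesNE Hq ?oppr0.
Qed.

Lemma tame_expansion s : uniq s -> tame_word s (expansion s).
Proof.
elim: s => [|x s IHs] //= /andP[xs us] a b.
rewrite [subseq _ _]/=; case: eqP => [-> |/eqP ax]; last first.
  move=> ab; have [sa sb] : a \in s /\ b \in s.
    by split; apply: (mem_subseq ab); rewrite !inE eqxx ?orbT.
  have bx : b != x by apply: contraNneq xs => <-.
  have H : tame a b (expansion s) by apply: IHs.
  by elim: {2}s => [|y t IHt] //=; apply: tame_pair_ratio.
rewrite sub1seq => sb.
have xb : x != b by apply: contraNneq xs => ->.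
have [H _] := foldr_pair_ratio xs (expansion_no_pos xs) => m.
exists (`|m x|.+1)%N => j Hj; apply: H.
by have [_ -> _ _] := exp_shift j m xb; lia.
Qed.

(** The universal expansions satisfy the same exchange relations as the words of
    currents, since both sides agree after multiplication by the other factors. *)
Theorem expansion_exchange u x y v : uniq (u ++ x :: y :: v) ->
  dfac Q x y *: expansion (u ++ x :: y :: v) =
  dfac Q y x *: expansion (u ++ y :: x :: v).
Proof.
move=> U.
have U' : uniq (u ++ y :: x :: v).
  by rewrite (perm_uniq (perm_swap u y x v)).
apply/eqP; rewrite -subr_eq0; apply/eqP.
have ss a b : subseq (u ++ a :: v) (u ++ a :: b :: v).
  apply: cat_subseq => //; apply: (@cat_subseq _ [:: a] v [:: a] (b :: v)) => //.
  exact: subseq_cons.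
have ss' a b : subseq (u ++ a :: v) (u ++ b :: a :: v).
  by apply: cat_subseq => //; apply: subseq_cons.
apply: (@wrest_cancel _ _ _ Q_neq0 u x y v).
- by apply: tame_wordB; apply: tame_word_scale;
    [apply: tame_word_sub (ss x y) _|apply: tame_word_sub (ss' x y) _];
    apply: tame_expansion.
- by apply: tame_wordB; apply: tame_word_scale;
    [apply: tame_word_sub (ss' y x) _|apply: tame_word_sub (ss y x) _];
    apply: tame_expansion.
rewrite scalerBr !scalerA -wprod_pair wrestC -wprod_pair !expansionK //.
by rewrite (wprod_perm numerC (perm_swap u x y v)) ?subrr.
Qed.

(** By uniqueness of the quotient, a word whose product with all the factors
    [dfac] is known is a multiple of the universal expansion. *)
Theorem expansion_unique s f (P : {mpoly C[N]}) : uniq s -> tame_word s f ->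
  wprod (dfac Q) s *: f = (P * wprod numer s) *: @one_series C N ->
  f = P *: expansion s.
Proof.
move=> us Hf H; apply/eqP; rewrite -subr_eq0; apply/eqP.
apply: (@wprod_cancel _ _ _ Q_neq0 s).
  by apply: tame_wordB => //; apply: tame_word_scale; apply: tame_expansion.
by rewrite scalerBr H -scalerA -expansionK // !scalerA mulrC subrr.
Qed.

(** The last variable is the smallest one, so it has no negative powers. *)
Lemma expansion_last s y m : uniq (rcons s y) -> m y < 0 -> expansion (rcons s y) m = 0.
Proof.
elim: s m => [|x s IHs] m.
  move=> _ my; rewrite /= /one_series; case: eqP => [m0|//].
  by rewrite m0 ffunE ltxx in my.
rewrite rcons_cons cons_uniq => /andP[xs us] /=.
have xy : y != x by apply: contraNneq xs => <-; rewrite mem_rcons mem_head.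
move=> my; elim: {2}(rcons s y) m my => [|z t IHt] m my /=; first exact: IHs.
apply: (numer_closed (H := fun m : exponent N => m y < 0)) => // [m'|m' Hm].
  by rewrite !ffunE; case: eqP; case: eqP => /=; lia.
apply: dquot0 => j; apply: IHt.
have Hj : ((ue x - ue z) *+ j) y <= 0.
  elim: j => [|j IHj]; first by rewrite mulr0n ffunE.
  have Hz : (ue x - ue z) y <= 0 by rewrite !ffunE (negPf xy); case: eqP.
  by rewrite mulrSr ffunE; apply: le_trans (lerD IHj Hz) _.
have xy0 : (ue x) y = 0 by rewrite unit_expE (negPf xy).
rewrite ffunE [X in X + _]ffunE xy0 addr0.
by apply: le_lt_trans (lerD (lexx _) Hj) _; rewrite addr0.
Qed.

(** The inverse of the coefficient of [z_x] in [dfac x y]. *)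
Definition lead x y : C := if (x < y)%N then (Q x y)^-1 else - (Q x y)^-1.

Lemma dquot_lead x y g m : m x = -1 -> dquot x y g m = lead x y * g (m + ue x).
Proof.
move=> mx; have : geom x y g m = (Q x y)^-1 * g (m + ue x).
  by rewrite /geom mx /= big_ord1 mulr0n addr0 expr1.
by rewrite /dquot /lead; case: ifP => _ H; rewrite ?seriesNE H ?mulNr.
Qed.

(** Only negative powers of [z_x] occur in [g]. *)
Definition all_neg x g := forall m, 0 <= m x -> g m = 0.

Lemma pair_ratio_lead x y g : x != y -> same x y -> all_neg x g ->
  all_neg x (pair_ratio x y g) /\
  (forall m, m x = -1 -> pair_ratio x y g m = (Q x y)^-1 * g m).
Proof.
move=> xy sxy Hg.
have stepE m : pair_ratio x y g m = geom x y g (m - ue x) - geom x y g (m - ue y).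
  rewrite /pair_ratio /numer sxy /dquot; case: ifP => _.
    by rewrite scalerBl seriesDE seriesNE !scaleXE.
  by rewrite scalerN -scaleNr opprB scalerBl seriesDE seriesNE !scaleXE.
split=> m mx; rewrite stepE /geom; have [_ _ -> ->] := exp_shift 0 m xy.
  rewrite [X in _ - X]ifF ?subr0; last lia.
  case: ifP => // H; have -> : m x = 0 by lia.
  by rewrite /= big_ord1 subrK mulr0n addr0 Hg ?mulr0.
rewrite mx /= big_ord_recl !big_ord1 /= !expr1 !mulr0n !addr0 subrK.
have [e1 _ _ _] := exp_shift 0 (m - ue y) xy.
have [_ e2 e3 _] := exp_shift 1 m xy.
rewrite (Hg (m - ue y + ue x)) ?e1 ?e3 ?mx // (Hg (m + _)) ?mulr0 ?subr0 ?addr0 //.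
by rewrite e2 mx.
Qed.

(** The part of degree [-1] in each variable of a word of one color, followed by
    a variable of another color: only the first term of each factor contributes. *)
Theorem expansion_lead s w m : uniq (rcons s w) ->
  {in s &, forall x y, same x y} -> {in s, forall x, ~~ same x w} ->
  {in s, forall x, m x = -1} ->
  expansion (rcons s w) m =
    (\prod_(x <- s) lead x w) * wprod (fun x y => (Q x y)^-1) s
    * (m + \sum_(x <- s) ue x == 0)%:R.
Proof.
elim: s m => [|x s IHs] m.
  by move=> *; rewrite /= !big_nil !mul1r addr0.
rewrite rcons_cons cons_uniq => /andP[xs us] Hs Hw Hm.
have xw : x != w by apply: contraNneq xs => ->; rewrite mem_rcons mem_head.
have nxs : x \notin s by apply: contra xs; rewrite mem_rcons inE orbC => ->.
rewrite /= foldr_rcons.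
set G := pair_ratio x w _.
have HG : all_neg x G /\ (forall m, m x = -1 ->
    G m = lead x w * expansion (rcons s w) (m + ue x)).
  rewrite /G /pair_ratio /numer (negPf (Hw x (mem_head _ _))) scale1r; split=> m' mx.
    exact: dquot_ge0.
  exact: dquot_lead.
have mx : m x = -1 by apply: Hm; rewrite mem_head.
have [_ Hst] : all_neg x (foldr (pair_ratio x) G s) /\ (forall m, m x = -1 ->
    foldr (pair_ratio x) G s m = (\prod_(y <- s) (Q x y)^-1) * G m); last first.
  rewrite Hst // (proj2 HG) // IHs //; first 1 last.
  - by move=> y z sy sz; apply: Hs; rewrite inE ?sy ?sz orbT.
  - by move=> y sy; apply: Hw; rewrite inE sy orbT.
  - move=> y sy; rewrite ffunE unit_expE Hm ?inE ?sy ?orbT //.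
    by case: eqP => // e; rewrite -e sy in nxs.
  by rewrite !big_cons -addrA; ring.
have : {subset s <= s} by [].
elim: {1 3 4 5}s => [|y t IHt] ts /=.
  by rewrite big_nil; split; [case: HG|move=> m' _; rewrite mul1r].
have [|IH1 IH2] := IHt; first by move=> a ta; apply: ts; rewrite inE ta orbT.
have sy : y \in s by apply: ts; rewrite mem_head.
have [| |H1 H2] := @pair_ratio_lead x y _ _ _ IH1.
- by apply: contraNneq nxs => ->.
- by apply: Hs; rewrite inE ?eqxx ?sy ?orbT.
by split=> // m' mx'; rewrite H2 // IH2 // big_cons mulrA.
Qed.

End Expansion.

(** * Consequences of the exchange relations *)

Section ExchangeFamily.
Variables (R : comNzRingType) (M : lmodType R) (N : nat).
Variables (Phi : nat -> 'S_N -> M) (z : 'I_N -> R) (p w : R).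
Local Notation c := (p ^+ N.-1).

(** [Phi s g] stands for the word of length [N + 1] whose letters are
    [e(z_(g 0)), ..., e(z_(g (s-1))), y(w), e(z_(g s)), ..., e(z_(g (N-1)))],
    where [e] and [y] are currents with the exchange relations of [e_a] and [e_b]
    for [p = q_a] and [a_ab = 1 - N].  The relation between [e] and [y] is
    multiplied by [p^(N-1)] to clear the denominators. *)
Definition exchange_family : Prop :=
  (forall s (i : 'I_N) (g : 'S_N), i = s :> nat ->
     (z (g i) - c * w) *: Phi s.+1 g = (c * z (g i) - w) *: Phi s g) /\
  (forall s (i j : 'I_N) (g : 'S_N), j = i.+1 :> nat -> (j < s)%N || (s <= i)%N ->
     (p ^+ 2 * z (g i) - z (g j)) *: Phi s g =
     (z (g i) - p ^+ 2 * z (g j)) *: Phi s (tperm i j * g)%g).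

Hypothesis M_char : forall x : M, x + x = 0 -> x = 0.
Hypothesis family : exchange_family.

(** The sum of the words with the letter [y] at position [s], with weights [G] in
    the variables taken in the order of the word. *)
Definition weighted_sum (G : ('I_N -> R) -> R) s : M := \sum_(g : 'S_N) G (z \o g) *: Phi s g.

Lemma weighted_sum_exchange_w (i : 'I_N) s G : i = s :> nat ->
  weighted_sum (fun y => (y i - c * w) * G y) s.+1 = weighted_sum (fun y => (c * y i - w) * G y) s.
Proof.
by move=> e; apply: eq_bigr => g _; rewrite /= mulrC -[LHS]scalerA (proj1 family) // scalerA mulrC.
Qed.

(** The transposition of two neighbouring variables pairs the terms of the sum,
    and exchanges the two sides of their exchange relation. *)
Lemma weighted_sum_exchange_z (i j : 'I_N) s G : j = i.+1 :> nat -> (j < s)%N || (s <= i)%N ->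
  (forall y, G (y \o tperm i j) = G y) ->
  weighted_sum (fun y => (p ^+ 2 * y i - y j) * G y) s = 0.
Proof.
move=> eij hs HG; apply: M_char; rewrite {1}/weighted_sum.
rewrite (eq_bigr (fun g : 'S_N => ((z (g i) - p ^+ 2 * z (g j)) * G (z \o g))
   *: Phi s (tperm i j * g)%g)); last first.
  by move=> g _; rewrite /= mulrC -[LHS]scalerA (proj2 family) // scalerA mulrC.
rewrite (reindex_inj (mulgI (tperm i j))) /= -big_split big1 //= => g _.
rewrite mulgA tperm2 mul1g !permM tpermL tpermR -scalerDl.
have -> : G (z \o (tperm i j * g)%g) = G (z \o g).
  rewrite -[RHS]HG; congr G; apply/funext => k /=; by rewrite permM.
by rewrite [X in X *: _](_ : _ = 0) ?scale0r //=; ring.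
Qed.

(** A sufficient condition for a combination of the words to vanish: the weights
    [E s] are combinations of the exchange relations between [y] and a
    neighbouring letter, with coefficients [G], which link the positions [s] and
    [s + 1], and of those between neighbouring letters [e], with coefficients [S]
    symmetric in the two variables. *)
Lemma exchange_certificate (E G : nat -> ('I_N -> R) -> R)
    (S : nat -> 'I_N -> ('I_N -> R) -> R) :
  (forall s (i j : 'I_N) y, j = i.+1 :> nat -> S s i (y \o tperm i j) = S s i y) ->
  (forall s y, (s <= N)%N -> E s y =
     \sum_(i < N) (if i.+1 == s then (y i - c * w) * G s y else 0)
     - \sum_(i < N) (if i == s :> nat then (c * y i - w) * G s.+1 y else 0)
     + \sum_(i < N) \sum_(j < N)
         (if (j == i.+1 :> nat) && ((j < s)%N || (s <= i)%N)
          then (p ^+ 2 * y i - y j) * S s i y else 0)) ->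
  \sum_(s < N.+1) weighted_sum (E s) s = 0.
Proof.
move=> HS HE0.
have HE s y : (s <= N)%N -> E s y =
     \sum_(i < N | i.+1 == s) (y i - c * w) * G s y
     - \sum_(i < N | i == s :> nat) (c * y i - w) * G s.+1 y
     + \sum_(i < N) \sum_(j < N | (j == i.+1 :> nat) && ((j < s)%N || (s <= i)%N))
         (p ^+ 2 * y i - y j) * S s i y.
  move=> sN; rewrite HE0 // -!big_mkcond; congr (_ + _).
  by apply: eq_bigr => i _; rewrite -big_mkcond.
pose X (s : nat) : M := \sum_(i < N | i.+1 == s) weighted_sum (fun y => (y i - c * w) * G s y) s.
pose Y (s : nat) : M := \sum_(i < N | i == s :> nat) weighted_sum (fun y => (c * y i - w) * G s.+1 y) s.
have Es (s : 'I_N.+1) : weighted_sum (E s) s = X s - Y s.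
  transitivity (X s - Y s + \sum_(i < N)
    \sum_(j < N | (j == i.+1 :> nat) && ((j < s)%N || (s <= i)%N))
      weighted_sum (fun y => (p ^+ 2 * y i - y j) * S s i y) s); last first.
    rewrite big1 ?addr0 // => i _; rewrite big1 // => j /andP[/eqP eij hs].
    by apply: weighted_sum_exchange_z => // y; apply: HS.
  rewrite /X /Y -sumrN.
  rewrite /weighted_sum (eq_bigr (fun g : 'S_N => \sum_(i < N | i.+1 == s)
      ((z (g i) - c * w) * G s (z \o g)) *: Phi s g
    - \sum_(i < N | i == s :> nat) ((c * z (g i) - w) * G s.+1 (z \o g)) *: Phi s g
    + \sum_(i < N) \sum_(j < N | (j == i.+1 :> nat) && ((j < s)%N || (s <= i)%N))
       ((p ^+ 2 * z (g i) - z (g j)) * S s i (z \o g)) *: Phi s g)); last first.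
    move=> g _; rewrite HE ?scalerDl ?scaleNr ?scaler_suml; last by rewrite -ltnS.
    by congr (_ + _); apply: eq_bigr => i _; rewrite scaler_suml.
  rewrite !big_split /= sumrN; congr (_ + _); [congr (_ + _)|].
  - by rewrite exchange_big.
  - by rewrite exchange_big sumrN.
  - by rewrite exchange_big; apply: eq_bigr => i _; rewrite exchange_big.
rewrite (eq_bigr _ (fun s _ => Es s)) sumrB big_ord_recl [X in _ - X]big_ord_recr /=.
have -> : X 0%N = 0 by rewrite /X big1.
have -> : Y N = 0 by rewrite /Y big1 // => i /eqP iN; have := ltn_ord i; rewrite iN ltnn.
rewrite add0r addr0 -sumrB big1 // => s _; apply/eqP; rewrite subr_eq0; apply/eqP.
rewrite /X /Y /= /bump add1n; apply: eq_big => [i|i /eqP[eis]]; first by rewrite eqSS.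
exact: weighted_sum_exchange_w.
Qed.

End ExchangeFamily.

(** * Certificates for the wheel conditions *)

(** In the lemmas below, [wheelN_k] states that the [k]-th elementary symmetric
    polynomial of the [N] variables acts on the Serre combination as its value at
    the wheel [z_i = p^(N-1-2i) w].  The weights of the words and the statements
    are multiplied by [p^(N-1)], so that only polynomials in [p] occur. *)

Ltac wheel_perm :=
  move=> [|[|[|[|s]]]] [[|[|[|i]]] ?] [[|[|[|j]]] ?] y //= _; rewrite ?tpermD.
Ltac wheel_ring :=
  move=> [|[|[|[|s]]]] y // _; rewrite !big_ord_recl !big_ord0 /=;
  rewrite ?big_ord_recl ?big_ord0 /=; ring.

Section Wheel1.
Variables (R : comNzRingType) (M : lmodType R).
Variables (Phi : nat -> 'S_1 -> M) (z : 'I_1 -> R) (p w : R).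
Hypothesis charM : forall x : M, x + x = 0 -> x = 0.
Hypothesis fam : exchange_family Phi z p w.
Local Notation i0 := (ord0 : 'I_1).

Lemma wheel1_1 :
  \sum_(s < 2) weighted_sum Phi z (fun y => [:: 1; -1]`_s *
    (y i0 - w)) s = 0.
Proof.
apply: (exchange_certificate charM fam
  (E := fun s y => [:: 1; -1]`_s *
    (y i0 - w))
  (G := fun s y => match s with
    | 1 => - 1
    | _ => 0 end)
  (S := fun s i y => match s, nat_of_ord i with
    | _, _ => 0 end)).
  by wheel_perm.
by wheel_ring.
Qed.

End Wheel1.

Section Wheel2.
Variables (R : comNzRingType) (M : lmodType R).
Variables (Phi : nat -> 'S_2 -> M) (z : 'I_2 -> R) (p w : R).
Hypothesis charM : forall x : M, x + x = 0 -> x = 0.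
Hypothesis fam : exchange_family Phi z p w.
Local Notation i0 := (ord0 : 'I_2).
Local Notation i1 := (lift ord0 ord0 : 'I_2).

Lemma wheel2_1 :
  \sum_(s < 3) weighted_sum Phi z (fun y => [:: p; - (p ^+ 2 + 1); p]`_s *
    (p * (y i0 + y i1) - (p ^+ 2 + 1) * w)) s = 0.
Proof.
apply: (exchange_certificate charM fam
  (E := fun s y => [:: p; - (p ^+ 2 + 1); p]`_s *
    (p * (y i0 + y i1) - (p ^+ 2 + 1) * w))
  (G := fun s y => match s with
    | 1 => - (p + p ^+ 3)
    | 2 => (1 + p ^+ 2)
    | _ => 0 end)
  (S := fun s i y => match s, nat_of_ord i with
    | 0, 0 => - p ^+ 2
    | 2, 0 => 1
    | _, _ => 0 end)).
  by wheel_perm.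
by wheel_ring.
Qed.

Lemma wheel2_2 :
  \sum_(s < 3) weighted_sum Phi z (fun y => [:: p; - (p ^+ 2 + 1); p]`_s *
    (p * (y i0 * y i1 - w ^+ 2))) s = 0.
Proof.
apply: (exchange_certificate charM fam
  (E := fun s y => [:: p; - (p ^+ 2 + 1); p]`_s *
    (p * (y i0 * y i1 - w ^+ 2)))
  (G := fun s y => match s with
    | 1 => - p ^+ 2 * w - p * y i1
    | 2 => p * w + p ^+ 2 * y i0
    | _ => 0 end)
  (S := fun s i y => match s, nat_of_ord i with
    | 0, 0 => - p * w
    | 2, 0 => p * w
    | _, _ => 0 end)).
  by wheel_perm.
by wheel_ring.
Qed.

End Wheel2.

Section Wheel3.
Variables (R : comNzRingType) (M : lmodType R).
Variables (Phi : nat -> 'S_3 -> M) (z : 'I_3 -> R) (p w : R).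
Hypothesis charM : forall x : M, x + x = 0 -> x = 0.
Hypothesis fam : exchange_family Phi z p w.
Local Notation i0 := (ord0 : 'I_3).
Local Notation i1 := (lift ord0 ord0 : 'I_3).
Local Notation i2 := (lift ord0 (lift ord0 ord0) : 'I_3).

Lemma wheel3_1 :
  \sum_(s < 4) weighted_sum Phi z (fun y =>
    [:: p ^+ 2; - (p ^+ 4 + p ^+ 2 + 1); p ^+ 4 + p ^+ 2 + 1; - p ^+ 2]`_s *
    (p ^+ 2 * (y i0 + y i1 + y i2) - (p ^+ 4 + p ^+ 2 + 1) * w)) s = 0.
Proof.
apply: (exchange_certificate charM fam
  (E := fun s y => [:: p ^+ 2; - (p ^+ 4 + p ^+ 2 + 1); p ^+ 4 + p ^+ 2 + 1; - p ^+ 2]`_s *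
    (p ^+ 2 * (y i0 + y i1 + y i2) - (p ^+ 4 + p ^+ 2 + 1) * w))
  (G := fun s y => match s with
    | 1 => - (p ^+ 2 + p ^+ 4 + p ^+ 6)
    | 2 => (1 + 2 * p ^+ 2 + 2 * p ^+ 4 + p ^+ 6)
    | 3 => - (1 + p ^+ 2 + p ^+ 4)
    | _ => 0 end)
  (S := fun s i y => match s, nat_of_ord i with
    | 0, 0 => - (p ^+ 4 + p ^+ 6)
    | 0, 1 => - p ^+ 4
    | 1, 1 => (p ^+ 2 + p ^+ 4 + p ^+ 6)
    | 2, 0 => (1 + p ^+ 2 + p ^+ 4)
    | 3, 0 => - p ^+ 2
    | 3, 1 => - (1 + p ^+ 2)
    | _, _ => 0 end)).
  by wheel_perm.
by wheel_ring.
Qed.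

Lemma wheel3_2 :
  \sum_(s < 4) weighted_sum Phi z (fun y =>
    [:: p ^+ 2; - (p ^+ 4 + p ^+ 2 + 1); p ^+ 4 + p ^+ 2 + 1; - p ^+ 2]`_s *
    (p ^+ 2 * (y i0 * y i1 + y i0 * y i2 + y i1 * y i2) - (p ^+ 4 + p ^+ 2 + 1) * w ^+ 2)) s = 0.
Proof.
apply: (exchange_certificate charM fam
  (E := fun s y => [:: p ^+ 2; - (p ^+ 4 + p ^+ 2 + 1); p ^+ 4 + p ^+ 2 + 1; - p ^+ 2]`_s *
    (p ^+ 2 * (y i0 * y i1 + y i0 * y i2 + y i1 * y i2) - (p ^+ 4 + p ^+ 2 + 1) * w ^+ 2))
  (G := fun s y => match s with
    | 1 => - (p ^+ 2 + p ^+ 4 + p ^+ 6) * w - (p ^+ 2 + p ^+ 4 + p ^+ 6) * y i1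
    | 2 => (1 + 2 * p ^+ 2 + 2 * p ^+ 4 + p ^+ 6) * w + (p ^+ 2 + p ^+ 4 + p ^+
        6) * y i0 + (1 + p ^+ 2 + p ^+ 4) * y i2
    | 3 => - (1 + p ^+ 2 + p ^+ 4) * w - (1 + p ^+ 2 + p ^+ 4) * y i1
    | _ => 0 end)
  (S := fun s i y => match s, nat_of_ord i with
    | 0, 0 => - (p ^+ 2 + p ^+ 4 + p ^+ 6) * w - p ^+ 4 * y i2
    | 0, 1 => - (p ^+ 4 + p ^+ 6) * y i0
    | 1, 1 => (1 + p ^+ 2 + p ^+ 4) * w + (p ^+ 2 + p ^+ 4 + p ^+ 6) * y i0
    | 2, 0 => (p ^+ 2 + p ^+ 4 + p ^+ 6) * w + (1 + p ^+ 2 + p ^+ 4) * y i2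
    | 3, 0 => - (1 + p ^+ 2) * y i2
    | 3, 1 => - (1 + p ^+ 2 + p ^+ 4) * w - p ^+ 2 * y i0
    | _, _ => 0 end)).
  by wheel_perm.
by wheel_ring.
Qed.

Lemma wheel3_3 :
  \sum_(s < 4) weighted_sum Phi z (fun y =>
    [:: p ^+ 2; - (p ^+ 4 + p ^+ 2 + 1); p ^+ 4 + p ^+ 2 + 1; - p ^+ 2]`_s *
    (p ^+ 2 * (y i0 * y i1 * y i2 - w ^+ 3))) s = 0.
Proof.
apply: (exchange_certificate charM fam
  (E := fun s y => [:: p ^+ 2; - (p ^+ 4 + p ^+ 2 + 1); p ^+ 4 + p ^+ 2 + 1; - p ^+ 2]`_s *
    (p ^+ 2 * (y i0 * y i1 * y i2 - w ^+ 3)))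
  (G := fun s y => match s with
    | 1 => - p ^+ 4 * w ^+ 2 - p ^+ 4 * y i1 * w - p ^+ 2 * y i1 * y i2
    | 2 => (p ^+ 2 + p ^+ 4) * w ^+ 2 + p ^+ 4 * y i0 * w + (p ^+ 2 + p ^+ 4) *
        y i0 * y i2 + p ^+ 2 * y i2 * w
    | 3 => - p ^+ 2 * w ^+ 2 - p ^+ 4 * y i0 * y i1 - p ^+ 2 * y i1 * w
    | _ => 0 end)
  (S := fun s i y => match s, nat_of_ord i with
    | 0, 0 => - p ^+ 4 * w ^+ 2 - p ^+ 2 * y i2 * w
    | 0, 1 => - p ^+ 4 * y i0 * w
    | 1, 1 => p ^+ 2 * w ^+ 2 + (p ^+ 2 + p ^+ 4) * y i0 * w
    | 2, 0 => p ^+ 4 * w ^+ 2 + (p ^+ 2 + p ^+ 4) * y i2 * w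
    | 3, 0 => - p ^+ 2 * y i2 * w
    | 3, 1 => - p ^+ 2 * w ^+ 2 - p ^+ 4 * y i0 * w
    | _, _ => 0 end)).
  by wheel_perm.
by wheel_ring.
Qed.

End Wheel3.

(** * The Serre sum and the wheel *)

Section SymmetricAction.
Variables (R : comNzRingType) (M : lmodType R) (N : nat).
Implicit Types (K : M) (a b : 'I_N -> R) (t : {mpoly R[N]}).

Lemma meval_action t a b K : (forall i, a i *: K = b i *: K) ->
  t.@[a] *: K = t.@[b] *: K.
Proof.
move=> H; rewrite -(subrK t.@[b] t.@[a]) scalerDl -[RHS]add0r; congr (_ + _).
elim/mpolyind: t => [|c m t _ _ IHt]; first by rewrite !meval0 subrr scale0r.
rewrite !mevalD opprD addrACA scalerDl IHt addr0 !mevalZ -mulrBr -scalerA !mevalX.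
rewrite scalerBl; apply/eqP; rewrite -[eqbRHS](scaler0 _ c); apply/eqP; congr (_ *: _).
apply/eqP; rewrite subr_eq0; apply/eqP.
elim: (index_enum _) => [|i s IHs]; first by rewrite !big_nil.
rewrite !big_cons mulrC -scalerA.
have -> : a i ^+ m i *: K = b i ^+ m i *: K.
  elim: (m i) => [|k IHk]; first by rewrite !expr0.
  by rewrite exprSr -scalerA H scalerA mulrC -scalerA IHk scalerA -exprS.
by rewrite scalerA mulrC -scalerA IHs scalerA.
Qed.

(** A symmetric polynomial acts on [K] through its value at [b] as soon as the
    elementary symmetric polynomials do. *)
Lemma symmetric_action t a b K : t \is symmetric ->
  (forall k : 'I_N, (mesym N R k.+1).@[a] *: K = (mesym N R k.+1).@[b] *: K) ->
  t.@[a] *: K = t.@[b] *: K.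
Proof.
move=> /sym_fundamental [u [<- _]] H; rewrite !comp_mpoly_meval.
by apply: meval_action => i; rewrite !tnth_mktuple.
Qed.

End SymmetricAction.

Lemma meval_mwiden (R : comNzRingType) n (f : {mpoly R[n]}) (y : 'I_n.+1 -> R) :
  (mwiden f).@[y] = f.@[fun i => y (widen_ord (leqnSn n) i)].
Proof.
elim/mpolyind: f => [|c m f _ _ IHf]; first by rewrite mwiden0 !meval0.
rewrite mwidenD !mevalD IHf mwidenZ !mevalZ mwidenX !mevalX; congr (_ * _ + _).
rewrite big_ord_recr /= mnmwiden_ordmax expr0 mulr1.
by apply: eq_bigr => i _; rewrite mnmwiden_widen.
Qed.

Lemma mesym_sum (R : comNzRingType) n (y : 'I_n -> R) :
  (mesym n R 1).@[y] = \sum_i y i.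
Proof. by rewrite mesym1E raddf_sum; apply: eq_bigr => i _; apply: mevalXU. Qed.

Lemma mesym_prod (R : comNzRingType) n (y : 'I_n -> R) :
  (mesym n R n).@[y] = \prod_i y i.
Proof. by rewrite mesymnnE rmorph_prod; apply: eq_bigr => i _; apply: mevalXU. Qed.

(** The second elementary symmetric polynomial in three variables. *)
Lemma mesym_3_2 (R : comNzRingType) (y : 'I_3 -> R) :
  (mesym 3 R 2).@[y] = y ord0 * y (lift ord0 ord0)
    + y ord0 * y (lift ord0 (lift ord0 ord0))
    + y (lift ord0 ord0) * y (lift ord0 (lift ord0 ord0)).
Proof.
rewrite mesymSS mevalD mevalM mevalXU !meval_mwiden mesym_sum mesym_prod.
rewrite !big_ord_recl !big_ord0 /=.
have -> : widen_ord (leqnSn 2) ord0 = ord0 :> 'I_3 by apply: val_inj.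
have -> : widen_ord (leqnSn 2) (lift ord0 ord0) = lift ord0 ord0 :> 'I_3.
  exact: val_inj.
have -> : ord_max = lift ord0 (lift ord0 ord0) :> 'I_3 by apply: val_inj.
ring.
Qed.

Lemma meval_sym_perm (R : comNzRingType) n (f : {mpoly R[n]}) (y : 'I_n -> R)
  (g : 'S_n) : f \is symmetric -> f.@[y \o g] = f.@[y].
Proof.
move=> /issymP fs; rewrite -{2}(fs g) {fs}.
elim/mpolyind: f => [|c m f _ _ IHf]; first by rewrite msym0 !meval0.
rewrite msymD msymZ !mevalD !mevalZ IHf msymX !mevalX; congr (_ * _ + _).
rewrite [RHS](reindex_inj (perm_inj (s := g))) /=.
by apply: eq_bigr => i _; rewrite mnmE permK.
Qed.

Section WheelAnnihilator.
Variables (C : fieldType) (n : nat) (M : lmodType {mpoly C[n]}) (N : nat).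
Variables (Phi : nat -> 'S_N -> M) (z : 'I_N -> {mpoly C[n]}) (p : C).
Variable w : {mpoly C[n]}.
Hypothesis charC : 2 != 0 :> C.
Hypothesis p_neq0 : p != 0.
Hypothesis fam : exchange_family Phi z p%:MP w.

(** The combination of words that enters the quantum Serre relation. *)
Definition serre_sum : M := \sum_(s < N.+1)
  ((-1) ^+ s * qbinom p N s)%:MP *: \sum_(g : 'S_N) Phi s g.

(** The value of [z_k / w] on the wheel
    [z_0 = p^2 z_1 = ... = p^(2(N-1)) z_(N-1) = p^(N-1) w]. *)
Definition wheel_ratio (k : nat) : C := p ^+ N.-1 / p ^+ (2 * k).

Lemma no_two_torsion (x : M) : x + x = 0 -> x = 0.
Proof.
move=> xx; have: (2%:MP : {mpoly C[n]}) *: x = 0.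
  by rewrite -[2]/(1 + 1) mpolyCD scalerDl !scale1r.
move/(congr1 (fun u => (2^-1)%:MP *: u)).
by rewrite scaler0 scalerA -mpolyCM mulVf // scale1r.
Qed.

Lemma scale_cancel (a : C) (x : M) : a != 0 -> a%:MP *: x = 0 -> x = 0.
Proof.
move=> a0 /(congr1 (fun u => (a^-1)%:MP *: u)).
by rewrite scaler0 scalerA -mpolyCM mulVf // scale1r.
Qed.

(** The conclusion of a certificate, read as an action on the Serre sum, when the
    weights are [a * f - b] with [f] symmetric and [b] the value of [a * f] at the
    wheel. *)
Lemma serre_sum_action (co : seq {mpoly C[n]}) (e : ('I_N -> {mpoly C[n]}) -> {mpoly C[n]})
    (f a b : {mpoly C[n]}) :
  (forall g : 'S_N, e (z \o g) = a * f - b) ->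
  (forall s : 'I_N.+1, co`_s = (p ^+ N.-1 * ((-1) ^+ s * qbinom p N s))%:MP) ->
  \sum_(s < N.+1) weighted_sum Phi z (fun y => co`_s * e y) s = 0 ->
  (a * f) *: serre_sum = b *: serre_sum.
Proof.
move=> He Hco H; apply/eqP; rewrite -subr_eq0 -scalerBl; apply/eqP.
apply: (@scale_cancel (p ^+ N.-1)); first by rewrite expf_neq0.
rewrite -[RHS]H /serre_sum scalerA mulrC -scalerA !scaler_sumr.
apply: eq_bigr => s _; rewrite /weighted_sum !scaler_sumr; apply: eq_bigr => g _.
by rewrite He Hco mpolyCM !scalerA; congr (_ *: _); ring.
Qed.

Lemma wheel_ratioE (k : nat) : (wheel_ratio k)%:MP = p%:MP ^+ N.-1 * p^-1%:MP ^+ (2 * k)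
  :> {mpoly C[n]}.
Proof. by rewrite /wheel_ratio mpolyCM -exprVn -!rmorphXn. Qed.

End WheelAnnihilator.

Section WheelCases.
Variables (C : fieldType) (n : nat) (p : C).
Hypothesis p_neq0 : p != 0.

Lemma serre_coef1 (s : 'I_2) : [:: 1; -1]`_s = (p ^+ 0 * ((-1) ^+ s * qbinom p 1 s))%:MP
  :> {mpoly C[n]}.
Proof.
rewrite -(rmorph1 (@mpolyC n C)) -rmorphN /=.
by case: s => [[|[|s]] ?] //=; congr (_%:MP); rewrite /exprz /=; field; rewrite ?p_neq0.
Qed.

Lemma serre_coef2 (s : 'I_3) : [:: p%:MP; - (p%:MP ^+ 2 + 1); p%:MP]`_s =
  (p ^+ 1 * ((-1) ^+ s * qbinom p 2 s))%:MP :> {mpoly C[n]}.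
Proof.
rewrite -(rmorph1 (@mpolyC n C)) -rmorphXn -rmorphD -rmorphN /=.
by case: s => [[|[|[|s]]] ?] //=; congr (_%:MP); rewrite /exprz /=; field; rewrite ?p_neq0.
Qed.

Lemma serre_coef3 (s : 'I_4) :
  [:: p%:MP ^+ 2; - (p%:MP ^+ 4 + p%:MP ^+ 2 + 1); p%:MP ^+ 4 + p%:MP ^+ 2 + 1;
      - p%:MP ^+ 2]`_s = (p ^+ 2 * ((-1) ^+ s * qbinom p 3 s))%:MP :> {mpoly C[n]}.
Proof.
rewrite -(rmorph1 (@mpolyC n C)) -!rmorphXn -!rmorphD -!rmorphN /=.
case: s => [[|[|[|[|s]]]] ?] //=; congr (_%:MP); rewrite /exprz /=; field.
all: by rewrite ?p_neq0.
Qed.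

Lemma mpolyCV_cancel : p%:MP * p^-1%:MP = 1 :> {mpoly C[n]}.
Proof. by rewrite -mpolyCM mulfV. Qed.

Variables (M : lmodType {mpoly C[n]}) (w : {mpoly C[n]}).
Hypothesis charC : 2 != 0 :> C.
Local Notation annihilated N Phi z := (forall k : 'I_N,
  (mesym N _ k.+1).@[z] *: serre_sum Phi p =
  (mesym N _ k.+1).@[fun j => (wheel_ratio N p j)%:MP * w] *: serre_sum Phi p).
Let charM := @no_two_torsion C n M charC.

Lemma wheel_annihilator1 (Phi : nat -> 'S_1 -> M) (z : 'I_1 -> {mpoly C[n]}) :
  exchange_family Phi z p%:MP w -> annihilated 1 Phi z.
Proof.
move=> fam [[|//] k]; rewrite !mesym_sum !big_ord_recl !big_ord0 wheel_ratioE /= !addr0.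
have H : (1 * z ord0) *: serre_sum Phi p = w *: serre_sum Phi p.
  apply: (serre_sum_action p_neq0 _ serre_coef1 (wheel1_1 charM fam)) => g.
  by rewrite mul1r /= [g _]ord1.
by rewrite mul1r in H; rewrite H !mulr1 mul1r.
Qed.

Lemma wheel_annihilator2 (Phi : nat -> 'S_2 -> M) (z : 'I_2 -> {mpoly C[n]}) :
  exchange_family Phi z p%:MP w -> annihilated 2 Phi z.
Proof.
move=> fam k; have pp := mpolyCV_cancel.
set ez := (mesym _ _ _).@[z]; set ek := _.@[fun=> _].
suff H : (p%:MP * ez) *: serre_sum Phi p = (p%:MP * ek) *: serre_sum Phi p.
  apply/eqP; rewrite -subr_eq0 -scalerBl; apply/eqP; apply: (scale_cancel p_neq0).
  rewrite scalerA mulrBr scalerBl H; exact: subrr.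
have sym g : ez = (mesym 2 _ k.+1).@[z \o (g : 'S_2)].
  by rewrite meval_sym_perm // mesym_sym.
rewrite {}/ek; case: (nat_of_ord k) (ltn_ord k) @ez sym => [|[|m]] kN ez sym; last by discriminate kN.
- apply: (serre_sum_action p_neq0 _ serre_coef2) (wheel2_1 charM fam) => g.
  rewrite (sym g) !mesym_sum !big_ord_recl !big_ord0 !wheel_ratioE /=; ring: pp.
- apply: (serre_sum_action p_neq0 _ serre_coef2) (wheel2_2 charM fam) => g.
  rewrite (sym g) !mesym_prod !big_ord_recl !big_ord0 !wheel_ratioE /=; ring: pp.
Qed.

Lemma wheel_annihilator3 (Phi : nat -> 'S_3 -> M) (z : 'I_3 -> {mpoly C[n]}) :
  exchange_family Phi z p%:MP w -> annihilated 3 Phi z.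
Proof.
move=> fam k; have pp := mpolyCV_cancel.
set ez := (mesym _ _ _).@[z]; set ek := _.@[fun=> _].
suff H : (p%:MP ^+ 2 * ez) *: serre_sum Phi p = (p%:MP ^+ 2 * ek) *: serre_sum Phi p.
  apply/eqP; rewrite -subr_eq0 -scalerBl; apply/eqP.
  apply: (@scale_cancel _ _ _ (p ^+ 2)); first by rewrite expf_neq0.
  rewrite scalerA rmorphXn /= mulrBr scalerBl H; exact: subrr.
have sym g : ez = (mesym 3 _ k.+1).@[z \o (g : 'S_3)].
  by rewrite meval_sym_perm // mesym_sym.
rewrite {}/ek; case: (nat_of_ord k) (ltn_ord k) @ez sym => [|[|[|m]]] kN ez sym; last by discriminate kN.
- apply: (serre_sum_action p_neq0 _ serre_coef3) (wheel3_1 charM fam) => g.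
  rewrite (sym g) !mesym_sum !big_ord_recl !big_ord0 !wheel_ratioE /=; ring: pp.
- apply: (serre_sum_action p_neq0 _ serre_coef3) (wheel3_2 charM fam) => g.
  rewrite (sym g) !mesym_3_2 !wheel_ratioE /=; ring: pp.
- apply: (serre_sum_action p_neq0 _ serre_coef3) (wheel3_3 charM fam) => g.
  rewrite (sym g) !mesym_prod !big_ord_recl !big_ord0 !wheel_ratioE /=; ring: pp.
Qed.

(** The elementary symmetric polynomials in the variables of a Serre sum act on it
    by their values at the wheel [z_k = p^(N-1-2k) w]. *)
Theorem wheel_annihilator N (Phi : nat -> 'S_N -> M) (z : 'I_N -> {mpoly C[n]}) :
  (N <= 3)%N -> exchange_family Phi z p%:MP w -> annihilated N Phi z.
Proof.
case: N Phi z => [|[|[|[|N]]]] Phi z N3 fam; first by case.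
- exact: (wheel_annihilator1 fam).
- exact: (wheel_annihilator2 fam).
- exact: (wheel_annihilator3 fam).
- discriminate N3.
Qed.

End WheelCases.

(** * Laurent polynomials among formal series *)

Section PolynomialSeries.
Variables (C : fieldType) (N : nat).
Implicit Types (f : series C N) (p : {mpoly C[N]}) (m : exponent N).

(** A polynomial as a formal series. *)
Definition ser p : series C N := p *: @one_series C N.

Lemma one_series_mexp m (k : 'X_{1..N}) : @one_series C N (m - mexp k) = (m == mexp k)%:R.
Proof. by rewrite /one_series subr_eq0. Qed.

Lemma mexp_inj : injective (@mexp N).
Proof. by move=> k l /ffunP e; apply/mnmP => i; have := e i; rewrite !ffunE => -[]. Qed.

Lemma ser_coef p k : ser p (mexp k) = p@_k.
Proof.
rewrite /ser scale_seriesE mul_seriesE.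
rewrite (eq_bigr (fun l => p@_l * (l == k)%:R)); last first.
  by move=> l _; rewrite one_series_mexp (inj_eq mexp_inj) eq_sym.
have [kp|kp] := boolP (k \in msupp p).
  rewrite (bigD1_seq k) ?msupp_uniq //= eqxx mulr1 big1 ?addr0 // => l /negPf ->.
  by rewrite mulr0.
rewrite memN_msupp_eq0 // big_seq big1 // => l lp.
by case: eqP => [e|_]; rewrite ?mulr0 //; rewrite -e lp in kp.
Qed.

Lemma ser_inj : injective ser.
Proof. by move=> p1 p2 e; apply/mpolyP => k; rewrite -!ser_coef e. Qed.

Lemma serM p1 p2 : p1 *: ser p2 = ser (p1 * p2).
Proof. by rewrite /ser scalerA. Qed.

Lemma series_polynomial f (S : nat) :
  (forall x m, m x < 0 -> f m = 0) -> (forall m, S%:Z < \sum_x m x -> f m = 0) ->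
  exists p, f = ser p.
Proof.
move=> Hneg Hdeg.
exists (\sum_(l : 'X_{1..N < S.+1}) f (mexp l) *: 'X_[l]); apply: seriesP => m.
rewrite /ser scaler_suml series_sumE.
rewrite (eq_bigr (fun l : 'X_{1..N < S.+1} => f (mexp l) * (m == mexp l)%:R)); last first.
  by move=> l _; rewrite scaleXXE one_series_mexp.
have [/existsP [x mx]|] := boolP [exists x, m x < 0].
  rewrite (Hneg _ _ mx) big1 // => l _; case: eqP => [e|_]; last by rewrite mulr0.
  by move: mx; rewrite e ffunE.
rewrite negb_exists => /forallP m_ge0.
pose k : 'X_{1..N} := [multinom `|m x|%N | x < N].
have mk : m = mexp k.
  apply/ffunP => x; rewrite ffunE mnmE gez0_abs //.
  by have := m_ge0 x; rewrite -leNgt.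
have [kS|kS] := ltnP (mdeg k) S.+1.
  rewrite (bigD1 (BMultinom kS)) //= -mk eqxx mulr1 big1 ?addr0 // => l lk.
  rewrite mk (inj_eq mexp_inj); case: eqP => [e|_]; last by rewrite mulr0.
  by case/eqP: lk; apply: val_inj.
rewrite Hdeg.
  rewrite big1 // => l _; rewrite mk (inj_eq mexp_inj).
  case: eqP => [e|_]; last by rewrite mulr0.
  by have := bmdeg l; rewrite -e ltnNge kS.
rewrite (eq_bigr (fun x => (k x)%:Z)); last by move=> x _; rewrite mk ffunE.
by rewrite -(big_morph Posz PoszD erefl) ltz_nat -mdegE.
Qed.

(** The exponents of [z_x] in [f] are bounded below. *)
Definition bounded_below x f := exists k : int, forall m, m x < k -> f m = 0.

(** The total degree of the terms of [f] is bounded above. *)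
Definition bounded_degree f := exists S : int, forall m, S < \sum_x m x -> f m = 0.

Lemma sum_unit_exp m i : \sum_x (m - unit_exp i) x = \sum_x m x - 1.
Proof.
rewrite (eq_bigr (fun x => m x - (x == i)%:Z)); last by move=> x _; rewrite !ffunE.
rewrite sumrB; congr (_ - _).
by rewrite (bigD1 i) //= eqxx big1 ?addr0 // => x /negPf ->.
Qed.

Lemma bounded_below_scale x p f : bounded_below x f -> bounded_below x (p *: f).
Proof.
apply: scale_ind => [|g h [k Hk] [l Hl]|c g [k Hk]|i g [k Hk]].
- by exists 0.
- exists (Num.min k l) => m.
  by rewrite lt_min => /andP[mk ml]; rewrite seriesDE Hk // Hl // addr0.
- by exists k => m mk; rewrite scaleCE Hk // mulr0.
- exists k => m mk; rewrite scaleXE Hk // !ffunE.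
  by apply: le_lt_trans mk; case: eqP => /=; lia.
Qed.

Lemma bounded_degree_scale p f : bounded_degree f -> bounded_degree (p *: f).
Proof.
apply: scale_ind => [|g h [k Hk] [l Hl]|c g [k Hk]|i g [k Hk]].
- by exists 0.
- exists (Num.max k l) => m.
  by rewrite gt_max => /andP[mk ml]; rewrite seriesDE Hk // Hl // addr0.
- by exists k => m mk; rewrite scaleCE Hk // mulr0.
- exists (k + 1) => m mk; rewrite scaleXE Hk // sum_unit_exp; lia.
Qed.

(** The product of all the variables. *)
Definition all_vars : {mpoly C[N]} := \prod_(i < N) 'X_i.

Lemma scale_all_vars K f m : (all_vars ^+ K *: f) m = f [ffun x => m x - K%:Z].
Proof.
elim: K m => [|K IHK] m.
  by rewrite expr0 scale1r; congr f; apply/ffunP => x; rewrite ffunE subr0.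
have e : all_vars = 'X_[\sum_(i < N) U_(i)] by rewrite /all_vars mprodXE.
rewrite exprS -scalerA {1}e -['X_[_]]scale1r scaleXXE mul1r IHK.
congr f; apply/ffunP => x; rewrite !ffunE.
suff -> : (\sum_(i < N) U_(i))%MM x = 1%N by rewrite -addrA -opprD -PoszD add1n.
rewrite mnm_sumE (bigD1 x) //= mnm1E eqxx big1 // => i /negPf ix.
by rewrite mnm1E ix.
Qed.

(** A series is a Laurent polynomial as soon as its exponents are bounded below
    and its total degree above. *)
Lemma laurent_series f : (forall x, bounded_below x f) -> bounded_degree f ->
  exists K p, all_vars ^+ K *: f = ser p.
Proof.
move=> /fin_all_exists [k Hk] [S HS].
pose K := (\max_x `|k x|)%N; exists K.
apply: (@series_polynomial _ (`|S|%N + N * K)%N) => [x m mx|m mS].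
  rewrite scale_all_vars (Hk x) // ffunE.
  have : (`|k x| <= K)%N by apply: (leq_bigmax x).
  by lia.
rewrite scale_all_vars HS //.
rewrite (eq_bigr (fun x => m x - K%:Z)); last by move=> x _; rewrite ffunE.
rewrite sumrB sumr_const card_ord -mulr_natl natz.
by move: (\sum_x m x) mS => t; rewrite !PoszD PoszM; lia.
Qed.

End PolynomialSeries.
Arguments all_vars {C N}.
(** * Substitutions and divisibility by differences of variables *)

Section Substitution.
Variables (C : fieldType) (N : nat).
Implicit Types (p a : {mpoly C[N]}) (x y : 'I_N) (h : 'I_N -> {mpoly C[N]}).

Lemma mpoly_morph_eq (S : comNzRingType) (F G : {rmorphism {mpoly C[N]} -> S}) :
  (forall c : C, F c%:MP = G c%:MP) -> (forall x, F 'X_x = G 'X_x) -> F =1 G.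
Proof.
move=> HC HX; elim/mpolyind => [|c m p _ _ IHp]; first by rewrite !rmorph0.
rewrite !rmorphD IHp -!mul_mpolyC !rmorphM HC mpolyXE_id !rmorph_prod.
by congr (_ * _ + _); apply: eq_bigr => i _; rewrite !rmorphXn HX.
Qed.

(** Substitution of polynomials for the variables. *)
Definition subst h p : {mpoly C[N]} := mmap (@mpolyC N C) h p.

HB.instance Definition _ h :=
  GRing.RMorphism.copy (subst h) (mmap (@mpolyC N C) h).

Lemma substC h c : subst h c%:MP = c%:MP. Proof. exact: mmapC. Qed.
Lemma substX h x : subst h 'X_x = h x. Proof. by rewrite /subst mmapX mmap1U. Qed.
Lemma substZ h c p : subst h (c *: p) = c *: subst h p.
Proof. by rewrite /subst mmapZ mul_mpolyC. Qed.

Lemma meval_subst h p z : (subst h p).@[z] = p.@[fun x => (h x).@[z]].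
Proof.
pose F : {rmorphism {mpoly C[N]} -> C} := meval z \o subst h.
pose G : {rmorphism {mpoly C[N]} -> C} := meval (fun x => (h x).@[z]).
apply: (mpoly_morph_eq (F := F) (G := G)) => [c|x]; rewrite /F /G /=.
  by rewrite substC !mevalC.
by rewrite substX mevalXU.
Qed.

(** The substitution of [z_y] for [z_x]. *)
Definition identify x y : {mpoly C[N]} -> {mpoly C[N]} :=
  subst (fun i => 'X_(if i == x then y else i)).

HB.instance Definition _ x y := GRing.RMorphism.copy (identify x y)
  (subst (fun i => 'X_(if i == x then y else i))).

Lemma msymXU (s : 'S_N) x : msym s 'X_x = 'X_(s x) :> {mpoly C[N]}.
Proof. by rewrite /msym mmapX mmap1U. Qed.

Lemma msymC (s : 'S_N) (c : C) : msym s c%:MP = c%:MP.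
Proof. by rewrite /msym mmapC. Qed.

Lemma mpolyX_inj : injective (fun x : 'I_N => 'X_x : {mpoly C[N]}).
Proof.
move=> x y /(congr1 (mcoeff U_(y))); rewrite !mcoeffXU eqxx.
by case: eqP => // _ /eqP; rewrite eq_sym oner_eq0.
Qed.

Lemma scaleX_sub_neq0 (c : C) x y : x != y -> c *: 'X_x - 'X_y != 0 :> {mpoly C[N]}.
Proof.
move=> xy; apply: contraTneq (oner_neq0 C) => /(congr1 (mcoeff U_(y))).
rewrite mcoeffB mcoeffZ !mcoeffXU eqxx (negPf xy) mulr0 sub0r mcoeff0 => /eqP.
by rewrite oppr_eq0 => ->.
Qed.

Lemma identify_eq0 x y p : identify x y p = 0 -> exists a, p = ('X_x - 'X_y) * a.
Proof.
have [a Ha] : exists a, p - identify x y p = ('X_x - 'X_y) * a.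
  elim/mpolyind: p => [|c m p _ _ [b Hb]].
    by exists 0; rewrite rmorph0 subrr mulr0.
  suff [e He] : exists e, 'X_[m] - identify x y 'X_[m] = ('X_x - 'X_y) * e.
    exists (c *: e + b); rewrite rmorphD /= opprD addrACA Hb mulrDr; congr (_ + _).
    by rewrite {1}/identify substZ -scalerBr He scalerAr.
  have prodD f g f' g' : (exists e, f - f' = ('X_x - 'X_y) * e) ->
      (exists e, g - g' = ('X_x - 'X_y) * e) ->
      exists e, f * g - f' * g' = ('X_x - 'X_y) * e :> {mpoly C[N]}.
    move=> [e He] [e' He']; exists (e * g + f' * e').
    have -> : f * g - f' * g' = (f - f') * g + f' * (g - g') by ring.
    by rewrite He He'; ring.
  rewrite mpolyXE_id rmorph_prod; elim: (index_enum _) => [|i s IHs].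
    by exists 0; rewrite !big_nil subrr mulr0.
  rewrite !big_cons; apply: (prodD) => //.
  elim: (m i) => [|k IHk]; first by exists 0; rewrite !expr0 rmorph1 subrr mulr0.
  rewrite !exprS rmorphM; apply: (prodD) => //.
  rewrite /= /identify substX; case: eqP => [->|_]; first by exists 1; rewrite mulr1.
  by exists 0; rewrite subrr mulr0.
by move=> p0; exists a; rewrite -Ha p0 subr0.
Qed.

Lemma antisym_identify x y p : 2 != 0 :> C -> msym (tperm x y) p = - p ->
  identify x y p = 0.
Proof.
move=> char2 Hp.
have e : identify x y (msym (tperm x y) p) = identify x y p.
  pose F : {rmorphism {mpoly C[N]} -> {mpoly C[N]}} := identify x y \o msym (tperm x y).
  apply: (mpoly_morph_eq (F := F) (G := identify x y)) => [c|i]; rewrite /F /=.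
    by rewrite msymC.
  rewrite msymXU /identify !substX; case: tpermP => [->|->|]; rewrite ?eqxx //.
    by case: ifP.
  by case: ifP => // /eqP ->.
move/eqP: e; rewrite Hp rmorphN -subr_eq0 -opprD oppr_eq0 => /eqP H.
have : (2 : C) *: identify x y p = 0 by rewrite scaler_nat mulr2n.
by move/eqP; rewrite scaler_eq0 (negPf char2) => /eqP.
Qed.

(** A polynomial that vanishes on several hyperplanes [z_x = z_y] is divisible by
    the product of the differences, as these are pairwise coprime. *)
Lemma divide_pairs (L : seq ('I_N * 'I_N)) p : uniq L ->
  (forall pr, pr \in L -> (pr.1 < pr.2)%N /\ identify pr.1 pr.2 p = 0) ->
  exists a, p = (\prod_(pr <- L) ('X_(pr.1) - 'X_(pr.2))) * a.
Proof.
elim: L => [|[x y] L IHL]; first by exists p; rewrite big_nil mul1r.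
move=> /= /andP[xyL uL] H.
have [a pE] : exists a, p = (\prod_(pr <- L) ('X_(pr.1) - 'X_(pr.2))) * a.
  by apply: IHL => // pr prL; apply: H; rewrite inE prL orbT.
have [/= xy] := H (x, y) (mem_head _ _).
rewrite pE rmorphM rmorph_prod => /eqP; rewrite mulf_eq0 => /orP[|/eqP].
  rewrite prodf_seq_eq0 => /hasP [[s t] stL] /=.
  have [/= st _] := H (s, t) (mem_behead (s := (x, y) :: L) stL).
  have ne : (s, t) != (x, y) by apply: contraNneq xyL => <-.
  rewrite rmorphB /= /identify !substX subr_eq0 => /eqP /mpolyX_inj.
  move: ne st xy; rewrite xpair_eqE.
  case: (eqVneq s x) => [->|sx]; case: (eqVneq t x) => [->|tx] //=.
  - by rewrite ltnn.
  - by move=> ty _ _ yt; rewrite yt eqxx in ty.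
  - by move=> _ + xy1 sy; rewrite sy ltnNge ltnW.
  - by move=> _ st _ e; rewrite e ltnn in st.
by move/identify_eq0 => [b ->]; exists b; rewrite big_cons /= mulrA [X in _ = X * _]mulrC.
Qed.

Lemma wprod_sorted (T : eqType) (R : comNzRingType) (lt : rel T) (phi : T -> T -> R) s :
  irreflexive lt -> transitive lt -> sorted lt s ->
  wprod phi s = \prod_(x <- s) \prod_(y <- s | lt x y) phi x y.
Proof.
move=> irr tr; elim: s => [|x s IHs] /=; first by rewrite big_nil.
move=> xs; have := order_path_min tr xs => /allP xlt.
rewrite IHs ?(path_sorted xs) // !big_cons irr.
congr (_ * _).
  by rewrite [LHS]big_seq [RHS]big_seq_cond; apply: eq_bigl => y;
     case: (boolP (y \in s)) => // /xlt ->.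
rewrite [LHS]big_seq [RHS]big_seq; apply: eq_bigr => y ys.
rewrite big_cons ifF //; apply: contraFF (irr x) => yx.
exact: tr (xlt _ ys) yx.
Qed.

Lemma wprod_enum (R : comNzRingType) (phi : 'I_N -> 'I_N -> R) :
  wprod phi (enum 'I_N) = \prod_(x < N) \prod_(y < N | (x < y)%N) phi x y.
Proof.
rewrite (@wprod_sorted 'I_N _ (fun x y : 'I_N => (x < y)%N)).
- rewrite big_enum /=; apply: eq_bigr => x _; by rewrite big_enum_cond.
- by move=> x; rewrite ltnn.
- by move=> x y z; apply: ltn_trans.
- have := iota_ltn_sorted 0 N; rewrite -val_enum_ord sorted_map; apply: sub_sorted.
  by [].
Qed.

End Substitution.

(** * Words of currents *)

Section Correlations.
Variables (C : fieldType) (r : nat) (A : 'M[int]_r) (d : 'I_r -> nat) (q : C).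
Variables (V : lmodType C) (X : drinfeld_ops r V) (pr : int -> {linear V -> V}) (i0 : int).
Hypothesis symA : forall a b, (d a)%:Z * A a b = (d b)%:Z * A b a.
Hypothesis q_neq0 : q != 0.
Hypothesis hX : is_Uq_module A d q X.
Hypothesis hgr : graded_module X pr i0.
Variables (v : V) (xi : {scalar V}) (dv dx : int).
Hypothesis hv : homogeneous pr dv v.
Hypothesis hxi : forall j u, j != dx -> homogeneous pr j u -> xi u = 0.
Variables (N : nat) (col : 'I_N -> 'I_r).
Implicit Types (x y : 'I_N) (s t : seq 'I_N) (m : exponent N).

Local Notation ue := unit_exp.

(** The factor [q_a^(a_ab)] of the exchange relation between two currents. *)
Definition pole x y : C := qroot d q (col x) ^ A (col x) (col y).

Lemma pole_neq0 x y : pole x y != 0.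
Proof. by rewrite expfz_neq0 // expf_neq0. Qed.

Lemma poleC x y : pole x y = pole y x.
Proof.
have e a z : (q ^+ d a) ^ z = q ^ ((d a)%:Z * z) by rewrite -exprz_exp.
by rewrite /pole /qroot !e symA.
Qed.

(** The coefficient of [z_x^(m x)] in the current of [z_x]. *)
Definition mode x m : V -> V := e_op X (col x) (- m x).

(** The action of a word of modes. *)
Definition word_act s m u0 : V := apply_word [seq mode x m | x <- s] u0.

(** The correlation series for the currents taken in the order of the word [s]. *)
Definition word_corr s : series C N := fun m => xi (word_act s m v).

Lemma word_act_cat s t m u0 : word_act (s ++ t) m u0 = word_act s m (word_act t m u0).
Proof. by rewrite /word_act /apply_word map_cat foldr_cat. Qed.

Lemma word_act_lin s m a u0 u1 :
  word_act s m (a *: u0 + u1) = a *: word_act s m u0 + word_act s m u1.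
Proof.
elim: s => //= x s IHs; rewrite /word_act /= -!/(word_act s m _) IHs.
by rewrite /mode linearP.
Qed.

Lemma word_act0 s m : word_act s m 0 = 0.
Proof.
elim: s => //= x s IHs; rewrite /word_act /= -/(word_act s m 0) IHs.
by rewrite /mode linear0.
Qed.

Lemma eq_word_act s m m' u0 : {in s, m =1 m'} -> word_act s m u0 = word_act s m' u0.
Proof.
move=> H; rewrite /word_act; congr apply_word; apply/eq_in_map => x sx.
by rewrite /mode H.
Qed.

(** The word contributes the opposite of the total degree of its variables. *)
Lemma word_act_degree s m j u0 : homogeneous pr j u0 ->
  homogeneous pr (j - \sum_(x <- s) m x) (word_act s m u0).
Proof.
move=> hu; elim: s => [|x s IHs]; first by rewrite big_nil subr0.
have := e_degree hgr (col x) (- m x) IHs.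
by rewrite big_cons opprD [- m x + _]addrC addrA.
Qed.

Lemma homogeneous_gt0 j u0 : i0 < j -> homogeneous pr j u0 -> u0 = 0.
Proof. by move=> ij <-; apply: (pr_bound hgr). Qed.

Lemma word_corr_degree s m : dv - \sum_(x <- s) m x != dx -> word_corr s m = 0.
Proof. by move=> H; apply: hxi H _; apply: word_act_degree. Qed.

Lemma word_corr_last s x m : m x < dv - i0 -> word_corr (rcons s x) m = 0.
Proof.
move=> mx; rewrite /word_corr -cats1 word_act_cat.
rewrite [word_act [:: x] m v](@homogeneous_gt0 (dv - \sum_(y <- [:: x]) m y)).
- by rewrite word_act0 linear0.
- by rewrite big_seq1; lia.
- exact: word_act_degree.
Qed.

Lemma subseq_pair x y s : subseq [:: x; y] s ->
  exists u w t, s = u ++ x :: w ++ y :: t.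
Proof.
elim: s => [|z s IHs] //=; case: eqP => [<- |_].
  rewrite sub1seq => /splitPr [w t]; by exists [::], w, t.
by move/IHs => [u [w [t ->]]]; exists (z :: u), w, t.
Qed.

(** Far in the direction [z_x / z_y], the modes of [y] and of the letters that
    follow send [v] to a vector of large degree, hence to [0]. *)
Lemma tame_word_corr s t : uniq (s ++ t) -> tame_word s (word_corr (s ++ t)).
Proof.
move=> U x y /subseq_pair [u [w [t' es]]] m.
pose T := dv - \sum_(z <- t' ++ t) m z.
exists (absz (i0 - T + m y + 1)%R) => j hj; set m' := m + _.
have e : s ++ t = (u ++ x :: w) ++ [:: y] ++ (t' ++ t) by rewrite es -!catA /= -catA.
rewrite /word_corr e word_act_cat [word_act ([:: y] ++ _) _ _]word_act_cat.
move: U; rewrite e -catA /= cat_uniq cons_uniq.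
rewrite mem_cat inE !negb_or cat_uniq cons_uniq => /and3P[_ _].
case/andP=> /and3P[_ xy xt] /and3P[_ _ /andP[yt _]].
rewrite [word_act [:: y] _ _](_ : _ = 0) ?word_act0 ?linear0 //.
rewrite (@eq_word_act (t' ++ t) m' m) => [|z tz]; last first.
  have zx : z != x by apply: contraNneq xt => <-.
  have zy : z != y by apply: contraNneq yt => <-.
  by have [_ -> _ _] := exp_shift_other j m zx zy.
have yx : y != x by rewrite eq_sym.
have my : m' y = m y - j%:Z.
  have e1 k : ((ue x - ue y) *+ k) y = - k%:Z.
    elim: k => [|k IHk]; first by rewrite mulr0n ffunE.
    by rewrite mulrS ffunE IHk !ffunE eqxx (negPf yx) -addn1 PoszD opprD addrC.
  by rewrite ffunE e1.
have := @word_act_degree (t' ++ t) m _ _ hv; rewrite -/T => HT.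
apply: (@homogeneous_gt0 (T - \sum_(z <- [:: y]) m' z)).
  by rewrite big_seq1 my; lia.
exact: word_act_degree.
Qed.

Theorem word_corr_exchange u x y w : uniq (u ++ x :: y :: w) ->
  dfac pole x y *: word_corr (u ++ x :: y :: w) =
  dfac pole y x *: word_corr (u ++ y :: x :: w).
Proof.
wlog xy : x y / (x < y)%N => [H|U].
  case: (ltngtP x y) => [|yx|/val_inj ->] //; first exact: H.
  move=> U; symmetry; apply: H => //.
  by rewrite (perm_uniq (perm_swap u y x w)).
have xny : x != y by apply: contraTneq xy => ->; rewrite ltnn.
have yx : (y < x)%N = false by apply/negbTE; rewrite -leqNgt ltnW.
rewrite /dfac xy yx (poleC y x).
move: U; rewrite cat_uniq /= inE !negb_or => /and4P[_ /and3P[xu yu _] /andP[_ xw] /andP[yw _]].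
apply: seriesP => m; rewrite !scalerBl !seriesDE !seriesNE -!mul_mpolyC -!scalerA !scaleCE !scaleXE.
rewrite /word_corr.
pose T := word_act w m v.
have act a b (m' : exponent N) : (forall z, z != x -> z != y -> m' z = m z) ->
    word_act (u ++ a :: b :: w) m' v = word_act u m (mode a m' (mode b m' T)).
  move=> H; rewrite -[a :: b :: w]/([:: a; b] ++ w) !word_act_cat.
  have Hs s' : x \notin s' -> y \notin s' -> {in s', m' =1 m}.
    move=> xs ys z sz; apply: H; [apply: contraNneq xs|apply: contraNneq ys]; by move=> <-.
  by rewrite (eq_word_act _ (Hs w xw yw)) (eq_word_act _ (Hs u xu yu)).
have Hx z : z != x -> z != y -> (m - ue x) z = m z.
  by move=> zx zy; have [_ _ _ ->] := exp_shift_other 0 m zx zy.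
have Hy z : z != x -> z != y -> (m - ue y) z = m z.
  by move=> zx zy; have [_ _ -> _] := exp_shift_other 0 m zx zy.
rewrite !act //.
have [_ _ eyx exx] := exp_shift 0 m xny.
have yx' : y != x by rewrite eq_sym.
have [_ _ exy eyy] := exp_shift 0 m yx'.
have := e_e hX (col x) (col y) (- m x) (- m y) T; rewrite -/(pole x y).
move/(congr1 (fun z => xi (word_act u m z))).
have lin a b z1 z2 : xi (word_act u m (a *: z1 - b *: z2)) =
    a * xi (word_act u m z1) - b * xi (word_act u m z2).
  rewrite -scaleNr word_act_lin linearP /= -[(- b) *: z2]addr0 word_act_lin.
  by rewrite word_act0 addr0 linearZ /= mulNr.
by rewrite /= !lin !mul1r => H; rewrite /mode exx eyx exy eyy !opprB ![1 - _]addrC.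
Qed.

Definition same_color x y : bool := col x == col y.

Lemma same_colorC x y : same_color x y = same_color y x.
Proof. exact: eq_sym. Qed.

Local Notation num := (numer C same_color).

(** Once the polar factors are cleared, the correlation series does not depend on
    the order of the currents. *)
Lemma word_corr_invariant s s' : perm_eq s s' -> uniq s ->
  wprod (dfac pole) s *: word_corr s = wprod (dfac pole) s' *: word_corr s'.
Proof.
apply: (word_invariant (Phi := fun s => wprod (dfac pole) s *: word_corr s)).
move=> u x y w U; rewrite !wprod_pair wrestC -[LHS]scalerA -[RHS]scalerA; congr (_ *: _).
exact: word_corr_exchange.
Qed.

Lemma sum_perm_enum s m : perm_eq s (enum 'I_N) -> \sum_(x <- s) m x = \sum_x m x.
Proof. by move=> Hs; rewrite (perm_big _ Hs) /= big_enum. Qed.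

Lemma word_corr_laurent : exists K p, forall s, perm_eq s (enum 'I_N) ->
  all_vars ^+ K *: (wprod (dfac pole) s *: word_corr s) = ser p.
Proof.
have [K [p Hp]] : exists K p, all_vars ^+ K *:
    (wprod (dfac pole) (enum 'I_N) *: word_corr (enum 'I_N)) = ser p.
  apply: laurent_series => [x|].
    (* The lower bound on the exponents of [z_x] is seen on a word that ends by [x]. *)
    have Hx : perm_eq (enum 'I_N) (rcons (rem x (enum 'I_N)) x).
      by rewrite perm_sym perm_rcons perm_sym perm_to_rem // mem_enum.
    rewrite (word_corr_invariant Hx) ?enum_uniq //.
    by apply: bounded_below_scale; exists (dv - i0) => m; apply: word_corr_last.
  apply: bounded_degree_scale; exists (dv - dx) => m Hm.
  by apply: word_corr_degree; rewrite sum_perm_enum //; lia.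
exists K, p => s Hs; rewrite (word_corr_invariant Hs) //.
by rewrite (perm_uniq Hs) enum_uniq.
Qed.

Lemma perm_series_scale (sg : 'S_N) (P : {mpoly C[N]}) (f : series C N) :
  perm_series sg (P *: f) = msym sg P *: perm_series sg f.
Proof.
elim/mpolyind: P => [|c k P _ _ IHP].
  by rewrite msym0 !scale0r; apply: seriesP => m.
rewrite msymD !scalerDl msymZ msymX -IHP; apply: seriesP => m.
rewrite seriesDE {1}/perm_series seriesDE !scaleXXE; congr (_ * f _ + _).
by apply/ffunP => x; rewrite !ffunE mnmE permK.
Qed.

Lemma perm_series_one (sg : 'S_N) : perm_series sg (@one_series C N) = @one_series C N.
Proof.
apply: seriesP => m; rewrite /perm_series /one_series; congr (_ : bool)%:R.
apply/eqP/eqP => [/ffunP e|->]; apply/ffunP => x; last by rewrite !ffunE.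
by have := e (sg^-1 x)%g; rewrite !ffunE permKV.
Qed.

(** The permutations of the variables that preserve their colors. *)
Definition color_preserving (sg : 'S_N) := forall x, col (sg x) = col x.

(** Permuting the variables of each color permutes the letters of the words. *)
Lemma perm_word_corr (sg : 'S_N) s : color_preserving sg ->
  perm_series sg (word_corr s) = word_corr (map sg s).
Proof.
move=> Hsg; apply: seriesP => m; rewrite /perm_series /word_corr /word_act -map_comp.
congr (xi (apply_word _ v)); apply: eq_map => x.
by rewrite /mode /= Hsg ffunE.
Qed.

(** The sign by which a permutation of the variables changes the factor attached
    to a pair; the product over all the pairs is the signature. *)
Definition pair_sign (sg : 'S_N) x y : {mpoly C[N]} :=
  if (x < y)%N == (sg x < sg y)%N then 1 else -1.

Lemma msym_dfac (sg : 'S_N) x y : color_preserving sg ->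
  msym sg (dfac pole x y) = pair_sign sg x y * dfac pole (sg x) (sg y).
Proof.
move=> Hsg; rewrite /dfac /pair_sign {3 4}/pole !Hsg -/(pole x y).
by case: (x < y)%N; case: (sg x < sg y)%N; rewrite /= msymB msymZ !msymXU ?mul1r ?mulN1r ?opprB.
Qed.

(* The colors increase with the variables, so that the order of two variables of
   different colors is preserved by [color_preserving] permutations. *)
Hypothesis col_mono : forall x y, (x <= y)%N -> (col x <= col y)%N.

Lemma msym_numer (sg : 'S_N) x y : color_preserving sg ->
  msym sg (num x y) = pair_sign sg x y * num (sg x) (sg y).
Proof.
move=> Hsg; rewrite /numer /pair_sign /same_color !Hsg.
case: ifP => [_|/eqP cxy].
  by case: (x < y)%N; case: (sg x < sg y)%N; rewrite /= msymB !msymXU ?mul1r ?mulN1r ?opprB.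
rewrite msym1 mulr1 ifT //.
have ltcol (a b : 'I_N) : (a < b)%N -> col a != col b -> (col a < col b)%N.
  by move=> ab cab; rewrite ltn_neqAle cab col_mono // ltnW.
have gtcol (a b : 'I_N) : (col a < col b)%N -> (a < b)%N.
  by rewrite !ltnNge; apply: contra; apply: col_mono.
have ncxy : col x != col y by apply/eqP.
case: (ltngtP x y) => [xy|yx|/val_inj exy]; last by rewrite exy in cxy.
  by rewrite gtcol // !Hsg ltcol.
by rewrite eq_sym eqbF_neg -leqNgt ltnW // gtcol // !Hsg ltcol // eq_sym.
Qed.

Lemma msym_wprod (sg : 'S_N) (phi : 'I_N -> 'I_N -> {mpoly C[N]}) s :
  (forall x y, msym sg (phi x y) = pair_sign sg x y * phi (sg x) (sg y)) ->
  msym sg (wprod phi s) = wprod (pair_sign sg) s * wprod phi (map sg s).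
Proof.
move=> H; rewrite rmorph_wprod wprod_map -wprodM; apply: eq_wprod => x y _ _.
exact: H.
Qed.

Lemma pair_sign_neq0 (sg : 'S_N) s : wprod (pair_sign sg) s != 0.
Proof.
elim: s => [|x s IHs] /=; first exact: oner_neq0.
rewrite mulf_neq0 // prodf_seq_neq0; apply/allP => y _.
by rewrite /pair_sign; case: ifP => _; rewrite ?oppr_eq0 oner_neq0.
Qed.

Lemma pair_sign_tperm x y s : x != y -> x \notin s -> y \notin s ->
  wprod (pair_sign (tperm x y)) (x :: y :: s) = -1.
Proof.
move=> xy xs ys; rewrite /= big_cons {1}/pair_sign tpermL tpermR.
have -> : (x < y)%N == (y < x)%N = false.
  by case: ltngtP => // /val_inj e; rewrite e eqxx in xy.
have fixs a : a \in s -> tperm x y a = a.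
  by move=> sa; apply: tpermD; [apply: contraNneq xs|apply: contraNneq ys] => ->.
rewrite (@eq_wprod _ _ (pair_sign (tperm x y)) (fun _ _ => 1)); last first.
  by move=> a b sa sb; rewrite /pair_sign !fixs // eqxx.
rewrite wprod1 mulr1 -mulrA -big_split big_seq big1 ?mulr1 //= => a sa.
rewrite /pair_sign tpermL tpermR fixs // [(y < a)%N == _]eq_sym.
by case: ifP => _; rewrite ?mulr1 // mulrNN mulr1.
Qed.

Lemma perm_eq_map_enum (sg : 'S_N) s : perm_eq s (enum 'I_N) ->
  perm_eq (map sg s) (enum 'I_N).
Proof.
move=> Hs; apply: uniq_perm.
- by rewrite (map_inj_uniq perm_inj) (perm_uniq Hs) enum_uniq.
- exact: enum_uniq.
move=> x; rewrite mem_enum; apply/mapP; exists ((sg^-1)%g x); last by rewrite permKV.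
by rewrite (perm_mem Hs) mem_enum.
Qed.

Lemma msym_all_vars (sg : 'S_N) K : msym sg (all_vars ^+ K) = all_vars ^+ K :> {mpoly C[N]}.
Proof.
rewrite rmorphXn /all_vars rmorph_prod; congr (_ ^+ _).
rewrite [RHS](reindex_inj (perm_inj (s := sg))) /=.
by apply: eq_bigr => i _; rewrite msymXU.
Qed.

(** The product of the differences of the variables of the same color. *)
Definition color_vandermonde : {mpoly C[N]} := wprod num (enum 'I_N).

Lemma color_vandermonde_perm s : perm_eq s (enum 'I_N) ->
  wprod num s = color_vandermonde.
Proof.
move=> Hs; apply: (wprod_perm (numerC C same_colorC) Hs).
by rewrite (perm_uniq Hs) enum_uniq.
Qed.

Lemma color_vandermonde_neq0 : color_vandermonde != 0.
Proof.
rewrite /color_vandermonde wprod_enum prodf_seq_neq0; apply/allP => x _ /=.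
rewrite prodf_seq_neq0; apply/allP => y _; apply/implyP => xy.
rewrite /numer xy; case: ifP => _; last exact: oner_neq0.
by rewrite -['X_x]scale1r scaleX_sub_neq0 //; apply: contraTneq xy => ->; rewrite ltnn.
Qed.

Lemma msym_vandermonde (sg : 'S_N) s : color_preserving sg -> perm_eq s (enum 'I_N) ->
  msym sg color_vandermonde = wprod (pair_sign sg) s * color_vandermonde.
Proof.
move=> Hsg Hs; rewrite -(color_vandermonde_perm Hs) msym_wprod; last first.
  by move=> x y; apply: msym_numer.
by rewrite !color_vandermonde_perm // perm_eq_map_enum.
Qed.

Hypothesis char2 : 2 != 0 :> C.

(** The product of the correlation series with all the polar factors does not
    depend on the order of the currents; it is a Laurent polynomial, divisible by
    the Vandermonde products since it is antisymmetric. *)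
Theorem word_corr_structure : exists K a,
  (forall s, perm_eq s (enum 'I_N) ->
     all_vars ^+ K *: (wprod (dfac pole) s *: word_corr s) =
     ser (color_vandermonde * a)) /\
  (forall sg, color_preserving sg -> msym sg a = a).
Proof.
have [K [p Hp]] := word_corr_laurent.
have Hsym sg s : color_preserving sg -> perm_eq s (enum 'I_N) ->
    msym sg p = wprod (pair_sign sg) s * p.
  move=> Hsg Hs; apply: ser_inj.
  have := congr1 (perm_series sg) (Hp s Hs).
  rewrite {2}/ser !perm_series_scale perm_series_one perm_word_corr //.
  rewrite msym_all_vars msym_wprod => [<-|x y]; last exact: msym_dfac.
  rewrite -serM -(Hp _ (perm_eq_map_enum sg Hs)) !scalerA; congr (_ *: _); ring.
have anti x y : x != y -> same_color x y -> identify x y p = 0.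
  move=> xy /eqP cxy; apply: antisym_identify => //.
  (* The sign is easy to compute on a word that starts with [x] and [y]. *)
  have Hs : perm_eq [:: x, y & rem y (rem x (enum 'I_N))] (enum 'I_N).
    rewrite perm_sym (perm_trans (perm_to_rem (_ : x \in _))) ?mem_enum //.
    rewrite perm_cons perm_to_rem //; rewrite rem_filter ?enum_uniq //.
    by rewrite mem_filter /= eq_sym xy mem_enum.
  have Us : uniq [:: x, y & rem y (rem x (enum 'I_N))].
    by rewrite (perm_uniq Hs) enum_uniq.
  move: Us; rewrite /= inE negb_or => /and3P[/andP[_ xs] ys _].
  rewrite (Hsym _ _ _ Hs) ?pair_sign_tperm ?mulN1r // => z.
  by case: tpermP => [->|->|].
pose L := [seq pr : 'I_N * 'I_N <- enum {: 'I_N * 'I_N} |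
  (pr.1 < pr.2)%N && same_color pr.1 pr.2].
have [|e|a pE] := @divide_pairs _ _ L p.
- by rewrite filter_uniq // enum_uniq.
- rewrite mem_filter => /andP[/andP[lt12 c12] _]; split=> //.
  by apply: anti => //; apply: contraTneq lt12 => ->; rewrite ltnn.
have VE : color_vandermonde = \prod_(pr <- L) ('X_(pr.1) - 'X_(pr.2)).
  rewrite /color_vandermonde wprod_enum pair_big_dep big_filter big_enum_cond /=.
  rewrite [LHS]big_mkcond [RHS]big_mkcond /=; apply: eq_bigr => e _.
  by rewrite /numer; case: ifP => //= ->; case: ifP.
rewrite -VE in pE; exists K, a; split=> [s Hs|sg Hsg]; first by rewrite -pE Hp.
have := Hsym sg (enum 'I_N) Hsg (perm_refl _).
rewrite pE msymM (msym_vandermonde Hsg (perm_refl _)) mulrA.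
by apply: mulfI; rewrite mulf_neq0 ?pair_sign_neq0 ?color_vandermonde_neq0.
Qed.

(** * The wheel conditions *)

Section Wheel.
Variables (ca cb : 'I_r) (w : 'I_N).
Variables (T : nat) (t : 'I_T -> 'I_N).
Hypothesis T_def : T = `|1 - A ca cb|%N.
Hypothesis diagA : A ca ca = 2.
Hypothesis ca_cb : ca != cb.
Hypothesis offA : A ca cb <= 0.
Hypothesis T_le3 : (T <= 3)%N.
Hypothesis t_inj : injective t.
Hypothesis t_col : forall k, col (t k) = ca.
Hypothesis w_col : col w = cb.
Hypothesis char0 : [pchar C] =i pred0.

Let p := qroot d q ca.

Let p_neq0 : p != 0. Proof. by rewrite expf_neq0. Qed.

Let T_eq : A ca cb = 1 - T%:Z. Proof. by rewrite T_def; lia. Qed.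

Let t_neq_w k : t k != w.
Proof. by apply: contraNneq ca_cb => e; rewrite -(t_col k) e w_col. Qed.

(* A word made of the variables [t k], permuted by [g], and of [w]: [Some i]
   stands for [t (g i)] and [None] for [w]. *)
Let place (g : 'S_T) (o : option 'I_T) : 'I_N := if o is Some i then t (g i) else w.

Let place_inj g : injective (place g).
Proof.
move=> [i|] [j|] //= e; first by congr Some; apply: (@perm_inj _ g); apply: t_inj.
  by have := t_neq_w (g i); rewrite e eqxx.
by have := t_neq_w (g j); rewrite e eqxx.
Qed.

(* The position of [w] in the [s]-th term of the Serre relation. *)
Let pattern (s : nat) : seq (option 'I_T) :=
  [seq Some i | i <- take s (enum 'I_T)] ++ None :: [seq Some i | i <- drop s (enum 'I_T)].

Let word (s : nat) g := map (place g) (pattern s).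

Let locals : seq 'I_N := w :: map t (enum 'I_T).
Let others : seq 'I_N := [seq x <- enum 'I_N | x \notin locals].

Let locals_uniq : uniq locals.
Proof.
rewrite /= (map_inj_uniq t_inj) enum_uniq andbT.
by apply/mapP => -[k _ e]; have := t_neq_w k; rewrite -e eqxx.
Qed.

Let pattern_uniq (s : nat) : uniq (pattern s).
Proof.
have Hp : perm_eq (pattern s) (None :: map Some (enum 'I_T)).
  by rewrite /pattern (perm_catCA _ [:: None]) /= -map_cat cat_take_drop.
rewrite (perm_uniq Hp) /= map_inj_uniq ?enum_uniq ?andbT; last by move=> k l [].
by apply/mapP => -[].
Qed.

Let word_uniq (s : nat) g : uniq (word s g).
Proof. by rewrite (map_inj_uniq (@place_inj g)) pattern_uniq. Qed.

Let word_perm (s : nat) g : perm_eq (word s g) locals.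
Proof.
apply: uniq_perm => // x; apply/mapP/idP => [[[i|] _ ->] /=|].
- by rewrite inE map_f ?orbT // mem_enum.
- by rewrite mem_head.
have mem_pattern o : o \in pattern s.
  rewrite mem_cat inE orbCA -mem_cat -map_cat cat_take_drop.
  by case: o => [i|//]; rewrite map_f ?orbT // mem_enum.
rewrite inE => /predU1P[->|/mapP[k _ ->]]; first by exists None.
by exists (Some (g^-1%g k)) => //=; rewrite permKV.
Qed.

Let full_perm l : perm_eq l locals -> perm_eq (l ++ others) (enum 'I_N).
Proof.
move=> Hl; have Ul : uniq l by rewrite (perm_uniq Hl).
apply: uniq_perm; [|exact: enum_uniq|] => [|x].
  rewrite cat_uniq Ul filter_uniq ?enum_uniq // andbT /=.
  apply/hasPn => x; rewrite mem_filter => /andP[+ _].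
  by rewrite (perm_mem Hl).
by rewrite mem_cat mem_filter (perm_mem Hl) mem_enum andbT orbN.
Qed.

Let full_uniq l : perm_eq l locals -> uniq (l ++ others).
Proof. by move=> Hl; rewrite (perm_uniq (full_perm Hl)) enum_uniq. Qed.

Let cross_perm (phi : 'I_N -> 'I_N -> {mpoly C[N]}) l : perm_eq l locals ->
  cross phi l others = cross phi locals others.
Proof. by move=> Hl; rewrite /cross (perm_big _ Hl). Qed.

Variables (K : nat) (a : {mpoly C[N]}).
Hypothesis a_corr : forall s, perm_eq s (enum 'I_N) ->
  all_vars ^+ K *: (wprod (dfac pole) s *: word_corr s) = ser (color_vandermonde * a).
Hypothesis a_sym : forall sg, color_preserving sg -> msym sg a = a.

(* The factors of the Vandermonde polynomial that involve another variable. *)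
Let rest : {mpoly C[N]} := cross num locals others * wprod num others.

Let vandermonde_split l : perm_eq l locals -> color_vandermonde = wprod num l * rest.
Proof.
move=> Hl; rewrite -(color_vandermonde_perm (full_perm Hl)) wprod_cat.
by rewrite (cross_perm _ Hl) mulrA.
Qed.

Let b : {mpoly C[N]} := rest * a.

Local Notation expan := (expansion pole same_color).

(** The remaining polar factors are those that involve another variable. *)
Let corr_expansion (s : nat) g :
  (all_vars ^+ K * (cross (dfac pole) locals others * wprod (dfac pole) others)) *:
    word_corr (word s g ++ others) = b *: expan (word s g).
Proof.
have Hw := word_perm s g.
apply: (@expansion_unique _ _ pole same_color pole_neq0) => //.
  by apply: tame_word_scale; apply: tame_word_corr; apply: full_uniq.
have := a_corr (full_perm Hw); rewrite wprod_cat (cross_perm _ Hw) (vandermonde_split Hw).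
rewrite /ser => H; transitivity ((wprod num (word s g) * rest * a) *: one_series C (N:=N)).
  by rewrite -H !scalerA; congr (_ *: _); ring.
by congr (_ *: _); rewrite /b; ring.
Qed.

Let Phi (s : nat) g : series C N := expan (word s g).

(** The quantum Serre relation, applied to the image of [v] by the other currents. *)
Let serre_zero : b *: serre_sum Phi p = 0.
Proof.
rewrite /serre_sum scaler_sumr.
pose P := all_vars ^+ K * (cross (dfac pole) locals others * wprod (dfac pole) others).
transitivity (P *: \sum_(s < T.+1) ((-1) ^+ s * qbinom p T s)%:MP *:
    \sum_(g : 'S_T) word_corr (word s g ++ others)).
  rewrite scaler_sumr; apply: eq_bigr => s _.
  have com (f1 f2 : {mpoly C[N]}) (h : series C N) : f1 *: (f2 *: h) = f2 *: (f1 *: h).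
    by rewrite !scalerA mulrC.
  rewrite [LHS]com [RHS]com; congr (_ *: _); rewrite !scaler_sumr.
  by apply: eq_bigr => g _; rewrite -corr_expansion.
rewrite [X in _ *: X](_ : _ = 0) ?scaler0 //; apply: seriesP => m.
rewrite series_sumE series0E.
have serre T' : T' = `|1 - A ca cb|%N -> forall (k : 'I_T' -> int) l u,
    \sum_(s < T'.+1) (-1) ^+ s * qbinom p T' s *: \sum_(g : 'S_T')
      apply_word ([seq (e_op X ca (k (g i)) : V -> V) | i <- take s (enum 'I_T')] ++
                  (e_op X cb l : V -> V) ::
                  [seq (e_op X ca (k (g i)) : V -> V) | i <- drop s (enum 'I_T')]) u = 0.
  by move=> ->; apply: (serre_e hX ca_cb).
have := serre T T_def (fun i => - m (t i)) (- m w) (word_act others m v).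
move/(congr1 xi); rewrite linear0 linear_sum => /= H; rewrite -[RHS]H.
apply: eq_bigr => s _; rewrite scaleCE series_sumE linearZ /= linear_sum /=.
congr (_ * _); apply: eq_bigr => g _.
rewrite /word_corr word_act_cat {1}/word_act /word /pattern !map_cat /= -!map_comp.
congr (xi (apply_word (_ ++ _ :: _) _)).
- by apply: eq_map => i; rewrite /= /mode t_col.
- by rewrite /mode w_col.
- by apply: eq_map => i; rewrite /= /mode t_col.
Qed.

Let expan_exchange u x y l : uniq (u ++ x :: y :: l) ->
  (pole x y *: 'X_x - 'X_y) *: expan (u ++ x :: y :: l) =
  ('X_x - pole x y *: 'X_y) *: expan (u ++ y :: x :: l).
Proof.
move=> U; have := expansion_exchange pole_neq0 same_colorC U.
have xy : x != y.
  move: U; rewrite cat_uniq => /and3P[_ _]; rewrite cons_uniq inE negb_or.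
  by case/andP => /andP[].
rewrite /dfac (poleC y x); case: (ltngtP x y) => // [_|e]; last first.
  by rewrite (val_inj e) eqxx in xy.
by rewrite -opprB -[X in _ = X *: _ -> _]opprB !scaleNr => /oppr_inj.
Qed.

Let pole_t k l : pole (t k) (t l) = p ^+ 2.
Proof. by rewrite /pole !t_col diagA. Qed.

Let pole_w k : p ^+ T.-1 * pole (t k) w = 1.
Proof.
have T0 : (0 < T)%N by case: k; case: (T).
rewrite /pole t_col w_col -/p T_eq -{2}(prednK T0) -addn1 PoszD opprD addrCA subrr addr0.
by rewrite -exprnN mulfV // expf_neq0.
Qed.

Let pattern_split (s : nat) (i j : 'I_T) : j = i.+1 :> nat -> (j < s)%N || (s <= i)%N ->
  exists u l, pattern s = u ++ Some i :: Some j :: l.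
Proof.
move=> eij; rewrite /pattern.
have [u [l [-> su]]] := enum_ord_adjacent eij.
case/orP => hs.
  rewrite take_cat drop_cat su ltnNge (_ : (i <= s)%N) /=; last by lia.
  have -> : (s - i = (s - i - 2).+2)%N by lia.
  exists (map Some u); eexists; by rewrite map_cat /= -catA.
rewrite take_cat drop_cat su; case: ltnP => is0.
  eexists (map Some (take s u) ++ None :: map Some (drop s u)); eexists.
  by rewrite map_cat /= -catA.
have -> : (s - i = 0)%N by lia.
by rewrite take0 cats0 drop0 /=; exists (map Some u ++ [:: None]); eexists; rewrite -catA.
Qed.

Let z (k : 'I_T) : {mpoly C[N]} := 'X_(t k).

Let family : exchange_family Phi z p%:MP 'X_w.
Proof.
split=> [s i g eis|s i j g eij hs]; rewrite /Phi /word.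
  have iT : (i < size (enum 'I_T))%N by rewrite size_enum_ord.
  have nthi : nth i (enum 'I_T) i = i by rewrite nth_ord_enum.
  have e1 : pattern s.+1 = map Some (take i (enum 'I_T)) ++
      Some i :: None :: map Some (drop i.+1 (enum 'I_T)).
    by rewrite /pattern -eis (take_nth i iT) nthi map_rcons cat_rcons.
  have e2 : pattern s = map Some (take i (enum 'I_T)) ++
      None :: Some i :: map Some (drop i.+1 (enum 'I_T)).
    by rewrite /pattern -eis (drop_nth i iT) nthi.
  have U := word_uniq s.+1 g; move: U; rewrite /word e1 e2 !map_cat /= => U.
  have pw : (p ^+ T.-1)%:MP * (pole (t (g i)) w)%:MP = 1 :> {mpoly C[N]}.
    by rewrite -mpolyCM pole_w mpolyC1.
  have pE : (p ^+ T.-1)%:MP = p%:MP ^+ T.-1 :> {mpoly C[N]} by apply: rmorphXn.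
  have -> : z (g i) - p%:MP ^+ T.-1 * 'X_w =
      (p ^+ T.-1)%:MP * (pole (t (g i)) w *: 'X_(t (g i)) - 'X_w).
    by rewrite mulrBr -mul_mpolyC mulrA pw mul1r pE.
  have -> : p%:MP ^+ T.-1 * z (g i) - 'X_w =
      (p ^+ T.-1)%:MP * ('X_(t (g i)) - pole (t (g i)) w *: 'X_w).
    by rewrite mulrBr -mul_mpolyC mulrA pw mul1r pE.
  by rewrite -scalerA (expan_exchange U) scalerA.
have [u [l eul]] := pattern_split eij hs.
have U := word_uniq s g; move: U; rewrite /word eul !map_cat /= => U.
have Up := pattern_uniq s; move: Up; rewrite eul cat_uniq /= inE !negb_or.
case/and3P=> _ /and3P[iu ju _] /and3P[/andP[ij il] jl _].
have fix_map e : Some i \notin e -> Some j \notin e ->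
    map (place (tperm i j * g)%g) e = map (place g) e.
  move=> ie je; apply/eq_in_map => -[k|//] ke /=; rewrite permM tpermD //.
    by apply: contraNneq ie => ->.
  by apply: contraNneq je => ->.
rewrite !fix_map // !permM tpermL tpermR.
have := expan_exchange U; rewrite pole_t => H.
have pE : (p ^+ 2)%:MP = p%:MP ^+ 2 :> {mpoly C[N]} by apply: rmorphXn.
by rewrite -pE !mul_mpolyC.
Qed.

(** The embedding of the polynomials as polynomials in the variables of the
    Serre relation, with the other variables as coefficients. *)
Let hat_var (x : 'I_N) : {mpoly {mpoly C[N]}[T]} :=
  if [pick k | t k == x] is Some k then 'X_k else ('X_x)%:MP.

Let hat : {rmorphism {mpoly C[N]} -> {mpoly {mpoly C[N]}[T]}} :=
  mmap (@mpolyC T {mpoly C[N]} \o @mpolyC N C) hat_var.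

Let hatC c : hat c%:MP = (c%:MP)%:MP. Proof. exact: mmapC. Qed.

Let hatXt k : hat 'X_(t k) = 'X_k.
Proof.
rewrite /hat /= mmapX mmap1U /hat_var; case: pickP => [l /eqP/t_inj -> //|/(_ k)].
by rewrite eqxx.
Qed.

Let hatX x : (forall k, t k != x) -> hat 'X_x = ('X_x)%:MP.
Proof.
move=> H; rewrite /hat /= mmapX mmap1U /hat_var; case: pickP => // k.
by rewrite (negPf (H k)).
Qed.

(** The substitution of the wheel for the variables [t k]. *)
Definition wheel_point (x : 'I_N) : {mpoly C[N]} :=
  if [pick k | t k == x] is Some k then (wheel_ratio T p k)%:MP * 'X_w else 'X_x.

Lemma wheel_point_t k : wheel_point (t k) = (wheel_ratio T p k)%:MP * 'X_w.
Proof.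
rewrite /wheel_point; case: pickP => [l /eqP/t_inj -> //|/(_ k)].
by rewrite eqxx.
Qed.

Lemma wheel_point_other x : (forall k, t k != x) -> wheel_point x = 'X_x.
Proof.
by move=> H; rewrite /wheel_point; case: pickP => // k; rewrite (negPf (H k)).
Qed.

Let t_or_not x : (exists k, x = t k) \/ (forall k, t k != x).
Proof.
have [/existsP [k /eqP <-]|] := boolP [exists k, t k == x]; first by left; exists k.
by rewrite negb_exists => /forallP; right.
Qed.

Let hat_id f : (hat f).@[z] = f.
Proof.
pose F : {rmorphism {mpoly C[N]} -> {mpoly C[N]}} := meval z \o hat.
apply: (mpoly_morph_eq (F := F) (G := idfun)) => [c|x]; rewrite /F /=.
  by rewrite hatC mevalC.
have [[k ->]|H] := t_or_not x; first by rewrite hatXt mevalXU.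
by rewrite hatX // mevalC.
Qed.

Let hat_wheel f :
  (hat f).@[fun k : 'I_T => (wheel_ratio T p k)%:MP * 'X_w] = subst wheel_point f.
Proof.
pose ev := meval (fun k : 'I_T => (wheel_ratio T p k)%:MP * 'X_w : {mpoly C[N]}).
pose F : {rmorphism {mpoly C[N]} -> {mpoly C[N]}} := ev \o hat.
apply: (mpoly_morph_eq (F := F) (G := subst wheel_point)) => [c|x]; rewrite /F /ev /=.
  by rewrite hatC mevalC substC.
rewrite substX; have [[k ->]|H] := t_or_not x; first by rewrite hatXt mevalXU wheel_point_t.
by rewrite hatX // mevalC wheel_point_other.
Qed.

Let hat_tperm f k l : msym (tperm k l) (hat f) = hat (msym (tperm (t k) (t l)) f).
Proof.
pose F : {rmorphism {mpoly C[N]} -> {mpoly {mpoly C[N]}[T]}} := msym (tperm k l) \o hat.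
pose G : {rmorphism {mpoly C[N]} -> {mpoly {mpoly C[N]}[T]}} :=
  hat \o msym (tperm (t k) (t l)).
apply: (mpoly_morph_eq (F := F) (G := G)) => [c|x]; rewrite /F /G /=.
  by rewrite msymC !hatC /msym mmapC.
rewrite msymXU; have [[i ->]|H] := t_or_not x.
  rewrite hatXt /msym mmapX mmap1U -hatXt; congr (hat 'X_ _).
  by case: tpermP => [->|->|/eqP ik /eqP il]; rewrite ?tpermL ?tpermR ?tpermD //
    (inj_eq t_inj) eq_sym.
by rewrite tpermD // !hatX // /msym mmapC.
Qed.

(** Both the Vandermonde polynomial and its factor in the [t k] and [w] change sign,
    so that their quotient [rest] is symmetric, and [b] as well. *)
Let b_tperm k l : msym (tperm (t k) (t l)) b = b.
Proof.
have [->|kl] := eqVneq k l; first by rewrite tperm1 msym1m.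
have tkl : t k != t l by rewrite (inj_eq t_inj).
have csg : color_preserving (tperm (t k) (t l)).
  by move=> x; case: tpermP => [->|->|]; rewrite ?t_col.
have [l0 Hl0] : exists l0, perm_eq [:: t k, t l & l0] locals.
  exists (rem (t l) (rem (t k) locals)).
  have mt i : t i \in locals by rewrite inE map_f ?orbT // mem_enum.
  rewrite perm_sym (perm_trans (perm_to_rem (mt k))) // perm_cons perm_to_rem //.
  by rewrite rem_filter // mem_filter /= eq_sym tkl mt.
have Ul : uniq [:: t k, t l & l0] by rewrite (perm_uniq Hl0).
move: (Ul); rewrite /= inE negb_or => /and3P[/andP[_ kl0] ll0 _].
have Uf := full_uniq Hl0; move: (Uf) => /=; rewrite inE negb_or.
case/and3P => /andP[_ kf] lf _.
have mapl : perm_eq (map (tperm (t k) (t l)) [:: t k, t l & l0]) [:: t k, t l & l0].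
  rewrite /= tpermL tpermR; have -> : map (tperm (t k) (t l)) l0 = l0.
    rewrite -[RHS]map_id; apply/eq_in_map => x xl.
    by rewrite tpermD //; [apply: contraNneq kl0|apply: contraNneq ll0] => ->.
  by rewrite (perm_catCA [:: t l] [:: t k] l0).
have N1 : msym (tperm (t k) (t l)) (wprod num [:: t k, t l & l0]) =
    - wprod num [:: t k, t l & l0].
  rewrite msym_wprod; last by move=> x y; apply: msym_numer.
  by rewrite pair_sign_tperm // mulN1r (wprod_perm (numerC C same_colorC) mapl) //
    (perm_uniq mapl).
have V1 : msym (tperm (t k) (t l)) color_vandermonde = - color_vandermonde.
  rewrite (@msym_vandermonde _ [:: t k, t l & l0 ++ others] csg (full_perm Hl0)).
  by rewrite pair_sign_tperm // mulN1r.
have := congr1 (msym (tperm (t k) (t l))) (vandermonde_split Hl0).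
rewrite msymM V1 N1 mulNr => /oppr_inj; rewrite (vandermonde_split Hl0).
have N0 : wprod num [:: t k, t l & l0] != 0.
  have := color_vandermonde_neq0; rewrite (vandermonde_split Hl0).
  by apply: contraNneq => ->; rewrite mul0r.
by move=> /(mulfI N0) rE; rewrite /b msymM -rE a_sym.
Qed.

Let hat_sym : hat b \is symmetric.
Proof.
apply/issymP => g; have [ts -> _] := prod_tpermP g.
elim: ts => [|[k l] ts IHts]; first by rewrite big_nil msym1m.
by rewrite big_cons msymMm hat_tperm b_tperm.
Qed.

Let wheel_zero : subst wheel_point b *: serre_sum Phi p = 0.
Proof.
have H := wheel_annihilator p_neq0 char2 T_le3 family.
have := symmetric_action hat_sym H; rewrite hat_wheel hat_id => <-.
exact: serre_zero.
Qed.

Let shift : exponent N := \sum_(k < T) ue (t k).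

(* The exponents equal to [-1] in all the variables [t k]. *)
Let on_slice m := forall k, m (t k) = -1.

(** If [w] is not the last letter, some [t k] is, and has no negative powers. *)
Let Phi_last (s : nat) g m : (s < T)%N -> on_slice m -> Phi s g m = 0.
Proof.
move=> sT Hm.
have [e [i ei]] : exists e i, drop s (enum 'I_T) = rcons e i.
  have : (0 < size (drop s (enum 'I_T)))%N by rewrite size_drop size_enum_ord subn_gt0.
  by case/lastP: (drop _ _) => // e i _; exists e, i.
have ew : word s g = rcons (map (place g) ([seq Some i | i <- take s (enum 'I_T)] ++
    None :: map Some e)) (t (g i)).
  by rewrite /word /pattern ei map_rcons -rcons_cons -rcons_cat map_rcons.
have := word_uniq s g; rewrite /Phi ew => U.
by apply: expansion_last => //; rewrite Hm.
Qed.

Let lead_const : C := (\prod_(k < T) lead pole (t k) w) *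
  wprod (fun x y => (pole x y)^-1) (map t (enum 'I_T)).

Let Phi_lead g m : on_slice m ->
  Phi T g m = lead_const * @one_series C N (m + shift).
Proof.
move=> Hm; pose e := [seq t (g i) | i <- enum 'I_T].
have ew : word T g = rcons e w.
  rewrite /word /pattern take_oversize ?drop_oversize ?size_enum_ord //.
  by rewrite cats1 map_rcons -map_comp.
have pe : perm_eq e (map t (enum 'I_T)).
  rewrite /e (map_comp t g) perm_map //; apply: uniq_perm.
  - by rewrite (map_inj_uniq perm_inj) enum_uniq.
  - exact: enum_uniq.
  by move=> i; rewrite mem_enum; apply/mapP; exists (g^-1%g i); rewrite ?mem_enum ?permKV.
have ue' : uniq e by rewrite (perm_uniq pe) (map_inj_uniq t_inj) enum_uniq.
have in_e x : x \in e -> exists k, x = t k.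
  by move/mapP => [i _ ->]; exists (g i).
have := word_uniq T g; rewrite /Phi ew => U; rewrite (@expansion_lead _ _ pole same_color _ _ _ U).
- rewrite (perm_big _ pe) big_map big_enum /=.
  rewrite (wprod_perm (fun x y => congr1 GRing.inv (poleC x y)) pe ue').
  rewrite [X in m + X](perm_big _ pe) big_map big_enum /=.
  by rewrite /lead_const /one_series.
- by move=> x y /in_e [k ->] /in_e [l ->]; rewrite /same_color !t_col.
- by move=> x /in_e [k ->]; rewrite /same_color t_col w_col.
- by move=> x /in_e [k ->].
Qed.

Let lead_const_neq0 : lead_const != 0.
Proof.
rewrite mulf_neq0 //.
  apply/prodf_neq0 => k _; rewrite /lead.
  by case: ifP => _; rewrite ?oppr_eq0 invr_eq0 pole_neq0.
elim: (map _ _) => [|x s IHs] /=; first exact: oner_neq0.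
rewrite mulf_neq0 // prodf_seq_neq0; apply/allP => y _ /=.
by rewrite invr_eq0 pole_neq0.
Qed.

Lemma qbinomnn n : qbinom p n n = 1.
Proof.
elim: n => [|n IHn] //=.
by rewrite qbinom_small // mulr0 add0r subrr expr0z mul1r.
Qed.

(** Only the [T!] words with [w] last contribute. *)
Let serre_slice : exists2 c0 : C, c0 != 0 & forall m, on_slice m ->
  serre_sum Phi p m = c0 * @one_series C N (m + shift).
Proof.
exists ((-1) ^+ T * T`!%:R * lead_const) => [|m Hm].
  rewrite mulf_neq0 ?lead_const_neq0 // mulf_neq0 //.
    by rewrite expf_neq0 // oppr_eq0 oner_neq0.
  by have /pcharf0P -> := char0; rewrite -lt0n fact_gt0.
have -> : serre_sum Phi p m = \sum_(s < T.+1)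
    (-1) ^+ s * qbinom p T s * \sum_(g : 'S_T) Phi s g m.
  transitivity (\sum_(s < T.+1)
      (((-1) ^+ s * qbinom p T s)%:MP *: \sum_(g : 'S_T) Phi s g) m).
    exact: series_sumE.
  by apply: eq_bigr => s _; rewrite scaleCE series_sumE.
rewrite big_ord_recr /= big1 => [|s _]; last first.
  by rewrite big1 ?mulr0 // => g _; rewrite Phi_last.
rewrite add0r (eq_bigr (fun _ => lead_const * one_series C (m + shift))).
  rewrite sumr_const (_ : #|_| = T`!); last exact: card_Sn.
  by rewrite qbinomnn -[_ *+ T`!]mulr_natl; ring.
by move=> g _; apply: Phi_lead.
Qed.

(** The polynomials restricted to the wheel do not involve the variables [t k]. *)
Let subst_wheel_ind (H : series C N -> Prop) :
  H 0 -> (forall f g, H f -> H g -> H (f + g)) ->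
  (forall (c : C) f, H f -> H (c%:MP *: f)) ->
  (forall i f, (forall k, t k != i) -> H f -> H ('X_i *: f)) ->
  forall P f, H f -> H (subst wheel_point P *: f).
Proof.
move=> H0 HD HC HX P f Hf.
elim/mpolyind: P => [|c k P _ _ IHP]; first by rewrite rmorph0 scale0r.
rewrite rmorphD scalerDl; apply: (HD) => //=; rewrite substZ -mul_mpolyC -scalerA.
apply: (HC); rewrite mpolyXE_id rmorph_prod.
elim: (index_enum _) => [|i s IHs]; first by rewrite big_nil scale1r.
rewrite big_cons -scalerA; elim: (k i) => [|j IHj]; first by rewrite expr0 rmorph1 scale1r.
rewrite exprS rmorphM -scalerA /= substX; have [[l il]|Hi] := t_or_not i.
  have -> : wheel_point i = (wheel_ratio T p l)%:MP * 'X_w by rewrite il wheel_point_t.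
  rewrite -scalerA; apply: (HC); apply: (HX); [exact: t_neq_w|].
  exact: IHj.
by rewrite wheel_point_other //; apply: (HX).
Qed.

(** The restriction of [b] to the wheel does not shift the exponents of the
    [t k]; on the slice where these are [-1], the Serre sum is a monomial with an
    invertible coefficient, so that the product with it determines [b]. *)
Let wheel_b : subst wheel_point b = 0.
Proof.
set P := subst _ _; have [c0 c0_neq0 Hc0] := serre_slice.
have P_free k m : m (t k) != 0 -> ser P m = 0.
  move: m; rewrite /ser /P; apply: (subst_wheel_ind (H := fun f => forall m,
    m (t k) != 0 -> f m = 0)) => [|f g Hf Hg m mk|c f Hf m mk|i f ti Hf m mk|m mk] //.
  - by rewrite seriesDE Hf // Hg // addr0.
  - by rewrite scaleCE Hf ?mulr0.
  - by rewrite scaleXE Hf // !ffunE (negPf (ti k)) subr0.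
  by rewrite /one_series; case: eqP => // m0; rewrite m0 ffunE eqxx in mk.
pose S0 : series C N := fun m => @one_series C N (m + shift).
pose D : series C N := serre_sum Phi p - c0%:MP *: S0.
(* [D] vanishes on the slice, which [P] preserves. *)
have PD m : on_slice m -> (P *: D) m = 0.
  move: m; rewrite /P; apply: (subst_wheel_ind (H := fun f => forall m,
    on_slice m -> f m = 0)) => [|f g Hf Hg m mk|c f Hf m mk|i f ti Hf m mk|m mk] //.
  - by rewrite seriesDE Hf // Hg // addr0.
  - by rewrite scaleCE Hf ?mulr0.
  - rewrite scaleXE Hf // => k.
    by rewrite !ffunE (negPf (ti k)) subr0.
  by rewrite /D seriesDE seriesNE scaleCE Hc0 // subrr.
have Pshift m : (P *: S0) m = ser P (m + shift).
  rewrite /ser !scale_seriesE !mul_seriesE; apply: eq_bigr => k _.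
  by rewrite /S0 addrAC.
apply/mpolyP => mu; rewrite mcoeff0 -ser_coef.
have [/existsP [k mk]|] := boolP [exists k, mu (t k) != 0%N].
  by apply: (P_free k); rewrite ffunE.
rewrite negb_exists => /forallP Hmu.
have slice : on_slice (mexp mu - shift).
  move=> k; rewrite !ffunE (eqP (negbNE (Hmu k))) sum_ffunE (bigD1 k) //=.
  rewrite unit_expE eqxx big1 ?addr0 // => l lk.
  by rewrite unit_expE (inj_eq t_inj) eq_sym (negPf lk).
have := PD _ slice; rewrite /D scalerBr wheel_zero seriesDE seriesNE series0E sub0r.
rewrite scalerA [P * _]mulrC -scalerA scaleCE Pshift subrK => /eqP.
by rewrite oppr_eq0 mulf_eq0 (negPf c0_neq0) => /eqP.
Qed.

Lemma wheel_sub_neq0 x y : x != y -> (forall k, t k != y) -> w != y ->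
  subst wheel_point ('X_x - 'X_y) != 0.
Proof.
move=> xy yt yw.
rewrite rmorphB /= !substX (wheel_point_other yt).
have [[k ->]|xt] := t_or_not x.
  by rewrite wheel_point_t mul_mpolyC scaleX_sub_neq0.
by rewrite wheel_point_other // -['X_x]scale1r scaleX_sub_neq0.
Qed.

Let wheel_numer x y : x != y -> y \in others -> subst wheel_point (num x y) != 0.
Proof.
move=> xy yo; have yt k : t k != y.
  apply: contraTneq yo => <-; rewrite mem_filter negb_and negbK.
  by rewrite inE map_f ?orbT // mem_enum.
have yw : w != y.
  by apply: contraTneq yo => <-; rewrite mem_filter negb_and negbK mem_head.
have linx := wheel_sub_neq0 xy yt yw.
rewrite /numer; case: ifP => _; last by rewrite rmorph1 oner_neq0.
by case: ifP => _ //; rewrite -opprB rmorphN oppr_eq0.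
Qed.

(** The numerator [a] vanishes on the wheel, since the differences in [rest], which
    all involve a variable outside of the wheel, do not. *)
Theorem wheel_vanishing : subst wheel_point a = 0.
Proof.
have := wheel_b; rewrite /b rmorphM => /eqP; rewrite mulf_eq0 => /orP[|/eqP //].
rewrite /rest rmorphM mulf_eq0 => /orP[]; apply: contraTeq => _.
  rewrite rmorph_prod; rewrite prodf_seq_neq0; apply/allP => x xl /=; rewrite rmorph_prod.
  rewrite prodf_seq_neq0; apply/allP => y yo; apply: wheel_numer => //.
  by apply: contraTneq yo => <-; rewrite mem_filter xl.
have : uniq others by rewrite filter_uniq // enum_uniq.
have : {subset others <= others} by [].
rewrite rmorph_wprod; elim: {1 3 4}others => [|x s IHs] /=; first by rewrite oner_neq0.
move=> so /andP[xs us]; rewrite mulf_neq0 ?IHs // => [|y ys]; last first.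
  by apply: so; rewrite inE ys orbT.
rewrite prodf_seq_neq0; apply/allP => y ys; apply: wheel_numer; last first.
  by apply: so; rewrite inE ys orbT.
by apply: contraNneq xs => ->.
Qed.

End Wheel.

End Correlations.

(** * Permutation of the variables in a fraction *)

Section FractionRepr.
Import FracField.
Local Open Scope quotient_scope.
Variable R : idomainType.

Lemma frac_repr (F : {fraction R}) :
  F = (\n_(generic_quotient.repr F))%:F / (\d_(generic_quotient.repr F))%:F.
Proof.
set x := generic_quotient.repr F; have d0 : \d_x != 0 := denom_ratioP x.
have -> : F = \pi_(type R) x by rewrite generic_quotient.reprK.
rewrite /GRing.mul /GRing.inv /= !piE; apply/eqmodP.
rewrite /= /equivf /mulf /invf !numden_Ratio ?oner_neq0 ?mulf_neq0 ?oner_neq0 //.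
by rewrite mul1r mulr1 mulrC.
Qed.

End FractionRepr.

(** [perm_frac] does not depend on the representative of the fraction. *)
Lemma perm_frac_div (C : fieldType) N (s : 'S_N) (P Q : {mpoly C[N]}) : Q != 0 ->
  perm_frac s (P%:F / Q%:F) = (msym s P)%:F / (msym s Q)%:F.
Proof.
move=> Q0; have := frac_repr (P%:F / Q%:F); rewrite /perm_frac.
set x := generic_quotient.repr _ => e.
have d0 : \d_x != 0 := denom_ratioP x.
have s0 (f : {mpoly C[N]}) : f != 0 -> (msym s f)%:F != 0.
  by move=> f0; rewrite tofrac_eq0 -(msym0 _ s) (inj_eq (@inj_msym _ _ s)).
have tf (f : {mpoly C[N]}) : f != 0 -> f%:F != 0 by rewrite tofrac_eq0.
apply/eqP; rewrite eqr_div ?s0 //; apply/eqP; rewrite -!tofracM -!msymM.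
congr (_%:F); congr (msym s _); apply/eqP; rewrite -tofrac_eq !tofracM eq_sym.
by rewrite -eqr_div ?tf // e.
Qed.

(** * Bound on the entries of the Cartan matrix *)

Section CartanBound.
Variables (r : nat) (A : 'M[int]_r) (d : 'I_r -> nat).
Hypothesis hA : simple_cartan A d.

Let D a : int := (d a)%:Z.

Lemma sum_on_seq (V : nmodType) (I : finType) (s : seq I) (F : I -> V) : uniq s ->
  (forall i, i \notin s -> F i = 0) -> \sum_i F i = \sum_(i <- s) F i.
Proof.
move=> us H; rewrite (bigID (mem s)) /= [X in _ + X]big1 // addr0 -big_filter.
by apply: perm_big; apply: uniq_perm; rewrite ?filter_uniq ?index_enum_uniq // => i;
   rewrite mem_filter mem_index_enum andbT.
Qed.

(** Positivity of the invariant form on the combinations of some simple roots. *)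
Lemma cartan_form_pos (s : seq 'I_r) (x : 'I_r -> int) i0 : uniq s ->
  i0 \in s -> x i0 != 0 ->
  0 < \sum_(i <- s) \sum_(j <- s) D i * A i j * x i * x j.
Proof.
move=> us si0 xi0.
pose y : 'rV[int]_r := \row_j (if j \in s then x j else 0).
have y0 : y != 0.
  by apply: contraNneq xi0 => /rowP/(_ i0); rewrite !mxE si0 => ->.
have := cartan_finite hA y0.
rewrite (sum_on_seq us) => [|i si]; last first.
  by rewrite big1 // => j _; rewrite mxE (negPf si) mulr0 mul0r.
rewrite (eq_big_seq (fun i => \sum_(j <- s) D i * A i j * x i * x j)) // => i si.
rewrite (sum_on_seq us) => [|j sj]; last by rewrite [y _ j]mxE (negPf sj) mulr0.
by apply: eq_big_seq => j sj; rewrite !mxE si sj.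
Qed.

(** Positivity on [a] and [b] gives [a_ab a_ba < 4], so that [a_ab <= -3] only if
    [(a_ab, a_ba) = (-3, -1)].  A third simple root [c] linked to [a] or [b] would
    give a nonzero vector on which the form is not positive; there is none, and
    [A] is of type G2 by indecomposability. *)
Theorem cartan_offdiag_ge : ~ type_G2 A -> forall a b, a != b -> -2 <= A a b.
Proof.
move=> hG2 a b ab; rewrite leNgt; apply/negP => Aab.
have D_gt0 i : 0 < D i by rewrite /D ltz_nat (symmetrizer_pos hA).
have symD i j : D i * A i j = D j * A j i := symmetrizer_sym hA i j.
have diag i : A i i = 2 := cartan_diag hA i.
have off i j : i != j -> A i j <= 0 := @cartan_offdiag _ _ _ hA i j.
have ba : b != a by rewrite eq_sym.
have [Aab3 Aba1] : A a b = -3 /\ A b a = -1.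
  have U2 : uniq [:: a; b] by rewrite /= inE ab.
  have := @cartan_form_pos [:: a; b] (fun i => if i == a then - A a b else 2) b U2.
  rewrite !inE eqxx orbT (negPf ba) !big_cons !big_nil !eqxx (negPf ba) !diag.
  move=> /(_ isT isT).
  have := symD a b; have := off b a ba; have := D_gt0 a; have := D_gt0 b.
  move: (D a) (D b) (A a b) (A b a) Aab => Da Db m n m3 Db0 Da0 n0 sym H.
  have s2 : Db * n * m = Da * m * m by rewrite -sym.
  have H2 : n * m * Db < 4 * Db by nia.
  have H3 : n * m < 4 by rewrite -(ltr_pM2r Db0).
  have n1 : n = -1.
    have n_neq0 : n <> 0 by move=> n00; move: sym; rewrite n00; nia.
    nia.
  by split=> //; rewrite n1 in H3; lia.
have D3 : D b = 3 * D a by have := symD a b; rewrite Aab3 Aba1; lia.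
have pos3 c (s t u : int) : c != a -> c != b -> u != 0 ->
    0 < 2 * D a * s ^+ 2 + 6 * D a * t ^+ 2 - 6 * D a * s * t + 2 * D c * u ^+ 2
      + 2 * D a * A a c * s * u + 2 * D b * A b c * t * u.
  move=> ca cb u0; have U3 : uniq [:: a; b; c].
    by rewrite /= !inE negb_or ab eq_sym ca eq_sym cb.
  have := @cartan_form_pos _ (fun i => if i == a then s else if i == b then t else u) c U3.
  rewrite !inE eqxx !orbT (negPf ca) (negPf cb) => /(_ isT u0).
  rewrite !big_cons !big_nil !eqxx (negPf ba) (negPf ca) (negPf cb) !diag Aab3 Aba1.
  rewrite (mulrC (D c * A c a)) (mulrC (D c * A c b)) -(symD a c) -(symD b c) D3.
  by apply: etrans; congr (0 < _); ring.
have noc c : c != a -> c != b -> A a c = 0 /\ A b c = 0.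
  move=> ca cb; have ac : a != c by rewrite eq_sym.
  have bc : b != c by rewrite eq_sym.
  have z1' := @cartan_zero _ _ _ hA c a; have z2' := @cartan_zero _ _ _ hA c b.
  have [a0 b0] : A a c <= 0 /\ A b c <= 0 by split; apply: off.
  have sqr_ge x y u w : 0 < x -> 0 < y -> u < 0 -> w < 0 -> x * u = y * w ->
      x * y <= (x * u) ^+ 2 :> int.
    move=> x0 y0 u0 w0 e; rewrite expr2 {2}e mulrACA.
    by rewrite -[X in X <= _]mulr1 ler_wpM2l //; nia.
  have sqr_le (x y : int) : 0 <= - x -> - x <= y -> x ^+ 2 <= y ^+ 2 by rewrite !expr2; nia.
  pose G1 := - (2 * D a * A a c + D b * A b c).
  pose G2 := - (3 * D a * A a c + 2 * D b * A b c).
  have [Da0 Db0 Dc0] : [/\ 0 < D a, 0 < D b & 0 < D c] by split; apply: D_gt0.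
  split; apply/eqP; rewrite -[_ == 0]negbK; apply/negP => nz.
    have ac0 : A a c < 0 by rewrite lt_neqAle nz.
    have ca0 : A c a < 0.
      by rewrite lt_neqAle off // andbT; apply: contra nz => /eqP/z1' ->.
    have := sqr_ge _ _ _ _ Da0 Dc0 ac0 ca0 (symD a c).
    have G_ge : - (2 * D a * A a c) <= G1 by rewrite /G1; nia.
    have G_gt0 : 0 < G1 by apply: lt_le_trans G_ge; nia.
    (* A combination of [a] and [b] orthogonal to [b], and then the coordinate on
       [c] that minimizes the form. *)
    have := pos3 c (4 * D c) (2 * D c) G1 ca cb (lt0r_neq0 G_gt0).
    have -> : 2 * D a * (4 * D c) ^+ 2 + 6 * D a * (2 * D c) ^+ 2
      - 6 * D a * (4 * D c) * (2 * D c) + 2 * D c * G1 ^+ 2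
      + 2 * D a * A a c * (4 * D c) * G1 + 2 * D b * A b c * (2 * D c) * G1
      = 2 * D c * (4 * (D a * D c) - G1 ^+ 2) by rewrite /G1; ring.
    rewrite pmulr_rgt0; last by lia.
    have g_le0 : 0 <= - (2 * D a * A a c) by rewrite -mulrA -mulrN; nia.
    have := sqr_le _ _ g_le0 G_ge.
    rewrite !expr2 -[2 * D a * A a c]mulrA; move: (D a * A a c) (D a * D c) G1 {G_ge G_gt0 g_le0} => g e G.
    lia.
  have bc0 : A b c < 0 by rewrite lt_neqAle nz.
  have cb0 : A c b < 0.
    by rewrite lt_neqAle off // andbT; apply: contra nz => /eqP/z2' ->.
  have := sqr_ge _ _ _ _ Db0 Dc0 bc0 cb0 (symD b c).
  have G_ge : - (2 * D b * A b c) <= G2 by rewrite /G2; nia.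
  have G_gt0 : 0 < G2 by apply: lt_le_trans G_ge; nia.
  (* The same, with a combination of [a] and [b] orthogonal to [a]. *)
  have := pos3 c (6 * D c) (4 * D c) G2 ca cb (lt0r_neq0 G_gt0).
  have -> : 2 * D a * (6 * D c) ^+ 2 + 6 * D a * (4 * D c) ^+ 2
    - 6 * D a * (6 * D c) * (4 * D c) + 2 * D c * G2 ^+ 2
    + 2 * D a * A a c * (6 * D c) * G2 + 2 * D b * A b c * (4 * D c) * G2
    = 2 * D c * (12 * (D a * D c) - G2 ^+ 2) by rewrite /G2; ring.
  rewrite pmulr_rgt0; last by lia.
  have g_le0 : 0 <= - (2 * D b * A b c) by rewrite -mulrA -mulrN; nia.
  have := sqr_le _ _ g_le0 G_ge.
  have -> : 12 * (D a * D c) = 4 * (D b * D c) by rewrite D3; ring.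
  rewrite !expr2 -[2 * D b * A b c]mulrA; move: (D b * A b c) (D b * D c) G2 {G_ge G_gt0 g_le0} => g e G.
  lia.
have all_ab c : (c == a) || (c == b).
  have [ST|ST] := eqVneq [set a; b] [set: 'I_r].
    by have := in_setT c; rewrite -ST !inE.
  have S0 : [set a; b] != set0.
    by apply/negP => /eqP/setP/(_ a); rewrite !inE eqxx.
  have [i [e [iS eS ie]]] := cartan_indecomposable hA S0 ST.
  move: eS; rewrite !inE negb_or => /andP[ea eb]; have [ae be] := noc e ea eb.
  by move: iS ie; rewrite !inE => /orP[] /eqP ->; rewrite ?ae ?be eqxx.
apply: hG2; exists (fun c => if c == a then ord_max else ord0).
  exists (fun k : 'I_2 => if k == ord0 then b else a) => [c|k].
    by have := all_ab c; case: eqP => [->|_] //= /eqP ->.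
  by case: k => [[|[|//]] ?]; rewrite /= ?eqxx ?(negPf ba); apply: val_inj.
move=> i j; rewrite /G2_matrix mxE.
have := all_ab i; have := all_ab j.
case: (eqVneq i a) => [->|ia]; case: (eqVneq j a) => [->|ja] /=.
- by rewrite diag.
- by move=> /eqP -> _; rewrite Aab3.
- by move=> _ /eqP ->; rewrite Aba1.
- by move=> /eqP -> /eqP ->; rewrite diag.
Qed.

End CartanBound.

(** * Variables and their colors *)

Section ColoredVariables.
Variables (C : fieldType) (r : nat) (n : 'I_r -> nat).
Local Notation N := (nvars n).
Local Notation col := (@zcolor r n).

Lemma zcolor_zvar (a : 'I_r) (i : 'I_(n a)) : col (zvar i) = a.
Proof. exact: tagnat.Rank1K. Qed.

Lemma zvar_surj (x : 'I_N) : exists a (i : 'I_(n a)), x = zvar i.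
Proof. by exists (tagnat.sig1 x), (tagnat.sig2 x); rewrite /zvar tagnat.sig2K. Qed.

Lemma zvar_inj (a : 'I_r) : injective (@zvar r n a).
Proof.
move=> i j /(congr1 (@nat_of_ord _)) /eqP.
by rewrite /zvar tagnat.eq_Rank eqxx /= => /eqP/val_inj.
Qed.

Lemma lt_zvar (a b : 'I_r) (i : 'I_(n a)) (j : 'I_(n b)) :
  (zvar i < zvar j)%N = (a < b)%N || ((a == b) && (i < j)%N).
Proof.
have := tagnat.lt_rank (Tagged _ i) (Tagged (fun a => 'I_(n a)) j).
rewrite ltEsig /= !leEord !ltEord => ->.
case: (ltngtP a b) => [ab|ba|/val_inj eab] /=.
- by [].
- by case: eqP => // e; rewrite e ltnn in ba.
- by case: _ / eab j => j; rewrite eqxx /= tagged_asE.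
Qed.

Lemma zcolor_mono (x y : 'I_N) : (x <= y)%N -> (col x <= col y)%N.
Proof. exact: (@tagnat.le_sig1 _ n x y). Qed.

Lemma prod_zvar (R : comNzRingType) (F : 'I_N -> R) :
  \prod_(x < N) F x = \prod_(a < r) \prod_(i < n a) F (zvar i).
Proof.
rewrite (reindex _ tagnat.rank_bij_on) /= sig_big_dep /=.
by apply: eq_bigr => -[a i] _.
Qed.

(** The pairs of distinct variables, listed color by color. *)
Lemma prod_pairs (R : comNzRingType) (f : 'I_N -> 'I_N -> R) :
  \prod_(x < N) \prod_(y < N | (x < y)%N) f x y =
  \prod_(a < r) \prod_(b < r | (a <= b)%N)
    \prod_(i < n a) \prod_(j < n b | (a == b) ==> (i < j)%N) f (zvar i) (zvar j).
Proof.
rewrite prod_zvar; apply: eq_bigr => a _.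
rewrite (eq_bigr (fun i => \prod_(b < r) \prod_(j < n b)
    (if (zvar i < zvar j)%N then f (zvar i) (zvar j) else 1))); last first.
  by move=> i _; rewrite big_mkcond prod_zvar.
rewrite exchange_big /= [RHS]big_mkcond; apply: eq_bigr => b _.
case: ifP => ab; last first.
  rewrite big1 // => i _; rewrite big1 // => j _; rewrite lt_zvar ifF //.
  by rewrite -(val_eqE a b) /=; move: ab; case: ltngtP.
apply: eq_bigr => i _; rewrite [RHS]big_mkcond; apply: eq_bigr => j _.
rewrite lt_zvar -!(val_eqE a b) /=; congr (if _ then _ else _).
by move: ab; case: ltngtP.
Qed.

Variables (A : 'M[int]_r) (d : 'I_r -> nat) (q : C).
Local Notation dfac := (dfac (pole A d q col)).

Lemma diagonalsE cond : diagonals n A d q cond =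
  wprod (fun x y => if cond (col x) (col y) then dfac x y else 1) (enum 'I_N).
Proof.
rewrite wprod_enum.
rewrite (eq_bigr (fun x : 'I_N => \prod_(y < N | (x < y)%N)
    if cond (col x) (col y) then pole A d q col x y *: 'X_x - 'X_y else 1)); last first.
  by move=> x _; apply: eq_bigr => y xy; rewrite /dfac xy.
rewrite prod_pairs /diagonals; apply: eq_bigr => a _.
rewrite big_mkcondr; apply: eq_bigr => b _; case: ifP => ab; last first.
  by rewrite big1 // => i _; rewrite big1 // => j _; rewrite !zcolor_zvar ab.
apply: eq_bigr => i _; apply: eq_bigr => j _.
by rewrite /pole !zcolor_zvar ab.
Qed.

Lemma all_diagonalsE : all_diagonals n A d q = wprod dfac (enum 'I_N).
Proof. exact: diagonalsE. Qed.

Lemma vandermondeE : vandermonde C n = color_vandermonde C col.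
Proof.
rewrite /color_vandermonde wprod_enum prod_pairs; apply: eq_bigr => a _.
rewrite (bigD1 a) //= [X in _ = _ * X]big1 ?mulr1 => [|b /andP[_ ba]]; last first.
  rewrite big1 // => i _; rewrite big1 // => j _.
  by rewrite /numer /same_color !zcolor_zvar eq_sym (negPf ba).
apply: eq_bigr => i _; rewrite eqxx; apply: eq_bigr => j ij.
by rewrite /numer /same_color !zcolor_zvar eqxx lt_zvar eqxx ij orbT.
Qed.

End ColoredVariables.

Lemma lift_max_widen m (i : 'I_m) : lift ord_max i = widen_ord (leqnSn m) i.
Proof. by apply: val_inj; apply: lift_max. Qed.

(** The modes of the last current that do not kill [v] are bounded, and each of
    them gives a correlation series with one variable less. *)
Lemma iter_laurent_corr (C : fieldType) (r : nat) (V : lmodType C)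
    (X : drinfeld_ops r V) (pr : int -> {linear V -> V}) (i0 : int)
    (hgr : graded_module X pr i0) (xi : {scalar V}) N (col : 'I_N -> 'I_r) (v : V) dv :
  homogeneous pr dv v -> iter_laurent (word_corr X v xi col (enum 'I_N)).
Proof.
elim: N col v dv => [|N IHN] col v dv hv //=.
pose col' i := col (widen_ord (leqnSn N) i).
have corrE m k : word_corr X v xi col (enum 'I_N.+1) (extend_exponent m k) =
    word_corr X (e_op X (col ord_max) (- k) v) xi col' (enum 'I_N) m.
  rewrite /word_corr /word_act enum_ordSr map_rcons -cats1 /apply_word foldr_cat /=.
  rewrite /mode ffunE unlift_none -map_comp; congr (xi (foldr _ _ _)).
  by apply: eq_map => i; rewrite /= /mode ffunE -{2}lift_max_widen liftK.
split=> [|k].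
  exists (dv - i0) => m k hk; rewrite corrE.
  rewrite (_ : e_op X _ _ v = 0); first by rewrite /word_corr word_act0 linear0.
  apply: (homogeneous_gt0 hgr (j := dv - k)); last exact: (e_degree hgr).
  by lia.
have -> : (fun m => word_corr X v xi col (enum 'I_N.+1) (extend_exponent m k)) =
    word_corr X (e_op X (col ord_max) (- k) v) xi col' (enum 'I_N).
  by apply/funext => m; apply: corrE.
by apply: IHN; apply: (e_degree hgr) hv.
Qed.

(** * The correlation function *)

Section CorrelationFunction.
Variables (C : fieldType) (r : nat) (A : 'M[int]_r) (d : 'I_r -> nat) (q : C).
Hypothesis char0 : [pchar C] =i pred0.
Hypothesis hA : simple_cartan A d.
Hypothesis A_ge : forall a b, a != b -> -2 <= A a b.
Hypothesis q_neq0 : q != 0.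
Variables (V : lmodType C) (X : drinfeld_ops r V) (pr : int -> {linear V -> V}) (i0 : int).
Hypothesis hX : is_Uq_module A d q X.
Hypothesis hgr : graded_module X pr i0.
Variables (v : V) (xi : {scalar V}) (dv dx : int).
Hypothesis hv : homogeneous pr dv v.
Hypothesis hxi : forall j u, j != dx -> homogeneous pr j u -> xi u = 0.
Variable n : 'I_r -> nat.
Local Notation N := (nvars n).
Local Notation col := (@zcolor r n).
Local Notation corr := (word_corr X v xi col).
Local Notation f := (correlation n X xi v).
Local Notation dfac := (dfac (pole A d q col)).
Local Notation D := (all_diagonals n A d q).
Local Notation Vd := (vandermonde C n).

Let symA : forall a b, (d a)%:Z * A a b = (d b)%:Z * A b a := symmetrizer_sym hA.

Let char2 : 2 != 0 :> C.
Proof. by have /pcharf0P -> := char0. Qed.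

Lemma dfac_neq0 (x y : 'I_N) : x != y -> dfac x y != 0.
Proof.
move=> xy; rewrite /dfac; case: ifP => _; first exact: scaleX_sub_neq0.
by rewrite -opprB oppr_eq0 scaleX_sub_neq0.
Qed.

Lemma all_diagonals_neq0 : D != 0.
Proof.
rewrite all_diagonalsE wprod_enum prodf_seq_neq0; apply/allP => x _ /=.
rewrite prodf_seq_neq0; apply/allP => y _; apply/implyP => xy.
by apply: dfac_neq0; apply: contraTneq xy => ->; rewrite ltnn.
Qed.

Lemma all_vars_neq0 K : all_vars ^+ K != 0 :> {mpoly C[N]}.
Proof.
rewrite expf_neq0 // /all_vars prodf_seq_neq0; apply/allP => x _ /=.
by apply/eqP => /(congr1 (mcoeff U_(x))); rewrite mcoeffXU eqxx mcoeff0 => /eqP; rewrite oner_eq0.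
Qed.

(* The numerator provided by [word_corr_structure]. *)
Variables (K : nat) (a : {mpoly C[N]}).
Hypothesis a_corr : forall s, perm_eq s (enum 'I_N) ->
  all_vars ^+ K *: (wprod dfac s *: corr s) = ser (color_vandermonde C col * a).
Hypothesis a_sym : forall sg, color_preserving col sg -> msym sg a = a.

Let L := Laurent a K.
Let F : {fraction {mpoly C[N]}} := Vd%:F / D%:F * laurent_frac L.

Let F_def : F = (Vd * a)%:F / (D * all_vars ^+ K)%:F.
Proof.
by rewrite /F /laurent_frac /= -/all_vars !tofracM invfM; ring.
Qed.

Lemma correlation_expansion : expansion_of F f.
Proof.
split; first by apply: (iter_laurent_corr hgr); apply: hv.
exists (Vd * a), (D * all_vars ^+ K); split.
- by rewrite mulf_neq0 ?all_diagonals_neq0 ?all_vars_neq0.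
- exact: F_def.
move=> m; rewrite -!scale_seriesE -/(ser _) vandermondeE -(a_corr (perm_refl _)).
by rewrite -all_diagonalsE scalerA mulrC.
Qed.

Lemma correlation_simple_poles : simple_poles A d q F.
Proof.
exists (Laurent (Vd * a) K); rewrite F_def /laurent_frac /= -/all_vars !tofracM invfM.
by rewrite mulrAC -!mulrA mulVKf ?tofrac_eq0 ?all_diagonals_neq0 // mulrA.
Qed.

Lemma laurent_color_symmetric : color_symmetric L.
Proof. by move=> s hs; rewrite /perm_laurent /= a_sym. Qed.

Lemma correlation_twisted (c : 'I_r) (i j : 'I_(n c)) : j = i.+1 :> nat ->
  ((qroot d q c ^+ 2 *: zpoly C i - zpoly C j)%:F * F =
   (zpoly C i - qroot d q c ^+ 2 *: zpoly C j)%:F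
     * perm_frac (tperm (zvar i) (zvar j)) F) /\
  (mul_series (qroot d q c ^+ 2 *: zpoly C i - zpoly C j) f =1
   mul_series (zpoly C i - qroot d q c ^+ 2 *: zpoly C j)
     (perm_series (tperm (zvar i) (zvar j)) f)).
Proof.
move=> eij; set x := zvar i; set y := zvar j.
have exy : y = x.+1 :> nat by rewrite /x /y /zvar !tagnat.RankEsum eij addnS.
have xy : x != y by apply/eqP => e; have := exy; rewrite e => /n_Sn.
have [u [w [euw _]]] := enum_ord_adjacent exy.
have csg : color_preserving col (tperm x y).
  by move=> z; case: tpermP => [->|->|] //; rewrite !zcolor_zvar.
have U : uniq (u ++ x :: y :: w) by rewrite -euw enum_uniq.
have Qxy : pole A d q col x y = qroot d q c ^+ 2.
  by rewrite /pole !zcolor_zvar (cartan_diag hA).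
have dxy : dfac x y = qroot d q c ^+ 2 *: zpoly C i - zpoly C j.
  by rewrite /dfac exy ltnSn Qxy.
have dyx : dfac y x = zpoly C i - qroot d q c ^+ 2 *: zpoly C j.
  by rewrite /dfac exy ltnNge leqnSn /= (poleC q symA) Qxy.
have sgu z : z \in u -> z != x /\ z != y.
  move=> zu; move: U; rewrite cat_uniq => /and3P[_ /hasPn H _].
  split; apply: contraTneq zu => ->; apply: H; rewrite !inE eqxx ?orbT //.
have sgw z : z \in w -> z != x /\ z != y.
  move=> zw; move: U; rewrite cat_uniq => /and3P[_ _ /= /and3P[]].
  rewrite inE negb_or => /andP[_ xw] yw _.
  by split; [apply: contraNneq xw|apply: contraNneq yw] => <-.
have smap s : {in s, forall z, z != x /\ z != y} -> map (tperm x y) s = s.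
  move=> H; rewrite -[RHS]map_id; apply/eq_in_map => z sz.
  by have [zx zy] := H z sz; rewrite tpermD // eq_sym.
have swap : map (tperm x y) (enum 'I_N) = u ++ y :: x :: w.
  by rewrite euw map_cat /= tpermL tpermR !smap.
rewrite -dxy -dyx; split; last first.
  move=> m; rewrite -!scale_seriesE -[f]/(corr (enum 'I_N)) perm_word_corr // swap euw.
  by rewrite (word_corr_exchange symA hX v xi col U).
rewrite F_def perm_frac_div ?mulf_neq0 ?all_diagonals_neq0 ?all_vars_neq0 //.
rewrite !msymM msym_all_vars a_sym // vandermondeE.
pose S := wprod (@pair_sign C N (tperm x y)) (enum 'I_N).
have -> : msym (tperm x y) (color_vandermonde C col) = S * color_vandermonde C col.
  by apply: msym_vandermonde (perm_refl _) => //; apply: zcolor_mono.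
have DE := all_diagonalsE n A d q.
have D' : msym (tperm x y) D = S * wprod dfac (u ++ y :: x :: w).
  rewrite DE msym_wprod -?swap // => z1 z2.
  exact: msym_dfac.
have swapE : wprod dfac (u ++ y :: x :: w) * dfac x y = D * dfac y x.
  by rewrite DE euw !wprod_pair wrestC; ring.
have S0 : S != 0 by apply: pair_sign_neq0.
have D'0 : wprod dfac (u ++ y :: x :: w) != 0.
  apply: contraTneq isT => D0; have := swapE; rewrite D0 mul0r => /esym/eqP.
  by rewrite mulf_eq0 (negPf all_diagonals_neq0) (negPf (dfac_neq0 _)) // eq_sym.
rewrite D' !mulrA; apply/eqP.
rewrite eqr_div ?tofrac_eq0 ?mulf_neq0 ?all_diagonals_neq0 ?all_vars_neq0 //.
rewrite -!tofracM tofrac_eq; apply/eqP.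
transitivity (color_vandermonde C col * a * S * all_vars ^+ K
   * (wprod dfac (u ++ y :: x :: w) * dfac x y)); first by ring.
by rewrite swapE; ring.
Qed.

(** A point of the torus satisfying the equations of the wheel is a value of
    [wheel_point], so the restriction to the wheel determines the value there. *)
Lemma meval_wheel_point (ca cb : 'I_r) (j : 'I_(n cb))
    (t : 'I_`|1 - A ca cb| -> 'I_(n ca)) (z : 'I_N -> C) (g : {mpoly C[N]}) :
  ca != cb -> injective t ->
  (forall k : 'I_`|1 - A ca cb|,
     qroot d q ca ^+ (2 * k) * z (zvar (t k)) = qroot d q ca ^ (- A ca cb) * z (zvar j)) ->
  subst (wheel_point d q ca (zvar j) (fun k => zvar (t k))) g = 0 -> g.@[z] = 0.
Proof.
move=> cab t_inj Hz /(congr1 (meval z)); rewrite meval0 meval_subst => <-.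
have t_inj' : injective (fun k => zvar (t k)) by move=> k l /zvar_inj/t_inj.
have p0 : qroot d q ca != 0 by rewrite expf_neq0.
apply: meval_eq => x.
have [/existsP [k /eqP <-]|] := boolP [exists k, zvar (t k) == x]; last first.
  rewrite negb_exists => /forallP H.
  by rewrite wheel_point_other // mevalXU.
rewrite (wheel_point_t _ _ _ _ t_inj') mevalM mevalC mevalXU.
apply: (mulfI (expf_neq0 (2 * k) p0)); rewrite Hz /wheel_ratio mulrA.
rewrite mulrCA mulfV ?expf_neq0 // mulr1; congr (_ * _).
have A0 := @cartan_offdiag _ _ _ hA ca cb cab.
by rewrite -[RHS]/(_ ^ (_ : nat)%:Z); congr (_ ^ _); lia.
Qed.

Lemma wheel_vanishing_zvar (ca cb : 'I_r) (j : 'I_(n cb)) T (t : 'I_T -> 'I_(n ca)) :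
  T = `|1 - A ca cb|%N -> ca != cb -> injective t ->
  subst (wheel_point d q ca (zvar j) (fun k => zvar (t k))) a = 0.
Proof.
move=> eT cab t_inj; have A0 := @cartan_offdiag _ _ _ hA ca cb cab.
have A2 := A_ge cab.
apply: (wheel_vanishing symA q_neq0 hX hgr hv _ char2 eT _ cab A0 _ _ _ _ char0
  a_corr a_sym).
- exact: zcolor_mono.
- exact: cartan_diag hA _.
- by rewrite eT; lia.
- by move=> k l /zvar_inj/t_inj.
- by move=> k; apply: zcolor_zvar.
- exact: zcolor_zvar.
Qed.

Lemma laurent_vanishing (ca cb : 'I_r) : ca != cb -> vanishing A d q L ca cb.
Proof.
move=> cab j t z t_inj z0 Hz; rewrite /laurent_eval /=.
by rewrite (meval_wheel_point cab t_inj Hz) ?mul0r // wheel_vanishing_zvar.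
Qed.

(** The pairs of variables of colors [a] and [b] with [a_ab = 0]; their linear form
    is [z_x - z_y]. *)
Definition unlinked : seq ('I_N * 'I_N) :=
  [seq e : 'I_N * 'I_N <- enum {: 'I_N * 'I_N} |
    (e.1 < e.2)%N && (A (col e.1) (col e.2) == 0)].

Let unlinked_prod : {mpoly C[N]} := \prod_(e <- unlinked) ('X_(e.1) - 'X_(e.2)).

Lemma all_diagonals_linked : D = linked_diagonals n A d q * unlinked_prod.
Proof.
rewrite /linked_diagonals !diagonalsE all_diagonalsE.
have -> : unlinked_prod = wprod (fun x y =>
    if A (col x) (col y) == 0 then dfac x y else 1) (enum 'I_N).
  rewrite wprod_enum pair_big_dep /unlinked_prod big_filter big_enum_cond /=.
  rewrite [LHS]big_mkcond [RHS]big_mkcond /=; apply: eq_bigr => e _.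
  case: ifP => [/andP[xy A0]|].
    by rewrite xy A0 /dfac xy /pole (eqP A0) expr0z scale1r.
  by case: ifP => //= _ ->.
rewrite -wprodM; apply: eq_wprod => x y _ _.
by case: eqP => _; rewrite ?mulr1 ?mul1r.
Qed.

Lemma divide_unlinked : exists a', a = unlinked_prod * a'.
Proof.
apply: divide_pairs => [|[x y]]; first by rewrite filter_uniq // enum_uniq.
rewrite mem_filter /= => /andP[/andP[xy /eqP A0] _]; split=> //.
have [c [i ex]] := zvar_surj x; have [c' [j ey]] := zvar_surj y.
rewrite ex ey !zcolor_zvar in A0 *.
have cc' : c != c'.
  by apply: contra_eqN A0 => /eqP <-; rewrite (cartan_diag hA).
have inj1 : injective (fun _ : 'I_1 => i) by move=> k l _; rewrite [k]ord1 [l]ord1.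
have := wheel_vanishing_zvar j (t := fun _ : 'I_1 => i) _ cc' inj1; rewrite A0 => /(_ erefl) <-.
apply: (mpoly_morph_eq (F := identify (zvar i) (zvar j))
  (G := subst (wheel_point d q c (zvar j) (fun _ : 'I_1 => zvar i)))) => [e|z] /=.
  by rewrite /identify !substC.
rewrite /identify !substX; case: eqP => [->|/eqP zi]; last first.
  by rewrite wheel_point_other // => _; rewrite eq_sym.
have inj2 : injective (fun _ : 'I_1 => zvar i) by move=> k l _; rewrite [k]ord1 [l]ord1.
have := wheel_point_t d q c (zvar j) inj2 ord0 => ->.
by rewrite /wheel_ratio /= !expr0 divr1 mpolyC1 mul1r.
Qed.

(** If [a_ab <> 0], no pair of variables of colors [a] and [b] is unlinked, so that
    the differences of the unlinked variables do not vanish identically on the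
    wheel, and the quotient of [a] by them inherits its vanishing conditions. *)
Theorem linked_form : exists M : laurent C N,
  F = Vd%:F / (linked_diagonals n A d q)%:F * laurent_frac M /\
  forall ca cb : 'I_r, ca != cb -> A ca cb != 0 -> vanishing A d q M ca cb.
Proof.
have [a' ea] := divide_unlinked; exists (Laurent a' K).
have := all_diagonals_neq0; rewrite all_diagonals_linked mulf_eq0 negb_or.
case/andP=> L0 U0; split.
  rewrite /F /laurent_frac /= -/all_vars all_diagonals_linked ea !tofracM invfM.
  have tU : unlinked_prod%:F != 0 by rewrite tofrac_eq0.
  by rewrite -!mulrA mulKf.
move=> ca cb cab Aab j t z t_inj z0 Hz; rewrite /laurent_eval /=.
rewrite (meval_wheel_point cab t_inj Hz) ?mul0r //.
have t_inj' : injective (fun k => zvar (t k)) by move=> k l /zvar_inj/t_inj.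
have := wheel_vanishing_zvar j (t := t) erefl cab t_inj; rewrite ea rmorphM /= => /eqP.
rewrite mulf_eq0 => /orP[|/eqP //]; rewrite /unlinked_prod rmorph_prod.
rewrite prodf_seq_eq0 => /hasP [[x y]]; rewrite mem_filter /= => /andP[/andP[xy A0] _].
have nxy : x != y by apply: contraTneq xy => ->; rewrite ltnn.
have Aba : A cb ca != 0 by apply: contra Aab => /eqP/(cartan_zero hA) ->.
pose local u := [exists k, zvar (t k) == u] || (zvar j == u).
have local_col u : local u -> col u = ca \/ col u = cb.
  by case/orP => [/existsP [k /eqP <-]|/eqP <-]; rewrite zcolor_zvar; [left|right].
have not_local u : ~~ local u -> (forall k, zvar (t k) != u) /\ zvar j != u.
  by rewrite negb_or negb_exists => /andP[/forallP].
have [lx|/not_local [xt xj]] := boolP (local x); last first.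
  rewrite -(opprB 'X_y 'X_x) rmorphN /= oppr_eq0 => H; exfalso; move: H; apply/negP.
  by apply: wheel_sub_neq0 => //; rewrite eq_sym.
have [ly|/not_local [yt yj]] := boolP (local y); last first.
  by move=> H; exfalso; move: H; apply/negP; apply: wheel_sub_neq0.
by move: A0; case: (local_col x lx) => ->; case: (local_col y ly) => ->;
  rewrite ?(cartan_diag hA) ?(negPf Aab) ?(negPf Aba).
Qed.

End CorrelationFunction.

Theorem theorem0p2
    (R : realType) (r : nat) (A : 'M[int]_r) (d : 'I_r -> nat)
    (hA : simple_cartan A d) (hG2 : ~ type_G2 A)
    (q : R[i]) (hq : q != 0)
    (V : lmodType R[i]) (X : drinfeld_ops r V) (pr : int -> {linear V -> V})
    (hV : highest_weight_module A d q X pr)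
    (v : V) (hv : weight_vector X pr v)
    (xi : {scalar V}) (hxi : weight_form X pr xi)
    (n : 'I_r -> nat) :
  let f : series R[i] (nvars n) := correlation n X xi v in
  iter_laurent f /\
  exists F : {fraction {mpoly R[i][nvars n]}},
    [/\ expansion_of F f,
        simple_poles A d q F,
        (forall (a : 'I_r) (i j : 'I_(n a)), j = i.+1 :> nat ->
           ((qroot d q a ^+ 2 *: zpoly R[i] i - zpoly R[i] j)%:F * F =
            (zpoly R[i] i - qroot d q a ^+ 2 *: zpoly R[i] j)%:F
              * perm_frac (tperm (zvar i) (zvar j)) F) /\
           (mul_series (qroot d q a ^+ 2 *: zpoly R[i] i - zpoly R[i] j) f =1
            mul_series (zpoly R[i] i - qroot d q a ^+ 2 *: zpoly R[i] j)
              (perm_series (tperm (zvar i) (zvar j)) f))) &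
        (exists L : laurent R[i] (nvars n),
           [/\ color_symmetric L,
               F = (vandermonde R[i] n)%:F / (all_diagonals n A d q)%:F
                   * laurent_frac L &
               forall a b : 'I_r, a != b -> vanishing A d q L a b]) /\
        (exists M : laurent R[i] (nvars n),
           F = (vandermonde R[i] n)%:F / (linked_diagonals n A d q)%:F
               * laurent_frac M /\
           forall a b : 'I_r, a != b -> A a b != 0 -> vanishing A d q M a b)].
Proof.
move=> f; have [hU [i0 [v0 [hgr _ _ _]]]] := hV.
have [[dv hdv] _] := hv; have [[dx hdx] _] := hxi.
have char0 : [pchar R[i]] =i pred0 by apply: pchar_num.
have char2 : 2 != 0 :> R[i] by have /pcharf0P -> := char0.
have A_ge := cartan_offdiag_ge hA hG2.
have [K [a [a_corr a_sym]]] := word_corr_structure (symmetrizer_sym hA) hq hU hgr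
  hdv hdx (@zcolor_mono _ n) char2.
have exp_f := correlation_expansion hgr hdv a_corr.
split; first by case: exp_f.
exists ((vandermonde R[i] n)%:F / (all_diagonals n A d q)%:F * laurent_frac (Laurent a K)).
split=> //.
- exact: (correlation_simple_poles A d q K a).
- by move=> b i j; exact: (correlation_twisted hA hU v xi K a_sym).
split; last exact: (linked_form char0 hA A_ge hq hU hgr hdv a_corr a_sym).
exists (Laurent a K); split=> //; first exact: (laurent_color_symmetric K a_sym).
exact: (laurent_vanishing char0 hA A_ge hq hU hgr hdv a_corr a_sym).
Qed.
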